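(* Consider the class $\mathcal{C}$ of all planar discontinuous piecewise linear differential systems $Z=(X,Y)$ with two pieces separated by a straight line $\Sigma$ (as described in the context) such that one of the two linear differential systems $X$, $Y$ (extended to the full plane) has its equilibrium point on the straight line of separation $\Sigma$. Let $N$ be the maximum number of limit cycles that a system in $\mathcal{C}$ can have, where the limit cycles counted are the non-sliding limit cycles surrounding a unique equilibrium point or a unique sliding segment. Then $$2\le N\le 3,$$ that is, every system in $\mathcal{C}$ has at most $3$ such limit cycles, and there exists a system in $\mathcal{C}$ having at least $2$ such limit cycles.
   Context: A planar discontinuous piecewise linear differential system with two pieces separated by a straight line is given as follows. Without loss of generality the separation line is $\Sigma=\{(x,y)\in\mathbb{R}^2: x=0\}$, and the two pieces are the half-planes $S^-=\{(x,y)\in\mathbb{R}^2: x\le 0\}$ and $S^+=\{(x,y)\in\mathbb{R}^2: x\ge 0\}$. The system is denoted $Z=(X,Y)$, where $$X(\mathbf{x})=A^-\mathbf{x}+\mathbf{b}^- \ \text{ governs the dynamics in } S^-,\qquad Y(\mathbf{x})=A^+\mathbf{x}+\mathbf{b}^+\ \text{ governs the dynamics in } S^+,$$ with $A^\pm$ real $2\times 2$ matrices and $\mathbf{b}^\pm\in\mathbb{R}^2$; discontinuous means that $X$ and $Y$ do not coincide on all of $\Sigma$. Standing assumption: each of the two linear differential systems $\dot{\mathbf{x}}=X(\mathbf{x})$ and $\dot{\mathbf{x}}=Y(\mathbf{x})$, extended to the full plane, has as its equilibrium point a focus (centers are included among the foci), or a node (with distinct eigenvalues, or with equal eigenvalues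 and diagonalizable or non-diagonalizable linear part), or a saddle. In particular each has a unique equilibrium point in $\mathbb{R}^2$. The equilibrium point of one of the two linear systems is called real if it belongs to the closure of the half-plane where that system governs the dynamics, and virtual otherwise. Following Filippov, one distinguishes three open regions in $\Sigma$: (1) the sliding region $\Sigma^{sl}$, the points $p\in\Sigma$ at which the vectors $X(p)$ and $Y(p)$ both point inward $\Sigma$ (i.e. for $\Sigma=\{x=0\}$, the first component of $X(p)$ is positive and the first component of $Y(p)$ is negative); (2) the escaping region $\Sigma^{e}$, the points $p\in\Sigma$ at which $X(p)$ and $Y(p)$ both point outward $\Sigma$ (the first component of $X(p)$ is negative and that of $Y(p)$ is positive); (3) the sewing region $\Sigma^{s}$, the points $p\in\Sigma$ at which $X(p)$ and $Y(p)$ are transverse to $\Sigma$ and point to the same side (the first components of $X(p)$ and $Y(p)$ have the same nonzero sign). Orbits of $Z$ follow orbits of $X$ in $S^-$ and orbits of $Y$ in $S^+$, and cross $\Sigma$ at sewing points by concatenation. Any segment contained in $\Sigma^e\cup\Sigma^{sl}$ is called a sliding segment. A limit cycle of $Z$ is a periodic orbit of $Z$ that is isolated in the set of all periodic orbits of $Z$. A limit cycle $\gamma$ of $Z$ is called non-sliding if $\gamma\cap(\Sigma^e\cup\Sigma^{sl})=\emptyset$. Throughout, only non-sliding limit cycles surrounding (i.e. enclosing in the bounded region they delimit) a unique equilibrium point or a unique sliding segment are considered. *)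

(* Defs.v *)
From HB Require Import structures.
From mathcomp Require Import all_boot all_order all_algebra.
From mathcomp Require Import all_classical all_reals all_analysis.
From mathcomp.real_closed Require Import complex.
Set Implicit Arguments.
Unset Strict Implicit.
Unset Printing Implicit Defensive.
Import Order.TTheory GRing.Theory Num.Theory.
Import numFieldNormedType.Exports.
Local Open Scope classical_set_scope.
Local Open Scope card_scope.
Local Open Scope ring_scope.

Record pwl_system (R : realType) := PwlSystem {
  Aminus : 'M[R]_2; bminus : 'cV[R]_2;
  Aplus : 'M[R]_2; bplus : 'cV[R]_2 }.

Section PiecewiseLinear.
Context {R : realType}.
Implicit Types (Z : pwl_system R) (p : 'cV[R]_2) (g : set 'cV[R]_2).

Definition fieldX Z p : 'cV[R]_2 := Aminus Z *m p + bminus Z.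
Definition fieldY Z p : 'cV[R]_2 := Aplus Z *m p + bplus Z.

Definition xcoord p : R := p 0 0.

Definition Sigma : set 'cV[R]_2 := [set p | xcoord p = 0].
Definition Sminus : set 'cV[R]_2 := [set p | xcoord p <= 0].
Definition Splus : set 'cV[R]_2 := [set p | 0 <= xcoord p].

(* The type of the equilibrium of x' = A x + b is read off the eigenvalues of
   its linear part A.  Zero trace is allowed for a focus (that is, a center). *)
Definition is_focus (A : 'M[R]_2) : Prop :=
  exists a b : R, b != 0 /\
    eigenvalue (map_mx (real_complex R) A) (Complex a b).
(* l = m is allowed, and then A may be diagonalizable or not. *)
Definition is_node (A : 'M[R]_2) : Prop :=
  exists l m : R, 0 < l * m /\ char_poly A = ('X - l%:P) * ('X - m%:P).
Definition is_saddle (A : 'M[R]_2) : Prop :=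
  exists l m : R, l * m < 0 /\ char_poly A = ('X - l%:P) * ('X - m%:P).
Definition focus_node_or_saddle (A : 'M[R]_2) : Prop :=
  is_focus A \/ is_node A \/ is_saddle A.

Definition discontinuous Z : Prop :=
  exists2 p, Sigma p & fieldX Z p <> fieldY Z p.

Definition sliding_region Z : set 'cV[R]_2 :=
  [set p | [/\ Sigma p, 0 < xcoord (fieldX Z p) & xcoord (fieldY Z p) < 0]].
Definition escaping_region Z : set 'cV[R]_2 :=
  [set p | [/\ Sigma p, xcoord (fieldX Z p) < 0 & 0 < xcoord (fieldY Z p)]].
Definition sewing_region Z : set 'cV[R]_2 :=
  [set p | Sigma p /\ 0 < xcoord (fieldX Z p) * xcoord (fieldY Z p)].

(* Filippov's sliding field: the convex combination of X p and Y p that is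
   tangent to Sigma, meaningful on the sliding and escaping regions. *)
Definition sliding_field Z p : 'cV[R]_2 :=
  (xcoord (fieldY Z p) - xcoord (fieldX Z p))^-1 *:
    (xcoord (fieldY Z p) *: fieldX Z p - xcoord (fieldX Z p) *: fieldY Z p).

Inductive mode := ModeX | ModeY | ModeSliding.

Definition mode_domain Z (m : mode) : set 'cV[R]_2 :=
  match m with
  | ModeX => Sminus
  | ModeY => Splus
  | ModeSliding => sliding_region Z `|` escaping_region Z
  end.

Definition mode_field Z (m : mode) : 'cV[R]_2 -> 'cV[R]_2 :=
  match m with
  | ModeX => fieldX Z
  | ModeY => fieldY Z
  | ModeSliding => sliding_field Z
  end.

Definition follows Z (m : mode) (phi : R -> 'cV[R]_2) (a b : R) : Prop :=
  forall s, a < s < b ->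
    mode_domain Z m (phi s) /\ is_derive s (1 : R) phi (mode_field Z m (phi s)).

(* The two fields may be concatenated with one another only at sewing points;
   the other switches are those by which a sliding motion starts or ends. *)
Definition may_switch Z (m1 m2 : mode) p : Prop :=
  match m1, m2 with
  | ModeX, ModeY | ModeY, ModeX => sewing_region Z p
  | _, _ => True
  end.

(* Near each time t the motion obeys one mode before t and one mode after t;
   equal modes on both sides mean that t is not a switching time.  In
   particular, an orbit of X may touch Sigma tangentially from within Sminus. *)
Definition trajectory Z (phi : R -> 'cV[R]_2) : Prop :=
  continuous phi /\
  forall t, exists e m1 m2,
    [/\ 0 < e, follows Z m1 phi (t - e) t, follows Z m2 phi t (t + e)
      & may_switch Z m1 m2 (phi t)].

(* Orbits are considered as subsets of the plane; a constant motion is not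
   a periodic orbit. *)
Definition periodic_orbit Z g : Prop :=
  exists phi (T : R),
    [/\ trajectory Z phi, 0 < T, forall t, phi (t + T) = phi t,
        exists t, phi t <> phi 0 & g = range phi].

Definition limit_cycle Z g : Prop :=
  periodic_orbit Z g /\
  exists U : set 'cV[R]_2, [/\ open U, g `<=` U
    & forall g', periodic_orbit Z g' -> g' `<=` U -> g' = g].

Definition non_sliding Z g : Prop :=
  g `&` (escaping_region Z `|` sliding_region Z) = set0.

(* The union of the bounded components of the complement of g. *)
Definition enclosed g : set 'cV[R]_2 :=
  [set p | ~ g p /\ bounded_set (connected_component (~` g) p)].

(* Only real equilibria are equilibria of Z. *)
Definition equilibrium_point Z p : Prop :=
  (fieldX Z p = 0 /\ Sminus p) \/ (fieldY Z p = 0 /\ Splus p).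

(* Maximal sliding segments, since every subsegment of a sliding segment is
   again one and uniqueness would otherwise never hold. *)
Definition sliding_segment Z (s : set 'cV[R]_2) : Prop :=
  exists2 p, (escaping_region Z `|` sliding_region Z) p
    & s = connected_component (escaping_region Z `|` sliding_region Z) p.

Definition surrounds_unique_equilibrium Z g : Prop :=
  exists! p, equilibrium_point Z p /\ enclosed g p.
Definition surrounds_unique_sliding_segment Z g : Prop :=
  exists! s, sliding_segment Z s /\ s `<=` enclosed g.

Definition counted_limit_cycles Z : set (set 'cV[R]_2) :=
  [set g | [/\ limit_cycle Z g, non_sliding Z g
    & surrounds_unique_equilibrium Z g \/
      surrounds_unique_sliding_segment Z g]].

Definition class_C Z : Prop :=
  [/\ discontinuous Z,
      focus_node_or_saddle (Aminus Z), focus_node_or_saddle (Aplus Z)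
    & exists2 p, Sigma p & fieldX Z p = 0 \/ fieldY Z p = 0].

End PiecewiseLinear.

Definition max_limit_cycles (R : realType) (N : nat) : Prop :=
  (forall Z : pwl_system R, class_C Z -> counted_limit_cycles Z #<= `I_N) /\
  (exists2 Z : pwl_system R, class_C Z & counted_limit_cycles Z #= `I_N).

(* Main.v *)
(* Reflecting in Sigma if necessary, assume that Y has its centre q on Sigma.
   Then a Y-arc in [0 <= x] with both ends on Sigma exists only for a focus,
   takes half a turn, and multiplies [y - q] by [- c] for a constant [c > 0].
   An X-arc in [x <= 0] starts with [x' = v < 0], ends with [x' = w > 0] after a
   time tau, and [v], [w] are explicit functions [Vf], [Uf] of tau.  The map
   [v -> w] is decreasing, so the return map is increasing and every crossing
   cycle crosses Sigma exactly twice; such cycles correspond to the zeros of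
   [Vf + c Uf - k (1 + c)].  By Rolle's theorem this function has at most three
   zeros unless it vanishes identically, and then the cycles form a continuous
   family and none of them is isolated.  Cycles on one side of Sigma lie in the
   continuous family of a linear centre and are not isolated either.

   For the lower bound, a node with eigenvalue ratio 2 is glued to a focus so
   that the times of the X-arcs are [ln 2] and [ln 4]. *)

(* The bound three comes from two differentiations. For [d != 0] the derivative of the displacement
   is a function without zeros times some [m], and [m'] is [S t] times [expR (- T * t) - c]. The
   last factor has at most one zero unless [T = 0] and [c = 1]; in that case the Wronskian identity
   gives [Vf + Uf = 0] and a cycle forces [k = 0].

   The obstacle before the calculus is that a periodic orbit may graze Sigma or, a priori, obey both
   fields at once. Discontinuity excludes the latter for nonconstant motions; then the position
   together with the side followed next determines the future, which the position alone does not.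

   Isolation is among all periodic orbits, sliding ones included. To refute it, one nearby cycle
   suffices; to prove it for the example, the neighbourhood avoids a closed segment containing all
   sliding and escaping points.

   In the example an X-arc of time [ln z] has [v = 1/z - 1] and [w = z - 1], so closing up means
   [c z^2 - (1 + k)(1 + c) z + 1 = 0]. Prescribing the roots 2 and 4 gives [c = 1/8] and
   [k = - 1/3]. *)
Require Import Defs.
From mathcomp Require Import all_boot all_order all_algebra.
From mathcomp Require Import all_classical all_reals all_analysis.
From mathcomp Require Import ring lra.
From mathcomp.real_closed Require Import complex.
Set Implicit Arguments.
Unset Strict Implicit.
Unset Printing Implicit Defensive.
Import Order.TTheory GRing.Theory Num.Theory.
Import numFieldNormedType.Exports.
Local Open Scope classical_set_scope.
Local Open Scope card_scope.
Local Open Scope ring_scope.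

(** * Calculus on the real line *)

Section Calculus.
Context {R : realType}.
Implicit Types (f g : R -> R) (x a b : R).

Notation deriv1 f x d := (is_derive x (1 : R) f d).

Lemma deriv1_eq f x d d' : deriv1 f x d -> d = d' -> deriv1 f x d'.
Proof. by move=> h <-. Qed.

Lemma deriv1D f g x df dg : deriv1 f x df -> deriv1 g x dg ->
  deriv1 (fun s => f s + g s) x (df + dg).
Proof. by move=> hf hg; exact: is_deriveD. Qed.

Lemma deriv1N f x df : deriv1 f x df -> deriv1 (fun s => - f s) x (- df).
Proof. by move=> hf; exact: is_deriveN. Qed.

Lemma deriv1M f g x df dg : deriv1 f x df -> deriv1 g x dg ->
  deriv1 (fun s => f s * g s) x (df * g x + f x * dg).
Proof.
move=> hf hg; have := @is_deriveM R R^o f g x 1 df dg hf hg.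
by rewrite /GRing.scale /= addrC [g x * df]mulrC.
Qed.

Lemma deriv1_cst (k x : R) : deriv1 (fun=> k) x 0.
Proof. exact: is_derive_cst. Qed.

Lemma deriv1_id (x : R) : deriv1 (fun s => s) x 1.
Proof. exact: is_derive_id. Qed.

Lemma deriv1V f x df : f x != 0 -> deriv1 f x df ->
  deriv1 (fun s => (f s)^-1) x (- df / f x ^+ 2).
Proof.
move=> f0 [h1 h2]; split; first exact: derivableV.
by rewrite deriveV// h2 /GRing.scale /= mulNr mulrC mulNr.
Qed.

Lemma deriv1_comp f g x df dg : deriv1 f (g x) df -> deriv1 g x dg ->
  deriv1 (fun s => f (g s)) x (df * dg).
Proof. by move=> hf hg; exact: (is_derive1_comp hf hg). Qed.

Lemma is_derive_cont f x d : deriv1 f x d -> {for x, continuous f}.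
Proof.
move=> [h _]; apply: differentiable_continuous.
exact/derivable1_diffP.
Qed.

Lemma continuousD1 f g x : {for x, continuous f} -> {for x, continuous g} ->
  {for x, continuous (fun s => f s + g s)}.
Proof. by move=> hf hg; exact: cvgD. Qed.

Lemma continuousN1 f x : {for x, continuous f} -> {for x, continuous (fun s => - f s)}.
Proof. by move=> hf; exact: cvgN. Qed.

Lemma continuousM1 f g x : {for x, continuous f} -> {for x, continuous g} ->
  {for x, continuous (fun s => f s * g s)}.
Proof. by move=> hf hg; exact: cvgM. Qed.

Lemma continuous_cst1 (k x : R) : {for x, continuous (fun _ : R => k)}.
Proof. exact: cst_continuous. Qed.

Lemma continuous_on_segment f a b : (forall x, a <= x <= b -> {for x, continuous f}) ->
  {within `[a, b], continuous f}.
Proof.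
move=> h; apply: continuous_in_subspaceT => x; rewrite inE /= in_itv /=.
exact: h.
Qed.

Lemma deriv1_mvt f df a b : a < b -> (forall x, a < x < b -> deriv1 f x (df x)) ->
  (forall x, a <= x <= b -> {for x, continuous f}) ->
  exists2 c, a < c < b & f b - f a = df c * (b - a).
Proof.
move=> ab hd hc; have hd' x : x \in `]a, b[ -> deriv1 f x (df x).
  by rewrite in_itv /=; exact: hd.
have [c] := MVT ab hd' (continuous_on_segment hc).
by rewrite in_itv /= => ? ?; exists c.
Qed.

Lemma deriv0_eq f a b : a <= b -> (forall x, a < x < b -> deriv1 f x 0) ->
  (forall x, a <= x <= b -> {for x, continuous f}) -> f b = f a.
Proof.
rewrite le_eqVlt => /orP[/eqP->//|ab] hd hc.
have [c _] := @deriv1_mvt f (fun=> 0) a b ab hd hc; by rewrite mul0r => /eqP; rewrite subr_eq0 => /eqP.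
Qed.

Lemma deriv_gt0_lt f df a b : a < b ->
  (forall x, a <= x <= b -> deriv1 f x (df x)) ->
  (forall x, a < x < b -> 0 < df x) -> f a < f b.
Proof.
move=> ab hd h0; have [x /andP[x1 x2]|x hx|c hc E] := @deriv1_mvt f df a b ab.
- by apply: hd; rewrite !ltW.
- exact: is_derive_cont (hd x hx).
by rewrite -subr_gt0 E mulr_gt0 ?h0 ?subr_gt0.
Qed.

Lemma deriv_lt0_gt f df a b : a < b ->
  (forall x, a <= x <= b -> deriv1 f x (df x)) ->
  (forall x, a < x < b -> df x < 0) -> f b < f a.
Proof.
move=> ab hd h0; rewrite -ltrN2.
apply: (@deriv_gt0_lt (fun s => - f s) (fun s => - df s)) => //.
  by move=> x hx; apply/deriv1N/hd.
by move=> x hx; rewrite oppr_gt0 h0.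
Qed.

Lemma deriv_rolle f df a b : a < b ->
  (forall x, a <= x <= b -> deriv1 f x (df x)) -> f a = f b ->
  exists2 c, a < c < b & df c = 0.
Proof.
move=> ab hd E; have [x /andP[x1 x2]|x hx|c hc] := @deriv1_mvt f df a b ab.
- by apply: hd; rewrite !ltW.
- exact: is_derive_cont (hd x hx).
rewrite E subrr => /eqP; rewrite eq_sym mulf_eq0 subr_eq0 [b == a]gt_eqF// orbF.
by move=> /eqP; exists c.
Qed.

Lemma deriv_pos_near f x d : deriv1 f x d -> f x = 0 -> 0 < d ->
  exists2 e, 0 < e & forall r, 0 < r < e -> 0 < f (x + r) /\ f (x - r) < 0.
Proof.
move=> [h1 h2] fx d0.
have : (fun h : R => h^-1 *: (f (h *: (1:R) + x) - f x)) @ (0:R)^' --> d.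
  by rewrite -h2; exact: h1.
move/cvgrPdist_lt => /(_ _ d0).
rewrite near_withinE => -[e /= e0 he]; exists e => // r /andP[r0 re].
have key s : s != 0 -> `|s| < e -> 0 < s^-1 * f (x + s).
  move=> s0 se; have := he s; rewrite /ball_ /= sub0r normrN => /(_ se s0).
  rewrite fx subr0 /GRing.scale /= mulr1 [s + x]addrC.
  by move=> /ltr_normlP[_]; lra.
split.
  have := key r; rewrite gt_eqF// gtr0_norm// pmulr_rgt0 ?invr_gt0//.
  exact.
have := key (- r); rewrite oppr_eq0 gt_eqF// normrN gtr0_norm//.
rewrite invrN mulNr oppr_gt0 pmulr_rlt0 ?invr_gt0//; exact.
Qed.

(** The supremum of the times up to which [P] holds throughout cannot lie below [b]. A motion is
    described only near each time, separately before and after it; this principle turns such local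
    descriptions into statements on whole intervals. *)
Lemma real_induction (P : R -> Prop) a b : a <= b -> P a ->
  (forall s, a <= s < b -> P s -> exists2 e, 0 < e & forall r, s < r < s + e -> P r) ->
  (forall s, a < s <= b -> (forall r, a <= r < s -> P r) -> P s) ->
  forall s, a <= s <= b -> P s.
Proof.
move=> ab Pa Pstep Plim.
pose A := [set s | a <= s <= b /\ forall r, a <= r <= s -> P r].
have Aa : A a.
  split; first by rewrite lexx ab.
  by move=> r /andP[r1 r2]; have -> : r = a by apply/eqP; rewrite eq_le r1 r2.
have hsup : has_sup A.
  split; first by exists a.
  by exists b => s [/andP[]].
pose m := sup A.
have am : a <= m by apply: ub_le_sup => //; case: hsup.
have mb : m <= b.
  by apply: ge_sup; [exists a|move=> s [/andP[]]].
have below r : a <= r < m -> P r.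
  move=> /andP[ar rm]; have [s [hs1 hs2] rs] := sup_gt hsup.1 rm.
  by apply: hs2; rewrite ar ltW.
have Pm : P m.
  move: am; rewrite le_eqVlt => /orP[/eqP <-//|am].
  by apply: Plim => //; rewrite am mb.
have Am : A m.
  split; first by rewrite am mb.
  move=> r /andP[ar]; rewrite le_eqVlt => /orP[/eqP->//|rm].
  by apply: below; rewrite ar rm.
suff -> : b = m by case: Am.
apply/eqP; rewrite eq_le mb andbT; rewrite leNgt; apply/negP => mltb.
have [e e0 he] := Pstep m (ltac:(by rewrite am mltb)) Pm.
pose s := Num.min b (m + e / 2).
have ms : m < s by rewrite lt_min mltb ltrDl divr_gt0.
suff As : A s.
  have : s <= m by apply: ub_le_sup => //; case: hsup.
  by rewrite leNgt ms.
split; first by rewrite (le_trans am (ltW ms)) ge_min lexx.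
move=> r /andP[ar rs]; have [rm|mr] := leP r m; first by apply: Am.2; rewrite ar.
apply: he; rewrite mr (le_lt_trans rs)// gt_min; apply/orP; right.
by rewrite ltrD2l ltr_pdivrMr// ltr_pMr// ltr1n.
Qed.

End Calculus.
Arguments continuous_cst1 {R} k x.

(** * The fundamental solution of [s'' = T s' - D s] *)

Section Fundamental.
Context {R : realType}.
Notation deriv1 f x d := (is_derive (x : R) (1 : R) f d).

Definition tr2 (A : 'M[R]_2) : R := A 0 0 + A 1 1.
Definition det2 (A : 'M[R]_2) : R := A 0 0 * A 1 1 - A 0 1 * A 1 0.

Lemma lift0_0 : lift (0 : 'I_2) (0 : 'I_1) = 1.
Proof. exact: val_inj. Qed.

Lemma char_poly2 (F : fieldType) (A : 'M[F]_2) : char_poly A =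
  ('X - (A 0 0)%:P) * ('X - (A 1 1)%:P) - (A 0 1 * A 1 0)%:P.
Proof.
rewrite /char_poly (expand_det_row _ 0) !big_ord_recl big_ord0 addr0.
rewrite /cofactor !det_mx11 !mxE /=.
have l01 : lift (0 : 'I_2) 0 = 1 by exact: val_inj.
have l10 : lift (1 : 'I_2) 0 = 0 by exact: val_inj.
rewrite l01 l10 /= expr0 expr1 !mulr1n !mulr0n polyCM; ring.
Qed.

Lemma char_poly22 (F : fieldType) (A : 'M[F]_2) (x : F) : (char_poly A).[x] =
  (x - A 0 0) * (x - A 1 1) - A 0 1 * A 1 0.
Proof. by rewrite char_poly2 !hornerE. Qed.

(** [S] is the solution with initial data [(0, 1)] and [C] is its derivative, not the solution with
    data [(1, 0)]; the latter is [C - T S]. *)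
Record fundamental (T D : R) (S C : R -> R) : Prop := Fundamental {
  fund_S : forall t, deriv1 S t (C t);
  fund_C : forall t, deriv1 C t (T * C t - D * S t);
  fund_S0 : S 0 = 0;
  fund_C0 : C 0 = 1 }.

(* The case of a focus, [h] being half of the period of its rotation. *)
Record oscillates (T D : R) (S C : R -> R) (h : R) : Prop := Oscillates {
  osc_h : 0 < h;
  osc_D : 0 < D;
  osc_pos : forall t, 0 < t < h -> 0 < S t;
  osc_S : forall t, S (t + h) = - expR (T * h / 2) * S t;
  osc_C : forall t, C (t + h) = - expR (T * h / 2) * C t }.

Lemma deriv1_expRM (a t : R) : deriv1 (fun s => expR (a * s)) t (a * expR (a * t)).
Proof.
have h := deriv1M (deriv1_cst a t) (deriv1_id t).
have := @deriv1_comp R expR (fun s => a * s) t _ _ (is_derive_expR _) h.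
by rewrite mul0r add0r mulr1 mulrC.
Qed.

Definition node_S (l m t : R) := (expR (l * t) + - expR (m * t)) * (l - m)^-1.
Definition node_C (l m t : R) :=
  (l * expR (l * t) + - (m * expR (m * t))) * (l - m)^-1.

Lemma fundamental_node (l m : R) : l != m ->
  fundamental (l + m) (l * m) (node_S l m) (node_C l m).
Proof.
move=> lm; have lm0 : l - m != 0 by rewrite subr_eq0.
split.
- move=> t; apply: (deriv1_eq (deriv1M (deriv1D (deriv1_expRM l t) (deriv1N (deriv1_expRM m t))) (deriv1_cst _ t))).
  by rewrite /node_C; ring.
- move=> t; apply: (deriv1_eq (deriv1M (deriv1D (deriv1M (deriv1_cst l t) (deriv1_expRM l t))
        (deriv1N (deriv1M (deriv1_cst m t) (deriv1_expRM m t)))) (deriv1_cst _ t))).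
  by rewrite /node_S /node_C; field.
- by rewrite /node_S !mulr0 subrr mul0r.
- by rewrite /node_C !mulr0 expR0 !mulr1 mulfV.
Qed.

(** For real eigenvalues [l - m] and the difference of the exponentials have the same sign at
    positive times, whatever the signs of [l] and [m]; nodes and saddles are thus treated alike. A
    double eigenvalue gives the limit [t * expR (l * t)]. *)
Lemma fundamental_node_pos (l m : R) : exists S C,
  fundamental (l + m) (l * m) S C /\ forall t, 0 < t -> 0 < S t.
Proof.
have [<-|lm] := eqVneq l m.
  exists (fun t => t * expR (l * t)), (fun t => expR (l * t) + t * (l * expR (l * t))).
  split; last by move=> t t0; rewrite mulr_gt0 ?expR_gt0.
  split.
  - move=> t; apply: (deriv1_eq (deriv1M (deriv1_id t) (deriv1_expRM l t))).
    ring.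
  - move=> t; apply: (deriv1_eq (deriv1D (deriv1_expRM l t) (deriv1M (deriv1_id t) (deriv1M (deriv1_cst l t) (deriv1_expRM l t))))).
    ring.
  - by rewrite mul0r.
  - by rewrite mulr0 expR0 mul0r addr0.
exists (node_S l m), (node_C l m); split; first exact: fundamental_node.
move=> t t0; rewrite /node_S; move: lm; rewrite -subr_eq0 neq_lt subr_lt0 subr_gt0 => /orP[h|h].
  by rewrite nmulr_lgt0 ?invr_lt0 ?subr_lt0// ltr_expR ltr_pM2r.
by rewrite pmulr_lgt0 ?invr_gt0 ?subr_gt0// ltr_expR ltr_pM2r.
Qed.

Lemma deriv1_sinM (a t : R) : deriv1 (fun s => sin (a * s)) t (a * cos (a * t)).
Proof.
have h := deriv1M (deriv1_cst a t) (deriv1_id t).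
have := @deriv1_comp R sin (fun s => a * s) t _ _ (is_derive_sin _) h.
by rewrite mul0r add0r mulr1 mulrC.
Qed.

Lemma deriv1_cosM (a t : R) : deriv1 (fun s => cos (a * s)) t (- a * sin (a * t)).
Proof.
have h := deriv1M (deriv1_cst a t) (deriv1_id t).
have := @deriv1_comp R cos (fun s => a * s) t _ _ (is_derive_cos _) h.
by rewrite mul0r add0r mulr1 mulrC mulNr mulrN.
Qed.

Definition focus_S (a b t : R) := expR (a * t) * sin (b * t) * b^-1.
Definition focus_C (a b t : R) := (a * expR (a * t) * sin (b * t)
   + expR (a * t) * (b * cos (b * t))) * b^-1.

Lemma fundamental_focus (a b : R) : b != 0 ->
  fundamental (a *+ 2) (a ^+ 2 + b ^+ 2) (focus_S a b) (focus_C a b).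
Proof.
move=> bn; split.
- move=> t; apply: (deriv1_eq (deriv1M (deriv1M (deriv1_expRM a t) (deriv1_sinM b t)) (deriv1_cst _ t))).
  by rewrite /focus_C; ring.
- move=> t; apply: (deriv1_eq (deriv1M (deriv1D (deriv1M (deriv1M (deriv1_cst a t) (deriv1_expRM a t)) (deriv1_sinM b t))
      (deriv1M (deriv1_expRM a t) (deriv1M (deriv1_cst b t) (deriv1_cosM b t)))) (deriv1_cst _ t))).
  by rewrite /focus_S /focus_C; field.
- by rewrite /focus_S !mulr0 sin0 mulr0 mul0r.
- by rewrite /focus_C !mulr0 sin0 cos0 expR0 mulr0 mulr1 mul1r add0r mulfV.
Qed.

Lemma oscillates_focus (a b : R) : 0 < b ->
  oscillates (a *+ 2) (a ^+ 2 + b ^+ 2) (focus_S a b) (focus_C a b) (pi / b).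
Proof.
move=> b0; have bn : b != 0 by rewrite gt_eqF.
have e : a *+ 2 * (pi / b) / 2 = a * (pi / b) by rewrite mulr2n; field.
have E t : expR (a * (t + pi / b)) = expR (a * t) * expR (a * (pi / b)).
  by rewrite mulrDr expRD.
have Es t : sin (b * (t + pi / b)) = - sin (b * t).
  by rewrite mulrDr mulrCA divff// mulr1 sinDpi.
have Ec t : cos (b * (t + pi / b)) = - cos (b * t).
  by rewrite mulrDr mulrCA divff// mulr1 cosDpi.
split.
- by rewrite divr_gt0 ?pi_gt0.
- by rewrite ltr_wpDl ?sqr_ge0// exprn_gt0.
- move=> t /andP[t0 t1]; rewrite divr_gt0// mulr_gt0 ?expR_gt0//.
  apply: sin_gt0_pi; rewrite mulr_gt0//=.
  by move: t1; rewrite ltr_pdivlMr// mulrC.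
- by move=> t; rewrite /focus_S e E Es; ring.
- by move=> t; rewrite /focus_C e E Es Ec; ring.
Qed.

(** [S] and [C] depend on [A] only through its trace and determinant, so diagonalizability never
    enters. The later arguments distinguish only whether [S] stays positive or oscillates. *)
Lemma fundamental_exists (A : 'M[R]_2) : focus_node_or_saddle A ->
  det2 A != 0 /\ exists S C, fundamental (tr2 A) (det2 A) S C /\
   ((forall t, 0 < t -> 0 < S t) \/ exists h, oscillates (tr2 A) (det2 A) S C h).
Proof.
have real_case l m : l * m != 0 -> char_poly A = ('X - l%:P) * ('X - m%:P) ->
  det2 A != 0 /\ exists S C, fundamental (tr2 A) (det2 A) S C /\
   ((forall t, 0 < t -> 0 < S t) \/ exists h, oscillates (tr2 A) (det2 A) S C h).
  move=> lm0 E.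
  (* The values of a monic quadratic at 0 and 1 determine its coefficients, that is, the determinant
     and the trace. *)
  have E0 := congr1 (fun p => p.[0]) E; have E1 := congr1 (fun p => p.[1]) E.
  move: E0 E1; rewrite /= !char_poly22 !hornerE => E0 E1.
  have ED : det2 A = l * m by rewrite /det2; lra.
  have ET : tr2 A = l + m by rewrite /tr2; lra.
  rewrite ED ET; split=> //.
  have [S [C [h1 h2]]] := fundamental_node_pos l m.
  by exists S, C; split=> //; left.
move=> [[a [b [b0]]]|[[l [m [lm E]]]|[l [m [lm E]]]]]; last 2 first.
- by apply: (real_case l m) => //; rewrite gt_eqF.
- by apply: (real_case l m) => //; rewrite lt_eqF.
rewrite eigenvalue_root_char rootE char_poly22 !mxE /= => /eqP.
move=> E; have E1 := congr1 (@complex.Re R) E.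
have E2 := congr1 (@complex.Im R) E.
simpl in E1, E2.
(* The imaginary part of the characteristic equation at [a + i b] gives the trace, and the real part
   then gives the determinant. *)
have {}E2 : (a *+ 2 - tr2 A) * b = 0 by rewrite -E2 /tr2 mulr2n; ring.
have ET : tr2 A = a *+ 2.
  by move/eqP: E2; rewrite mulf_eq0 (negbTE b0) orbF subr_eq0 => /eqP.
have ED : det2 A = a ^+ 2 + b ^+ 2.
  move: E1 ET; rewrite /det2 /tr2 mulr2n => E1 ET.
  have {}ET : A 1 1 = a + a - A 0 0 by lra.
  by rewrite ET in E1 *; lra.
have [b' b'0 bb] : exists2 b', 0 < b' & b ^+ 2 = b' ^+ 2.
  exists `|b|; first by rewrite normr_gt0.
  by rewrite real_normK// num_real.
rewrite ET ED bb; split.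
  by rewrite gt_eqF// ltr_wpDl ?sqr_ge0// exprn_gt0.
exists (focus_S a b'), (focus_C a b').
split; first by apply: fundamental_focus; rewrite gt_eqF.
by right; exists (pi / b'); exact: oscillates_focus.
Qed.

(** * The Wronskian identity and the primitive of the fundamental solution *)

Section FundamentalTheory.
Variables (T D : R) (S C : R -> R).
Hypothesis F : fundamental T D S C.

(* The determinant of [exp (t A)] when [T] and [D] are the trace and the
   determinant of [A]. *)
Lemma fund_wronskian t : C t ^+ 2 - T * C t * S t + D * S t ^+ 2 = expR (T * t).
Proof.
(* Liouville's formula: the determinant divided by its expected value is constant. *)
pose w s := (C s * C s + - (T * (C s * S s)) + D * (S s * S s)) * expR (- T * s).
have dw s : deriv1 w s 0.
  have dS := fund_S F s; have dC' := fund_C F s.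
  apply: (deriv1_eq (deriv1M (deriv1D (deriv1D (deriv1M dC' dC') (deriv1N (deriv1M (deriv1_cst T s) (deriv1M dC' dS))))
      (deriv1M (deriv1_cst D s) (deriv1M dS dS))) (deriv1_expRM _ s))).
  ring.
have : w t = w 0 by exact: is_derive_0_is_cst.
rewrite /w (fund_S0 F) (fund_C0 F) !mulr0 expR0 => E.
have {E} : (C t ^+ 2 - T * C t * S t + D * S t ^+ 2) * expR (- T * t) = 1.
  by rewrite -[RHS]mulr1; move: E; rewrite !mulr1 oppr0 !addr0 => <-; ring.
move=> /(congr1 (fun x => x * expR (T * t))).
by rewrite -mulrA -expRD mulNr addNr expR0 mulr1 mul1r.
Qed.

(** The primitive of [S] that vanishes at 0, which is the response to a constant force: it solves
    [x'' = T x' - D x + 1] with zero initial data. *)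
Definition Wf (t : R) : R := (1 + T * S t - C t) / D.

Lemma deriv1_W t : D != 0 -> deriv1 Wf t (S t).
Proof.
move=> D0; apply: (deriv1_eq (deriv1M (deriv1D (deriv1D (deriv1_cst 1 t) (deriv1M (deriv1_cst T t) (fund_S F t))) (deriv1N (fund_C F t))) (deriv1_cst _ t))).
by field.
Qed.

Lemma W0 : Wf 0 = 0.
Proof. by rewrite /Wf (fund_S0 F) (fund_C0 F) mulr0 addr0 subrr mul0r. Qed.

End FundamentalTheory.
End Fundamental.

(** * Affine planar flows *)

Section Flow.
Context {R : realType}.
Notation deriv1 f x d := (is_derive (x : R) (1 : R) f d).
Implicit Types (p q : 'cV[R]_2) (phi : R -> 'cV[R]_2).

Definition vec2 (x y : R) : 'cV[R]_2 := \col_i (if i == 0 then x else y).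

Lemma vec2_0 x y : vec2 x y 0 0 = x. Proof. by rewrite mxE. Qed.
Lemma vec2_1 x y : vec2 x y 1 0 = y. Proof. by rewrite mxE. Qed.

Lemma ord2P (i : 'I_2) : i = 0 \/ i = 1.
Proof. by case: i => -[|[|//]] h; [left|right]; exact: val_inj. Qed.

Lemma vec2P p q : p 0 0 = q 0 0 -> p 1 0 = q 1 0 -> p = q.
Proof.
move=> h0 h1; apply/matrixP => i j; rewrite [j]ord1.
by have [->|->] := ord2P i.
Qed.

Lemma mulA0 (A : 'M[R]_2) p : (A *m p) 0 0 = A 0 0 * p 0 0 + A 0 1 * p 1 0.
Proof. by rewrite mxE !big_ord_recl big_ord0 addr0 lift0_0. Qed.

Lemma mulA1 (A : 'M[R]_2) p : (A *m p) 1 0 = A 1 0 * p 0 0 + A 1 1 * p 1 0.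
Proof. by rewrite mxE !big_ord_recl big_ord0 addr0 lift0_0. Qed.

Lemma vec_deriv phi t v : is_derive t (1 : R) phi v <->
  deriv1 (fun s => phi s 0 0) t (v 0 0) /\ deriv1 (fun s => phi s 1 0) t (v 1 0).
Proof.
split=> [[h1 h2]|[[h01 h02] [h11 h12]]].
  have h1' := (derivable_mxP phi t 1).1 h1.
  rewrite -h2 derive_mx// !mxE.
  by split; apply: derivableP; exact: h1'.
have h : derivable phi t 1.
  apply/derivable_mxP => i j; rewrite [j]ord1.
  by have [->|->] := ord2P i.
by split=> //; rewrite derive_mx//; apply: vec2P; rewrite mxE.
Qed.

Lemma vec_cont phi t : {for t, continuous phi} <->
  {for t, continuous (fun s => phi s 0 0)} /\
  {for t, continuous (fun s => phi s 1 0)}.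
Proof.
split=> [h|[h0 h1]].
  split.
    exact: (@continuous_comp _ _ _ phi (fun M : 'cV[R]_2 => M 0 0) t h (@coord_continuous _ _ _ _ _ _)).
  exact: (@continuous_comp _ _ _ phi (fun M : 'cV[R]_2 => M 1 0) t h (@coord_continuous _ _ _ _ _ _)).
apply/cvgrPdist_lt => e e0; near=> s.
rewrite [X in X < _]/Num.Def.normr/= mx_normrE (bigmax_lt _ e0)//= => -[i j] _.
rewrite !mxE [j]ord1 /=; have [->|->] := ord2P i; near: s.
  exact: (cvgrPdist_lt _ _).1 h0 _ e0.
exact: (cvgrPdist_lt _ _).1 h1 _ e0.
Unshelve. all: by end_near. Qed.

Section OneSystem.
Variables (A : 'M[R]_2) (b : 'cV[R]_2) (S C : R -> R).
Hypothesis F : fundamental (tr2 A) (det2 A) S C.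
Hypothesis D0 : det2 A != 0.

Definition equil : 'cV[R]_2 :=
  vec2 ((A 0 1 * b 1 0 - A 1 1 * b 0 0) / det2 A)
     ((A 1 0 * b 0 0 - A 0 0 * b 1 0) / det2 A).

Definition aff p := A *m p + b.

Lemma aff0 p : aff p 0 0 = A 0 0 * p 0 0 + A 0 1 * p 1 0 + b 0 0.
Proof. by rewrite mxE mulA0. Qed.

Lemma aff1 p : aff p 1 0 = A 1 0 * p 0 0 + A 1 1 * p 1 0 + b 1 0.
Proof. by rewrite mxE mulA1. Qed.

Lemma aff_equil : aff equil = 0.
Proof.
apply: vec2P; rewrite ?aff0 ?aff1 vec2_0 vec2_1 [in RHS]mxE; move: D0; rewrite /det2 => h; field; exact: h.
Qed.

Lemma aff_eq0 p : aff p = 0 -> p = equil.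
Proof.
move=> E; have := congr1 (fun v : 'cV[R]_2 => v 0 0) E.
have := congr1 (fun v : 'cV[R]_2 => v 1 0) E.
rewrite /= aff0 aff1 !mxE => E1 E0.
apply: vec2P; rewrite ?vec2_0 ?vec2_1; apply: (mulIf D0); rewrite divfK// /det2.
  have -> : A 0 1 * b 1 0 - A 1 1 * b 0 0 = A 0 1 * (A 1 0 * p 0 0 + A 1 1 * p 1 0 + b 1 0)
    - A 1 1 * (A 0 0 * p 0 0 + A 0 1 * p 1 0 + b 0 0)
    + p 0 0 * (A 0 0 * A 1 1 - A 0 1 * A 1 0) by ring.
  by rewrite E0 E1; ring.
have -> : A 1 0 * b 0 0 - A 0 0 * b 1 0 = A 1 0 * (A 0 0 * p 0 0 + A 0 1 * p 1 0 + b 0 0)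
  - A 0 0 * (A 1 0 * p 0 0 + A 1 1 * p 1 0 + b 1 0)
  + p 1 0 * (A 0 0 * A 1 1 - A 0 1 * A 1 0) by ring.
by rewrite E0 E1; ring.
Qed.

(* By Cayley-Hamilton, [exp (t A) = C t + S t (A - tr A)]. *)
Definition flow (t : R) p : 'cV[R]_2 :=
  let w0 := p 0 0 - equil 0 0 in let w1 := p 1 0 - equil 1 0 in
  vec2 (equil 0 0 + (C t * w0 + S t * (A 0 1 * w1 - A 1 1 * w0)))
     (equil 1 0 + (C t * w1 + S t * (A 1 0 * w0 - A 0 0 * w1))).

Lemma flow0 p : flow 0 p = p.
Proof.
by apply: vec2P; [rewrite [LHS]vec2_0|rewrite [LHS]vec2_1];
  rewrite (fund_S0 F) (fund_C0 F) mul0r addr0 mul1r addrC subrK.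
Qed.

Lemma affE p : aff p = vec2 (A 0 0 * (p 0 0 - equil 0 0) + A 0 1 * (p 1 0 - equil 1 0))
  (A 1 0 * (p 0 0 - equil 0 0) + A 1 1 * (p 1 0 - equil 1 0)).
Proof.
have E0 : A 0 0 * equil 0 0 + A 0 1 * equil 1 0 + b 0 0 = 0.
  by rewrite -aff0 aff_equil mxE.
have E1 : A 1 0 * equil 0 0 + A 1 1 * equil 1 0 + b 1 0 = 0.
  by rewrite -aff1 aff_equil mxE.
by apply: vec2P; [rewrite aff0 [RHS]vec2_0|rewrite aff1 [RHS]vec2_1]; lra.
Qed.

Lemma deriv1_comp_shift (f : R -> R) (r s d : R) : deriv1 f (s - r) d ->
  deriv1 (fun u => f (u - r)) s d.
Proof.
move=> h; apply: (deriv1_eq (@deriv1_comp R f (fun u => u - r) s _ _ h (deriv1D (deriv1_id s) (deriv1_cst (- r) s)))).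
by rewrite addr0 mulr1.
Qed.

Lemma deriv1_comp_back (f : R -> R) (r s d : R) : deriv1 f (r - s) d ->
  deriv1 (fun u => f (r - u)) s (- d).
Proof.
move=> h; apply: (deriv1_eq (@deriv1_comp R f (fun u => r - u) s _ _ h (deriv1D (deriv1_cst r s) (deriv1N (deriv1_id s))))).
by rewrite add0r mulrN1.
Qed.

Lemma deriv_flow t p : is_derive t (1 : R) (flow^~ p) (aff (flow t p)).
Proof.
have dS := fund_S F t; have dC' := fund_C F t.
apply/vec_deriv; rewrite affE [X in deriv1 _ _ X /\ _]vec2_0 [X in _ /\ deriv1 _ _ X]vec2_1.
have -> : flow t p 0 0 - equil 0 0 =  C t * (p 0 0 - equil 0 0) + S t * (A 0 1 * (p 1 0 - equil 1 0) - A 1 1 * (p 0 0 - equil 0 0)).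
  by rewrite [X in X - _]vec2_0 addrC addKr.
have -> : flow t p 1 0 - equil 1 0 =  C t * (p 1 0 - equil 1 0) + S t * (A 1 0 * (p 0 0 - equil 0 0) - A 0 0 * (p 1 0 - equil 1 0)).
  by rewrite [X in X - _]vec2_1 addrC addKr.
set w0 := p 0 0 - _; set w1 := p 1 0 - _.
split.
  rewrite (_ : (fun s => _) = (fun s => equil 0 0 + (C s * w0 + S s * (A 0 1 * w1 - A 1 1 * w0)))); last first.
    by apply/funext => s; rewrite [LHS]vec2_0.
  apply: (deriv1_eq (deriv1D (deriv1_cst _ t) (deriv1D (deriv1M dC' (deriv1_cst w0 t)) (deriv1M dS (deriv1_cst _ t))))).
  by rewrite /tr2 /det2; ring.
rewrite (_ : (fun s => _) = (fun s => equil 1 0 + (C s * w1 + S s * (A 1 0 * w0 - A 0 0 * w1)))); last first.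
  by apply/funext => s; rewrite [LHS]vec2_1.
apply: (deriv1_eq (deriv1D (deriv1_cst _ t) (deriv1D (deriv1M dC' (deriv1_cst w1 t)) (deriv1M dS (deriv1_cst _ t))))).
by rewrite /tr2 /det2; ring.
Qed.

Lemma flow_cont p : continuous (flow^~ p).
Proof.
move=> t; have /vec_deriv[h0 h1] := deriv_flow t p.
by apply/vec_cont; split; [exact: is_derive_cont h0|exact: is_derive_cont h1].
Qed.

(** The difference between [phi] and the flow line, transported by [exp ((r - u) A)], has zero
    derivative and vanishes at [u = r]. The equation is assumed only in the open interval;
    continuity extends the conclusion to the endpoints, where switches may occur. *)
Lemma flow_unique phi (a c : R) : continuous phi ->
  (forall s, a < s < c -> is_derive s (1 : R) phi (aff (phi s))) ->
  forall r s : R, a <= r <= c -> a <= s <= c -> phi s = flow (s - r) (phi r).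
Proof.
move=> hc hd r s hr hs.
pose psi u := flow (u - r) (phi r).
have hpsi u : deriv1 (fun v => psi v 0 0) u (aff (psi u) 0 0) /\
    deriv1 (fun v => psi v 1 0) u (aff (psi u) 1 0).
  have /vec_deriv[h0 h1] := deriv_flow (u - r) (phi r).
  split; first exact: (@deriv1_comp_shift (fun v => flow v (phi r) 0 0)).
  exact: (@deriv1_comp_shift (fun v => flow v (phi r) 1 0)).
pose d0 u := phi u 0 0 - psi u 0 0; pose d1 u := phi u 1 0 - psi u 1 0.
pose z0 u := C (r - u) * d0 u + S (r - u) * (A 0 1 * d1 u - A 1 1 * d0 u).
pose z1 u := C (r - u) * d1 u + S (r - u) * (A 1 0 * d0 u - A 0 0 * d1 u).
have dCr u := deriv1_comp_back (fund_C F (r - u)).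
have dSr u := deriv1_comp_back (fund_S F (r - u)).
have hd0 u : a < u < c -> deriv1 d0 u (A 0 0 * d0 u + A 0 1 * d1 u).
  move=> hu; have /vec_deriv[h _] := hd u hu; have [h' _] := hpsi u.
  apply: (deriv1_eq (deriv1D h (deriv1N h'))); rewrite !aff0 /d0 /d1; ring.
have hd1 u : a < u < c -> deriv1 d1 u (A 1 0 * d0 u + A 1 1 * d1 u).
  move=> hu; have /vec_deriv[_ h] := hd u hu; have [_ h'] := hpsi u.
  apply: (deriv1_eq (deriv1D h (deriv1N h'))); rewrite !aff1 /d0 /d1; ring.
have cd0 u : {for u, continuous d0}.
  have [h _] := hpsi u; apply: continuousD1 (continuousN1 (is_derive_cont h)).
  by case: ((vec_cont phi u).1 (hc u)).
have cd1 u : {for u, continuous d1}.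
  have [_ h] := hpsi u; apply: continuousD1 (continuousN1 (is_derive_cont h)).
  by case: ((vec_cont phi u).1 (hc u)).
have hz0 u : a < u < c -> deriv1 z0 u 0.
  move=> hu; apply: (deriv1_eq (deriv1D (deriv1M (dCr u) (hd0 u hu)) (deriv1M (dSr u)
    (deriv1D (deriv1M (deriv1_cst _ u) (hd1 u hu)) (deriv1N (deriv1M (deriv1_cst _ u) (hd0 u hu))))))).
  by rewrite /tr2 /det2; ring.
have hz1 u : a < u < c -> deriv1 z1 u 0.
  move=> hu; apply: (deriv1_eq (deriv1D (deriv1M (dCr u) (hd1 u hu)) (deriv1M (dSr u)
    (deriv1D (deriv1M (deriv1_cst _ u) (hd0 u hu)) (deriv1N (deriv1M (deriv1_cst _ u) (hd1 u hu))))))).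
  by rewrite /tr2 /det2; ring.
have cCr u := is_derive_cont (dCr u).
have cSr u := is_derive_cont (dSr u).
have cz0 u : {for u, continuous z0}.
  rewrite /z0; apply: continuousD1 (continuousM1 (cCr u) (cd0 u)) (continuousM1 (cSr u)
    (continuousD1 (continuousM1 (continuous_cst1 _ u) (cd1 u)) (continuousN1 (continuousM1 (continuous_cst1 _ u) (cd0 u))))).
have cz1 u : {for u, continuous z1}.
  rewrite /z1; apply: continuousD1 (continuousM1 (cCr u) (cd1 u)) (continuousM1 (cSr u)
    (continuousD1 (continuousM1 (continuous_cst1 _ u) (cd0 u)) (continuousN1 (continuousM1 (continuous_cst1 _ u) (cd1 u))))).
have zconst (z : R -> R) : (forall u, a < u < c -> deriv1 z u 0) ->
    (forall u : R, {for u, continuous z}) -> z s = z r.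
  move: hr hs => /andP[ar rc] /andP[as_ sc] dz cz.
  have [rs|/ltW sr] := leP r s.
    apply: deriv0_eq => // u /andP[u1 u2]; apply: dz.
    by rewrite (le_lt_trans ar u1) (lt_le_trans u2 sc).
  symmetry; apply: deriv0_eq => // u /andP[u1 u2]; apply: dz.
  by rewrite (le_lt_trans as_ u1) (lt_le_trans u2 rc).
have psir : psi r = phi r by rewrite /psi subrr flow0.
have d0r : d0 r = 0 by rewrite /d0 psir subrr.
have d1r : d1 r = 0 by rewrite /d1 psir subrr.
have E0 : z0 s = 0.
  by rewrite (zconst _ hz0 cz0) /z0 d0r d1r; ring.
have E1 : z1 s = 0.
  by rewrite (zconst _ hz1 cz1) /z1 d0r d1r; ring.
have W := fund_wronskian F (r - s).
have Wn : expR (tr2 A * (r - s)) != 0 by rewrite gt_eqF ?expR_gt0.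
(* The transporting matrix has the nonzero determinant [expR (tr2 A * (r - s))], so Cramer's rule
   recovers the difference from [E0] and [E1]. *)
suff [e0 e1] : d0 s = 0 /\ d1 s = 0.
  by apply: vec2P; apply/eqP; rewrite -subr_eq0; apply/eqP; [exact: e0|exact: e1].
move: E0 E1; rewrite /z0 /z1; set c' := C _; set s' := S _ => E0 E1.
split; apply: (mulfI Wn); rewrite mulr0 -W -/c' -/s' /tr2 /det2.
  transitivity ((c' - s' * A 0 0) * (c' * d0 s + s' * (A 0 1 * d1 s - A 1 1 * d0 s))
    - s' * A 0 1 * (c' * d1 s + s' * (A 1 0 * d0 s - A 0 0 * d1 s))); first ring.
  by rewrite E0 E1; ring.
transitivity ((c' - s' * A 1 1) * (c' * d1 s + s' * (A 1 0 * d0 s - A 0 0 * d1 s))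
    - s' * A 1 0 * (c' * d0 s + s' * (A 0 1 * d1 s - A 1 1 * d0 s))); first ring.
by rewrite E0 E1; ring.
Qed.

Lemma flowD s t p : flow (s + t) p = flow s (flow t p).
Proof.
have [h1|h1] := leP 0 s.
  have := @flow_unique (flow^~ p) t (s + t) (@flow_cont p) (fun u _ => deriv_flow u p) t (s + t).
  by rewrite addrK; apply; rewrite ?lexx ?lerDr ?h1.
have := @flow_unique (flow^~ p) (s + t) t (@flow_cont p) (fun u _ => deriv_flow u p) t (s + t).
by rewrite addrK; apply; rewrite ?lexx ?gerDr ?(ltW h1).
Qed.

Lemma flow_equil t : flow t equil = equil.
Proof. by apply: vec2P; [rewrite [LHS]vec2_0|rewrite [LHS]vec2_1];
  rewrite !subrr !mulr0 subrr mulr0 !addr0. Qed.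

End OneSystem.
End Flow.

(** * Trajectories without sliding *)

Section Trajectories.
Context {R : realType}.
Notation deriv1 f x d := (is_derive (x : R) (1 : R) f d).
Implicit Types (p q : 'cV[R]_2) (phi psi : R -> 'cV[R]_2) (t u e : R) (s : bool).

(* The sides are indexed by booleans: [true] for Y and [0 <= x], [false] for X
   and [x <= 0]. *)
Definition sgn s : R := if s then 1 else -1.
Definition side_mode s : mode := if s then ModeY else ModeX.

Lemma sgn2 s : sgn s * sgn s = 1.
Proof. by case: s; rewrite /sgn ?mulrNN mulr1. Qed.

Lemma sgnN s : sgn (~~ s) = - sgn s.
Proof. by case: s; rewrite /sgn //= opprK. Qed.

Variable Z : pwl_system R.

Definition sideA s := if s then Aplus Z else Aminus Z.
Definition sideb s := if s then bplus Z else bminus Z.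
Definition sfield s p := aff (sideA s) (sideb s) p.

Lemma followsE s phi (a c : R) : follows Z (side_mode s) phi a c <->
  forall u, a < u < c -> 0 <= sgn s * phi u 0 0 /\
    is_derive u (1 : R) phi (sfield s (phi u)).
Proof.
by case: s; split => h u hu; have [h1 h2] := h u hu; split=> //;
  move: h1; rewrite /= /Splus /Sminus /xcoord /= ?mul1r ?mulN1r ?oppr_ge0.
Qed.

Lemma sewingE s p : sewing_region Z p <->
  p 0 0 = 0 /\ 0 < sfield s p 0 0 * sfield (~~ s) p 0 0.
Proof. by case: s; rewrite // mulrC. Qed.

Variables (S C : bool -> R -> R).
Hypothesis F : forall s, fundamental (tr2 (sideA s)) (det2 (sideA s)) (S s) (C s).
Hypothesis D0 : forall s, det2 (sideA s) != 0.

Definition sflow s t p := flow (sideA s) (sideb s) (S s) (C s) t p.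

Lemma sflow0 s p : sflow s 0 p = p. Proof. exact: flow0. Qed.
Lemma sflowD s t u p : sflow s (t + u) p = sflow s t (sflow s u p). Proof. exact: flowD. Qed.
Lemma sflowK s t p : sflow s t (sflow s (- t) p) = p.
Proof. by rewrite -sflowD subrr sflow0. Qed.
Lemma sflow_deriv s t p : is_derive t (1 : R) (sflow s ^~ p) (sfield s (sflow s t p)).
Proof. exact: deriv_flow. Qed.
Lemma sflow_cont s p : continuous (sflow s ^~ p). Proof. exact: flow_cont. Qed.
Lemma sflow_unique s phi (a c : R) : continuous phi ->
  (forall u, a < u < c -> is_derive u (1 : R) phi (sfield s (phi u))) ->
  forall r u : R, a <= r <= c -> a <= u <= c -> phi u = sflow s (u - r) (phi r).
Proof. exact: flow_unique. Qed.

(** The motion is expressed by the explicit flow on closed time intervals instead of by derivatives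
    on open ones, so that it can be evaluated at the switching times themselves. *)
Definition flows_fwd s phi t e := forall r, 0 <= r <= e ->
  0 <= sgn s * phi (t + r) 0 0 /\ phi (t + r) = sflow s r (phi t).
Definition flows_bwd s phi t e := forall r, 0 <= r <= e ->
  0 <= sgn s * phi (t - r) 0 0 /\ phi (t - r) = sflow s (- r) (phi t).
Definition after_side s phi t := exists2 e, 0 < e & flows_fwd s phi t e.
Definition before_side s phi t := exists2 e, 0 < e & flows_bwd s phi t e.

Definition flow_motion phi := forall t, exists s1 s2,
  [/\ before_side s1 phi t, after_side s2 phi t & s1 != s2 -> sewing_region Z (phi t)].

Lemma flows_fwdS s phi t e e' : e' <= e -> flows_fwd s phi t e -> flows_fwd s phi t e'.
Proof. by move=> he h r /andP[r0 r1]; apply: h; rewrite r0 (le_trans r1 he). Qed.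

Lemma flows_bwdS s phi t e e' : e' <= e -> flows_bwd s phi t e -> flows_bwd s phi t e'.
Proof. by move=> he h r /andP[r0 r1]; apply: h; rewrite r0 (le_trans r1 he). Qed.

Lemma flows_fwd_shift s phi t e r : 0 <= r -> flows_fwd s phi t e -> flows_fwd s phi (t + r) (e - r).
Proof.
move=> r0 h v /andP[v0 v1].
have [|h1 h2] := h (r + v); first by apply/andP; split; lra.
have [|_ h3] := h r; first by apply/andP; split; lra.
by rewrite -addrA; split=> //; rewrite h2 h3 addrC sflowD.
Qed.

Lemma flows_fwd_bwd s phi t e r : 0 <= r <= e -> flows_fwd s phi t e -> flows_bwd s phi (t + r) r.
Proof.
move=> /andP[r0 re] h v /andP[v0 v1].
have [|h1 h2] := h (r - v); first by apply/andP; split; lra.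
have [|_ h3] := h r; first by apply/andP; split; lra.
by rewrite -addrA; split=> //; rewrite h2 h3 addrC sflowD.
Qed.

Lemma flows_bwd_fwd s phi t e r : 0 <= r <= e -> flows_bwd s phi t e -> flows_fwd s phi (t - r) r.
Proof.
move=> /andP[r0 re] h v /andP[v0 v1].
have [|h1 h2] := h (r - v); first by apply/andP; split; lra.
have [|_ h3] := h r; first by apply/andP; split; lra.
have -> : t - r + v = t - (r - v) by ring.
by split=> //; rewrite h2 h3 opprB sflowD.
Qed.

Lemma flows_fwd_after s phi t e r : 0 <= r < e -> flows_fwd s phi t e -> after_side s phi (t + r).
Proof.
move=> /andP[r0 re] h; exists (e - r); first by rewrite subr_gt0.
exact: flows_fwd_shift.
Qed.

Lemma flows_bwd_after s phi t e r : 0 < r <= e -> flows_bwd s phi t e -> after_side s phi (t - r).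
Proof.
move=> /andP[r0 re] h; exists r => //; apply: flows_bwd_fwd h.
by rewrite (ltW r0).
Qed.

Lemma near_eq_deriv (phi psi : R -> 'cV[R]_2) u e v : 0 < e ->
  (forall w, u - e < w < u + e -> phi w = psi w) ->
  is_derive u (1 : R) psi v -> is_derive u (1 : R) phi v.
Proof.
move=> e0 h; apply: near_eq_is_derive.
near=> w; apply/esym/h; near: w; apply: near_in_itvoo.
by rewrite in_itv /=; apply/andP; split; lra.
Unshelve. all: by end_near. Qed.

Lemma flows_fwd_deriv s phi t e u : flows_fwd s phi t e -> t < u < t + e ->
  is_derive u (1 : R) phi (sfield s (phi u)).
Proof.
move=> h /andP[u1 u2].
have E w : t <= w <= t + e -> phi w = sflow s (w - u) (phi u).
  move=> /andP[w1 w2].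
  have [|_] := h (w - t); first by apply/andP; split; lra.
  have [|_] := h (u - t); first by apply/andP; split; lra.
  rewrite !(addrC t) !subrK => -> ->; rewrite -sflowD; congr (sflow _ _ _); ring.
have d0 : 0 < Num.min (u - t) (t + e - u) by rewrite lt_min; apply/andP; split; lra.
apply: (near_eq_deriv (psi := fun w => sflow s (w - u) (phi u)) d0).
  move=> w; have m1 : Num.min (u - t) (t + e - u) <= u - t by rewrite ge_min lexx.
  have m2 : Num.min (u - t) (t + e - u) <= t + e - u by rewrite ge_min lexx orbT.
  by move=> /andP[w1 w2]; apply: E; apply/andP; split; lra.
have := sflow_deriv s (u - u) (phi u); rewrite {2}subrr sflow0.
move/vec_deriv => [h0 h1]; apply/vec_deriv; split.
  exact: (@deriv1_comp_shift R (fun v => sflow s v (phi u) 0 0)).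
exact: (@deriv1_comp_shift R (fun v => sflow s v (phi u) 1 0)).
Qed.

Lemma flows_bwd_deriv s phi t e u : flows_bwd s phi t e -> t - e < u < t ->
  is_derive u (1 : R) phi (sfield s (phi u)).
Proof.
move=> h hu; apply: (flows_fwd_deriv (t := t - e) (e := e)); last by rewrite subrK.
apply: (flows_bwd_fwd _ h); rewrite lexx andbT.
by move: hu => /andP[]; lra.
Qed.

Lemma derive_unique phi u v w : is_derive u (1 : R) phi v ->
  is_derive u (1 : R) phi w -> v = w.
Proof. by move=> [_ <-] [_ <-]. Qed.

(** A sliding mode on an interval would place a point of the motion in the sliding or escaping
    region, so only the two linear modes remain; uniqueness of solutions then gives the flow
    formula. *)
Lemma trajectory_flow_motion phi : trajectory Z phi ->
  (forall t, ~ (escaping_region Z `|` sliding_region Z) (phi t)) -> flow_motion phi.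
Proof.
move=> [hc ht] hns t; have [e [m1 [m2 [e0 f1 f2 sw]]]] := ht t.
have side m a c : a < c -> follows Z m phi a c -> exists s, m = side_mode s.
  case: m => ac; [by exists false|by exists true|].
  move=> /(_ ((a + c) / 2)) [|/= h _]; first by apply/andP; split; lra.
  by exfalso; apply: (hns ((a + c) / 2)); case: h; [right|left].
have [s1 E1] := side m1 (t - e) t (ltac:(lra)) f1.
have [s2 E2] := side m2 t (t + e) (ltac:(lra)) f2.
subst m1 m2; exists s1, s2.
move: f1 => /followsE f1; move: f2 => /followsE f2.
have cx s : {for t, continuous (fun u => sgn s * phi u 0 0)}.
  by apply: continuousM1; [exact: cst_continuous|case: ((vec_cont phi t).1 (hc t))].
split.
- exists (e / 2); first lra.
  move=> r /andP[r0 re]; split; last first.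
    have -> : phi (t - r) = sflow s1 (t - r - t) (phi t).
      apply: (sflow_unique hc (a := t - e) (c := t)).
      + by move=> u hu; case: (f1 u hu).
      + by apply/andP; split; lra.
      + by apply/andP; split; lra.
    by congr (sflow _ _ _); ring.
  (* The mode gives the sign of the abscissa only strictly before [t]; at [t] it follows by
     continuity. *)
  have [->|rn] := eqVneq r 0; last first.
    by case: (f1 (t - r)) => //; apply/andP; split; lra.
  rewrite subr0 leNgt; apply/negP => neg.
  have /cvgrPdist_lt := cx s1.
  move=> /(_ (- (sgn s1 * phi t 0 0))); rewrite oppr_gt0 => /(_ neg) [d /= d0 hd].
  pose v := Num.min (d / 2) (e / 2).
  have v0 : 0 < v by rewrite lt_min; apply/andP; split; lra.
  have v1 : v <= d / 2 by rewrite ge_min lexx.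
  have v2 : v <= e / 2 by rewrite ge_min lexx orbT.
  have := hd (t - v); rewrite /ball_ /= opprB addrC subrK gtr0_norm//.
  move=> /(_ ltac:(lra)) /ltr_normlP[+ _].
  by have [] := f1 (t - v) (ltac:(apply/andP; split; lra)) => ? _ ?; lra.
- exists (e / 2); first lra.
  move=> r /andP[r0 re]; split; last first.
    have -> : phi (t + r) = sflow s2 (t + r - t) (phi t).
      apply: (sflow_unique hc (a := t) (c := t + e)).
      + by move=> u hu; case: (f2 u hu).
      + by apply/andP; split; lra.
      + by apply/andP; split; lra.
    by congr (sflow _ _ _); ring.
  have [->|rn] := eqVneq r 0; last first.
    by case: (f2 (t + r)) => //; apply/andP; split; lra.
  rewrite addr0 leNgt; apply/negP => neg.
  have /cvgrPdist_lt := cx s2.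
  move=> /(_ (- (sgn s2 * phi t 0 0))); rewrite oppr_gt0 => /(_ neg) [d /= d0 hd].
  pose v := Num.min (d / 2) (e / 2).
  have v0 : 0 < v by rewrite lt_min; apply/andP; split; lra.
  have v1 : v <= d / 2 by rewrite ge_min lexx.
  have v2 : v <= e / 2 by rewrite ge_min lexx orbT.
  have := hd (t + v); rewrite /ball_ /= opprD addrA subrr sub0r normrN gtr0_norm//.
  move=> /(_ ltac:(lra)) /ltr_normlP[+ _].
  by have [] := f2 (t + v) (ltac:(apply/andP; split; lra)) => ? _ ?; lra.
- by move: sw; case: (s1); case: (s2).
Qed.


Lemma flow_motion_cont phi : flow_motion phi -> continuous phi.
Proof.
move=> h t; have [s1 [s2 [[e1 e10 h1] [e2 e20 h2] _]]] := h t.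
have c1 := @sflow_cont s1 (phi t) 0; have c2 := @sflow_cont s2 (phi t) 0.
apply/cvgrPdist_lt => d d0.
move/cvgrPdist_lt: c1 => /(_ d d0); rewrite sflow0 => -[a1 /= a10 k1].
move/cvgrPdist_lt: c2 => /(_ d d0); rewrite sflow0 => -[a2 /= a20 k2].
pose e := Num.min (Num.min e1 e2) (Num.min a1 a2).
have e0 : 0 < e by rewrite !lt_min e10 e20 a10 a20.
have [i1 i2 i3 i4] : [/\ e <= e1, e <= e2, e <= a1 & e <= a2].
  by split; rewrite !ge_min lexx ?orbT.
exists e => //= u; rewrite /ball_ /= => hu.
have [tu|ut] := leP t u.
  move: hu; rewrite distrC ger0_norm ?subr_ge0// => hu.
  have [|_] := h2 (u - t); first by apply/andP; split; lra.
  rewrite addrC subrK => ->; apply: k2.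
  by rewrite /ball_ /= sub0r normrN ger0_norm ?subr_ge0//; lra.
move: hu; rewrite gtr0_norm ?subr_gt0// => hu.
have [|_] := h1 (t - u); first by apply/andP; split; lra.
rewrite opprB addrC subrK => ->; apply: k1.
by rewrite /ball_ /= sub0r normrN ltr0_norm ?subr_lt0//; lra.
Qed.

Lemma flow_motion_trajectory phi : flow_motion phi -> trajectory Z phi.
Proof.
move=> h; split; first exact: flow_motion_cont.
move=> t; have [s1 [s2 [[e1 e10 h1] [e2 e20 h2] sw]]] := h t.
pose e := Num.min e1 e2.
have e0 : 0 < e by rewrite !lt_min e10 e20.
have {}h1 : flows_bwd s1 phi t e by apply: flows_bwdS h1; rewrite ge_min lexx.
have {}h2 : flows_fwd s2 phi t e by apply: flows_fwdS h2; rewrite ge_min lexx orbT.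
exists e, (side_mode s1), (side_mode s2); split=> //.
- apply/followsE => u hu; split; last exact: flows_bwd_deriv h1 hu.
  have [|k _] := h1 (t - u); first by move: hu => /andP[? ?]; apply/andP; split; lra.
  by move: k; rewrite opprB addrC subrK.
- apply/followsE => u hu; split; last exact: flows_fwd_deriv h2 hu.
  have [|k _] := h2 (u - t); first by move: hu => /andP[? ?]; apply/andP; split; lra.
  by move: k; rewrite addrC subrK.
- by move: sw; case: (s1); case: (s2) => //= k; exact: k.
Qed.

(** * Sides and switches of a nonconstant periodic motion *)

Section Nonconstant.
Variables (phi : R -> 'cV[R]_2) (per : R).
Hypotheses (L : flow_motion phi) (per0 : 0 < per) (phiP : forall t, phi (t + per) = phi t).

Lemma phiPn n t : phi (t + per *+ n) = phi t.
Proof. by elim: n => [|n IH]; rewrite ?addr0// mulrSr addrA phiP. Qed.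

Lemma periodic_later t u : exists n, t < u + per *+ n.
Proof.
exists (Num.bound ((t - u) / per)).
have := archi_boundP; have [h|h] := leP 0 ((t - u) / per).
  move=> /(_ _ _ h); rewrite ltr_pdivrMr// mulr_natl; lra.
move=> _; have : (t - u) / per * per < 0 by rewrite pmulr_llt0.
rewrite divfK ?gt_eqF// => k.
have : 0 <= per *+ Num.bound ((t - u) / per) by rewrite mulrn_wge0 ?ltW.
lra.
Qed.

Lemma rest_forever p a : phi a = p -> (forall s, sfield s p = 0) -> forall t, phi t = p.
Proof.
move=> pa h0; have eqs s : equil (sideA s) (sideb s) = p.
  by symmetry; apply: aff_eq0 => //; exact: h0.
have flp s r : sflow s r p = p by rewrite /sflow -(eqs s) flow_equil.
move=> t; have [n hn] := periodic_later a t.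
(* Every time is moved beyond [a] by periods, so it is enough to follow the motion forward from
   [a]. *)
rewrite -(phiPn n); apply: (@real_induction R (fun u => phi u = p) a (t + per *+ n)) => //.
- exact: ltW.
- move=> u _ pu; have [_ [s [_ [e e0 h] _]]] := L u.
  exists e => // r /andP[r1 r2]; have [|_] := h (r - u); first by apply/andP; split; lra.
  by rewrite addrC subrK pu flp.
- move=> u /andP[u1 u2] pu; have [s [_ [[e e0 h] _ _]]] := L u.
  pose v := Num.min e (u - a).
  have v0 : 0 < v by rewrite lt_min; apply/andP; split; lra.
  have v1 : v <= e by rewrite ge_min lexx.
  have v2 : v <= u - a by rewrite ge_min lexx orbT.
  have [|_] := h v; first by apply/andP; split; lra.
  rewrite pu => [/(congr1 (sflow s v))|]; last by apply/andP; split; lra.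
  by rewrite sflowK flp.
- by rewrite lexx (ltW hn).
Qed.

Hypothesis disc : discontinuous Z.
Hypothesis nonconst : exists t, phi t <> phi 0.

(** A motion obeying both fields for a while would run inside Sigma through points where they agree.
    Two such points would make the affine fields agree on all of Sigma, against discontinuity; so
    the motion rests at one point, both fields vanish there, and by [rest_forever] it is
    constant. *)
Lemma after_side_excl s t : after_side s phi t -> after_side (~~ s) phi t -> False.
Proof.
move=> [e1 e10 h1] [e2 e20 h2]; pose e := Num.min e1 e2.
have e0 : 0 < e by rewrite !lt_min e10 e20.
have {}h1 : flows_fwd s phi t e by apply: flows_fwdS h1; rewrite ge_min lexx.
have {}h2 : flows_fwd (~~ s) phi t e by apply: flows_fwdS h2; rewrite ge_min lexx orbT.
have x0 u : t < u < t + e -> phi u 0 0 = 0.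
  move=> /andP[u1 u2]; have hu : 0 <= u - t <= e by apply/andP; split; lra.
  have [k1 _] := h1 _ hu; have [k2 _] := h2 _ hu.
  move: k1 k2; rewrite addrC subrK sgnN mulNr oppr_ge0 => k1 k2.
  have : sgn s * phi u 0 0 = 0 by apply/eqP; rewrite eq_le k1 k2.
  by move/(congr1 (fun x => sgn s * x)); rewrite mulrA sgn2 mul1r mulr0.
have fe u : t < u < t + e -> sfield s (phi u) = sfield (~~ s) (phi u).
  move=> hu; apply: derive_unique; [exact: flows_fwd_deriv h1 hu|exact: flows_fwd_deriv h2 hu].
have {}fe u : t < u < t + e -> sfield false (phi u) = sfield true (phi u).
  by move=> /fe; case: (s).
have y0 u v : t < u < t + e -> t < v < t + e -> phi u 1 0 = phi v 1 0.
  move=> hu hv; apply/eqP/negPn/negP => ne.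
  have [q + []] := disc; rewrite /Sigma /= /xcoord => q0.
  have Eu := fe u hu; have Ev := fe v hv.
  have := congr1 (fun w : 'cV[R]_2 => w 0 0) Eu.
  have := congr1 (fun w : 'cV[R]_2 => w 1 0) Eu.
  have := congr1 (fun w : 'cV[R]_2 => w 0 0) Ev.
  have := congr1 (fun w : 'cV[R]_2 => w 1 0) Ev.
  rewrite /= !aff0 !aff1 /= (x0 u hu) (x0 v hv) !mulr0 !add0r => e1' e2' e3 e4.
  have yn : phi u 1 0 - phi v 1 0 != 0 by rewrite subr_eq0.
  have a0 : Aminus Z 0 1 = Aplus Z 0 1.
    by apply: (mulIf yn); move: e2' e4; lra.
  have a1 : Aminus Z 1 1 = Aplus Z 1 1.
    by apply: (mulIf yn); move: e1' e3; lra.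
  apply: vec2P; rewrite [LHS]mxE [RHS]mxE.
    by rewrite !mulA0 q0 a0; move: e4; rewrite a0; lra.
  by rewrite !mulA1 q0 a1; move: e3; rewrite a1; lra.
pose m := t + e / 2; have hm : t < m < t + e by rewrite /m; apply/andP; split; lra.
have cst u : t < u < t + e -> phi u = phi m.
  by move=> hu; apply: vec2P; [rewrite !x0|exact: y0].
have f0 : sfield s (phi m) = 0.
  have dm : is_derive m (1 : R) phi (0 : 'cV[R]_2).
    apply: (@near_eq_deriv phi (fun=> phi m) m (e / 2)); first lra.
      by move=> w /andP[w1 w2]; apply: cst; rewrite /m in w1 w2; apply/andP; split; lra.
  exact: derive_unique (flows_fwd_deriv h1 hm) dm.
have f0' s' : sfield s' (phi m) = 0.
  have : sfield (~~ s) (phi m) = 0 by rewrite -f0; have := fe m hm; case: (s).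
  by case: s' f0; case: (s).
have [u []] := nonconst.
by rewrite !(rest_forever (erefl (phi m)) f0').
Qed.

Lemma after_side_uniq s s' t : after_side s phi t -> after_side s' phi t -> s = s'.
Proof.
move=> h h'; apply/eqP/negPn/negP => ne; apply: (after_side_excl h).
by move: ne h'; case: (s); case: (s').
Qed.

Lemma before_side_uniq s s' t : before_side s phi t -> before_side s' phi t -> s = s'.
Proof.
move=> [e e0 h] [e' e'0 h']; pose d := Num.min e e'.
have d0 : 0 < d by rewrite lt_min e0.
apply: (@after_side_uniq _ _ (t - d)).
  by apply: flows_bwd_after h; rewrite d0 ge_min lexx.
by apply: flows_bwd_after h'; rewrite d0 ge_min lexx orbT.
Qed.

Lemma after_side_total t : exists s, after_side s phi t.
Proof. by have [_ [s [_ h _]]] := L t; exists s. Qed.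

Lemma before_side_total t : exists s, before_side s phi t.
Proof. by have [s [_ [h _ _]]] := L t; exists s. Qed.

Lemma switch_sewing s s' t : before_side s phi t -> after_side s' phi t -> s != s' ->
  sewing_region Z (phi t).
Proof.
move=> h1 h2; have [s1 [s2 [k1 k2 sw]]] := L t.
by rewrite (before_side_uniq h1 k1) (after_side_uniq h2 k2).
Qed.

Lemma fwd_x_deriv s t e : 0 < e -> flows_fwd s phi t e ->
  phi t 0 0 = 0 -> 0 <= sgn s * sfield s (phi t) 0 0.
Proof.
move=> e0 h x0; rewrite leNgt; apply/negP => neg.
have /vec_deriv[+ _] := sflow_deriv s 0 (phi t); rewrite sflow0 => d.
have d' := deriv1M (deriv1_cst (- sgn s) 0) d; rewrite mul0r add0r mulNr in d'.
have [||a a0 ha] := deriv_pos_near d'.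
- by rewrite sflow0 x0 mulr0.
- by rewrite oppr_gt0.
pose v := Num.min (a / 2) e.
have v0 : 0 < v by rewrite lt_min; apply/andP; split; lra.
have v1 : v <= a / 2 by rewrite ge_min lexx.
have v2 : v <= e by rewrite ge_min lexx orbT.
have [|k1 k2] := h v; first by apply/andP; split; lra.
have [|k _] := ha v; first by apply/andP; split; lra.
by move: k; rewrite add0r -k2 mulNr oppr_gt0 ltNge k1.
Qed.

Lemma bwd_x_deriv s t e : 0 < e -> flows_bwd s phi t e ->
  phi t 0 0 = 0 -> sgn s * sfield s (phi t) 0 0 <= 0.
Proof.
move=> e0 h x0; rewrite leNgt; apply/negP => pos.
have /vec_deriv[+ _] := sflow_deriv s 0 (phi t); rewrite sflow0 => d.
have d' := deriv1M (deriv1_cst (sgn s) 0) d; rewrite mul0r add0r in d'.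
have [||a a0 ha] := deriv_pos_near d'.
- by rewrite sflow0 x0 mulr0.
- by [].
pose v := Num.min (a / 2) e.
have v0 : 0 < v by rewrite lt_min; apply/andP; split; lra.
have v1 : v <= a / 2 by rewrite ge_min lexx.
have v2 : v <= e by rewrite ge_min lexx orbT.
have [|k1 k2] := h v; first by apply/andP; split; lra.
have [|_ k] := ha v; first by apply/andP; split; lra.
by move: k; rewrite sub0r -k2 ltNge k1.
Qed.

Lemma sewing_after s t : sewing_region Z (phi t) -> after_side s phi t ->
  0 < sgn s * sfield s (phi t) 0 0.
Proof.
move=> /(sewingE s)[x0 prod] [e e0 h]; have k := fwd_x_deriv e0 h x0.
rewrite lt_def k andbT; apply/eqP => E.
have E' : sfield s (phi t) 0 0 = 0 by rewrite -[LHS]mul1r -(sgn2 s) -mulrA E mulr0.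
by move: prod; rewrite E' mul0r ltxx.
Qed.

Lemma sewing_before s t : sewing_region Z (phi t) -> before_side s phi t ->
  sgn s * sfield s (phi t) 0 0 < 0.
Proof.
move=> /(sewingE s)[x0 prod] [e e0 h]; have k := bwd_x_deriv e0 h x0.
rewrite lt_def k andbT eq_sym; apply/eqP => E.
have E' : sfield s (phi t) 0 0 = 0 by rewrite -[LHS]mul1r -(sgn2 s) -mulrA E mulr0.
by move: prod; rewrite E' mul0r ltxx.
Qed.

(** Arriving from the side [s] and leaving into it require opposite signs of the first component of
    the same field at the same point. *)
Lemma sewing_switch s s' t : sewing_region Z (phi t) -> before_side s phi t ->
  after_side s' phi t -> s' = ~~ s.
Proof.
move=> sw h1 h2; have k1 := sewing_before sw h1; have k2 := sewing_after sw h2.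
apply/eqP; rewrite eq_sym -addbT; apply/negPn/negP => ne.
have E : s' = s by move: ne; case: (s); case: (s').
by move: k2; rewrite E ltNge ltW.
Qed.

Lemma no_sewing_keep s t : ~ sewing_region Z (phi t) -> before_side s phi t -> after_side s phi t.
Proof.
move=> nsw h1; have [s' h2] := after_side_total t.
have [->//|ne] := eqVneq s s'; by case: nsw; exact: switch_sewing h1 h2 ne.
Qed.

Lemma after_side_per s t : after_side s phi t -> after_side s phi (t + per).
Proof.
move=> [e e0 h]; exists e => // r hr; rewrite addrAC !phiP; exact: h.
Qed.

Lemma after_side_per_n s t n : after_side s phi t -> after_side s phi (t + per *+ n).
Proof.
by move=> h; elim: n => [|n IH]; rewrite ?addr0// mulrSr addrA; exact: after_side_per.
Qed.

(* [t + tau] is the infimum of the later times at which the motion has left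
   the side [s]. *)
Lemma next_switch s t t' : after_side s phi t -> t < t' -> after_side (~~ s) phi t' ->
  exists tau, [/\ 0 < tau, t + tau <= t',
   (forall r, 0 <= r <= tau -> 0 <= sgn s * phi (t + r) 0 0 /\
      phi (t + r) = sflow s r (phi t)),
   (forall r, 0 <= r < tau -> after_side s phi (t + r)) &
   [/\ sewing_region Z (phi (t + tau)), after_side (~~ s) phi (t + tau)
     & before_side s phi (t + tau)]].
Proof.
move=> ht tt' ht'.
pose B := [set u | t <= u /\ after_side (~~ s) phi u].
have Bt' : B t' by split=> //; exact: ltW.
have hB : has_inf B by split; [exists t'|exists t => u []].
pose m := inf B.
have mt' : m <= t' by apply: ge_inf => //; case: hB.
have tm : t < m.
  have [e e0 h] := ht; apply: (@lt_le_trans _ _ (t + e)); first lra.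
  apply: lb_le_inf; first by exists t'.
  move=> u [tu hu]; rewrite leNgt; apply/negP => ue.
  apply: (after_side_excl _ hu); have -> : u = t + (u - t) by ring.
  by apply: flows_fwd_after h; apply/andP; split; lra.
have below u : t <= u < m -> after_side s phi u.
  move=> /andP[tu um]; have [s' hs'] := after_side_total u.
  have [->//|ne] := eqVneq s s'.
  have : m <= u.
    apply: ge_inf; first by case: hB.
    by split=> //; move: hs' ne; case: (s); case: (s').
  by rewrite leNgt um.
have befb u : t < u <= m -> before_side s phi u.
  move=> /andP[tu um]; have [s' hs'] := before_side_total u.
  suff -> : s = s' by [].
  have [e e0 h] := hs'; pose d := Num.min e (u - t).
  have d0 : 0 < d by rewrite lt_min e0 subr_gt0.
  have d1 : d <= u - t by rewrite ge_min lexx orbT.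
  apply: (@after_side_uniq _ _ (u - d)); first by apply: below; apply/andP; split; lra.
  by apply: flows_bwd_after h; rewrite d0 ge_min lexx.
have befm : before_side s phi m by apply: befb; rewrite tm lexx.
have aftm : after_side (~~ s) phi m.
  have [s' hs'] := after_side_total m.
  have [E|ne] := eqVneq s s'; last by move: hs' ne; case: (s); case: (s').
  exfalso; rewrite -E in hs'; have [e e0 h] := hs'.
  have : m + e <= m.
    apply: lb_le_inf; first by exists t'.
    move=> u [tu hu]; rewrite leNgt; apply/negP => ue.
    have mu : m <= u by apply: ge_inf => //; case: hB.
    apply: (after_side_excl _ hu); have -> : u = m + (u - m) by ring.
    by apply: flows_fwd_after h; apply/andP; split; lra.
  lra.
have flow_ u : t <= u <= m -> phi u = sflow s (u - t) (phi t).
  move: u; apply: (@real_induction R (fun u => phi u = sflow s (u - t) (phi t))).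
  - exact: ltW.
  - by rewrite subrr sflow0.
  - move=> u hu IH; have [e e0 h] := below u hu.
    exists e => // r /andP[r1 r2]; have [|_] := h (r - u); first by apply/andP; split; lra.
    by rewrite addrC subrK => ->; rewrite IH -sflowD; congr (sflow _ _ _); ring.
  - move=> u hu IH; have [e e0 h] := befb u hu.
    move: hu => /andP[u1 u2]; pose d := Num.min e (u - t).
    have d0 : 0 < d by rewrite lt_min e0 subr_gt0.
    have d1 : d <= u - t by rewrite ge_min lexx orbT.
    have d2 : d <= e by rewrite ge_min lexx.
    have [|_] := h d; first by apply/andP; split; lra.
    rewrite IH; last by apply/andP; split; lra.
    move=> /(congr1 (sflow s d)); rewrite sflowK => <-.
    by rewrite -sflowD; congr (sflow _ _ _); ring.
exists (m - t); have tmK : t + (m - t) = m by ring.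
rewrite tmK; split=> //.
- by rewrite subr_gt0.
- move=> r /andP[r0 r1]; split; last first.
    rewrite flow_; first by congr (sflow _ _ _); ring.
    by apply/andP; split; lra.
  move: r1; rewrite le_eqVlt => /orP[/eqP->|r1].
    rewrite tmK; have [e e0 h] := befm.
    by have [] := h 0; rewrite ?lexx ?(ltW e0)// subr0.
  have [|e e0 h] := below (t + r); first by apply/andP; split; lra.
  by have [] := h 0; rewrite ?lexx ?(ltW e0)// addr0.
- by move=> r /andP[r0 r1]; apply: below; apply/andP; split; lra.
- split=> //; apply: switch_sewing befm aftm _; by case: (s).
Qed.

End Nonconstant.
End Trajectories.

(** * Periodic orbits and isolation *)

Section Orbits.
Context {R : realType}.
Notation deriv1 f x d := (is_derive (x : R) (1 : R) f d).
Implicit Types (p q : 'cV[R]_2) (phi psi : R -> 'cV[R]_2) (t u e : R) (s : bool).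

Variable Z : pwl_system R.
Variables (S C : bool -> R -> R).
Hypothesis F : forall s, fundamental (tr2 (sideA Z s)) (det2 (sideA Z s)) (S s) (C s).
Hypothesis D0 : forall s, det2 (sideA Z s) != 0.
Hypothesis disc : discontinuous Z.

Local Notation sflow := (sflow Z S C).
Local Notation sfield := (sfield Z).
Local Notation after_side := (after_side Z S C).
Local Notation before_side := (before_side Z S C).
Local Notation flows_fwd := (flows_fwd Z S C).
Local Notation flows_bwd := (flows_bwd Z S C).
Local Notation flow_motion := (flow_motion Z S C).
Local Notation ctr s := (equil (sideA Z s) (sideb Z s)).

Record periodic_motion phi (per : R) : Prop := PeriodicMotion {
  motion_flow : flow_motion phi;
  motion_period_gt0 : 0 < per;
  motion_periodic : forall t, phi (t + per) = phi t;
  motion_nonconstant : exists t, phi t <> phi 0 }.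

(** The induction carries a common side along with the equality of positions, since at a tangency
    the position does not tell which field is followed. In the limit step the sides before the time
    agree because they agree slightly earlier; at a sewing point both motions switch, elsewhere both
    keep their side. *)
Lemma determinism phi psi per per' s t u : periodic_motion phi per -> periodic_motion psi per' ->
  phi t = psi u -> after_side s phi t -> after_side s psi u ->
  forall r, 0 <= r -> phi (t + r) = psi (u + r).
Proof.
move=> [L l0 lp ln] [L' l0' lp' ln'] E h h' b b0.
pose P r := phi (t + r) = psi (u + r) /\
  exists s, after_side s phi (t + r) /\ after_side s psi (u + r).
suff : P b by case.
apply: (@real_induction R P 0 b) => //; last by rewrite b0 lexx.
- by split; [rewrite !addr0|exists s; rewrite !addr0].
- move=> r _ [Er [s1 [[e1 e10 h1] [e2 e20 h2]]]].
  pose e := Num.min e1 e2.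
  have e0 : 0 < e by rewrite !lt_min e10 e20.
  have i1 : e <= e1 by rewrite ge_min lexx.
  have i2 : e <= e2 by rewrite ge_min lexx orbT.
  exists e => // w /andP[w1 w2]; have Ew v : v + w = v + r + (w - r) by ring.
  split; last first.
    exists s1; rewrite !Ew; split.
      by apply: flows_fwd_after h1 => //; apply/andP; split; lra.
    by apply: flows_fwd_after h2 => //; apply/andP; split; lra.
  rewrite !Ew; have [|_ ->] := h1 (w - r); first by apply/andP; split; lra.
  have [|_ ->] := h2 (w - r); first by apply/andP; split; lra.
  by rewrite Er.
move=> r /andP[r0 rb] IH.
have [s1 b1] := before_side_total L (t + r); have [s2 b2] := before_side_total L' (u + r).
have [e1 e10 h1] := b1; have [e2 e20 h2] := b2.
pose e := Num.min r (Num.min e1 e2).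
have e0 : 0 < e by rewrite !lt_min r0 e10 e20.
have [i1 i2 i3] : [/\ e <= r, e <= e1 & e <= e2].
  by split; rewrite !ge_min lexx ?orbT.
have [|Er [s3 [a1 a2]]] := IH (r - e); first by apply/andP; split; lra.
have Ee v : v + (r - e) = v + r - e by ring.
rewrite !Ee in Er a1 a2.
have a1' : after_side s1 phi (t + r - e) by apply: flows_bwd_after h1 => //; rewrite e0 i2.
have a2' : after_side s2 psi (u + r - e) by apply: flows_bwd_after h2 => //; rewrite e0 i3.
have E1 := after_side_uniq F D0 L l0 lp disc ln a1 a1'.
have E2 := after_side_uniq F D0 L' l0' lp' disc ln' a2 a2'.
subst s1 s2.
have Pr : phi (t + r) = psi (u + r).
  have [|_ k1] := h1 e; first by rewrite (ltW e0) i2.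
  have [|_ k2] := h2 e; first by rewrite (ltW e0) i3.
  by rewrite -(sflowK F D0 s3 e (phi _)) -k1 Er k2 sflowK.
split=> //.
have [sw|nsw] := pselect (sewing_region Z (phi (t + r))); last first.
  exists s3; split; first exact: (no_sewing_keep F D0 L l0 lp disc ln nsw b1).
  by rewrite Pr in nsw; exact: (no_sewing_keep F D0 L' l0' lp' disc ln' nsw b2).
have [s4 a4] := after_side_total L (t + r); have [s5 a5] := after_side_total L' (u + r).
have E4 := sewing_switch F D0 sw b1 a4.
rewrite Pr in sw; have E5 := sewing_switch F D0 sw b2 a5.
by subst s4 s5; exists (~~ s3).
Qed.

Lemma later_in_range phi per t : periodic_motion phi per ->
  range phi = [set phi (t + r) | r in [set r | 0 <= r]].
Proof.
move=> [L l0 lp ln]; apply/seteqP; split=> [p [u _ <-]|p [r _ <-]]; last by exists (t + r).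
have [n hn] := periodic_later l0 t u.
exists (u + per *+ n - t); rewrite /=; first lra.
by rewrite addrC subrK (phiPn lp).
Qed.

Lemma same_range phi psi per per' s t u : periodic_motion phi per -> periodic_motion psi per' ->
  phi t = psi u -> after_side s phi t -> after_side s psi u -> range phi = range psi.
Proof.
move=> c c' E h h'; rewrite (later_in_range t c) (later_in_range u c').
apply/seteqP; split=> p [r /= r0 <-]; exists r => //.
  exact/esym/(determinism c c' E h h').
exact: (determinism c c' E h h').
Qed.

Lemma motion_periodic_orbit phi per : periodic_motion phi per -> periodic_orbit Z (range phi).
Proof.
move=> [L l0 lp ln]; exists phi, per; split=> //.
exact: (flow_motion_trajectory F D0).
Qed.

Lemma periodic_orbit_motion g : periodic_orbit Z g -> non_sliding Z g ->
  exists phi per, periodic_motion phi per /\ g = range phi.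
Proof.
move=> [phi [per [tr p0 pp nc ->]]] ns; exists phi, per; split=> //; split=> //.
apply: (trajectory_flow_motion F D0) => // t ht.
by have : (range phi `&` (escaping_region Z `|` sliding_region Z)) (phi t) by [];
  rewrite ns.
Qed.

Lemma compact_in_open (K U : set 'cV[R]_2) : compact K -> open U -> K `<=` U ->
  exists2 e, 0 < e & forall p q, K p -> `|p - q| < e -> U q.
Proof.
move=> cK oU KU; have /compact_near_coveringP nc := cK.
pose P (e : R) p := forall q, `|p - q| < e -> U q.
have : \forall e \near (0 : R), K `<=` P e.
  apply: (nc R (nbhs (0:R)) P) => p Kp.
  have [r /= r0 hr] : nbhs_ball p U by apply/nbhs_ballP/open_nbhs_nbhs; split=> //; exact: KU.
  near=> p' e => q hq; apply: hr; rewrite -ball_normE /=.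
  rewrite (le_lt_trans (ler_distD p' _ _))//.
  have h1 : `|p - p'| < r / 2.
    near: p'; apply: (cvgrPdist_lt id p).1 => //; last by rewrite divr_gt0.
  have h2 : e < r / 2.
    by near: e; apply: lt_nbhsl; rewrite divr_gt0.
  by rewrite [r]splitr ltrD// (lt_trans hq).
move=> [e /= e0 he]; exists (e / 2); first by rewrite divr_gt0.
move=> p q Kp h; apply: (he (e / 2) _ p) => //.
by rewrite /ball_ /= sub0r normrN gtr0_norm; lra.
Unshelve. all: by end_near. Qed.

Lemma range_compact phi per : continuous phi -> 0 < per ->
  (forall t, phi (t + per) = phi t) -> compact (range phi).
Proof.
move=> hc l0 lp.
suff -> : range phi = phi @` `[0, per].
  apply: continuous_compact; last exact: segment_compact.
  exact: continuous_subspaceT.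
apply/seteqP; split=> [p [u _ <-]|p [u _ <-]]; last by exists u.
pose n := Num.floor (u / per).
have /andP[h1 h2] := floor_itv (u / per).
rewrite ler_pdivlMr// in h1; rewrite ltr_pdivrMr// intrD mulrDl mul1r in h2.
have pz (m : int) v : phi (v + m%:~R * per) = phi v.
  case: m => m; first by rewrite -[X in X * _]/(m%:R) mulr_natl (phiPn lp).
  rewrite NegzE mulrNz mulNr -[X in X * _]/(m.+1%:R) mulr_natl.
  by rewrite -[RHS](phiPn lp m.+1 v) -[v in LHS]addr0 -[LHS](phiPn lp m.+1) addr0 subrK (phiPn lp).
exists (u - (Num.floor (u / per))%:~R * per).
  by rewrite /= in_itv /=; apply/andP; split; lra.
by rewrite -[RHS](pz (- Num.floor (u / per))) mulrNz mulNr.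
Qed.

(** A homothetic copy of ratio close to 1 lies in the isolating neighbourhood, hence would coincide
    with the orbit. Comparing the largest distances to [p] then shows that this distance is 0, so
    the motion is constant. *)
Lemma homothety_not_isolated phi per p : continuous phi -> 0 < per ->
  (forall t, phi (t + per) = phi t) -> (exists t, phi t <> phi 0) ->
  (forall k : R, 0 < k < 1 -> trajectory Z (fun t => p + k *: (phi t - p))) ->
  ~ limit_cycle Z (range phi).
Proof.
move=> hc l0 lp [t1 ln] hk [_ [U [oU gU iso]]].
have cK := range_compact hc l0 lp.
have [e e0 he] := compact_in_open cK oU gU.
have cn : continuous (fun q : 'cV[R]_2 => `|q - p|).
  move=> q; apply: (@continuous_comp _ _ _ (fun q => q - p) Num.norm).
    by apply: (@continuousB _ _ _ id (fun=> p)); [move=> ?; exact: cvg_id|exact: cst_continuous].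
  exact: norm_continuous.
have [] := @compact_EVT_max _ R (fun q : 'cV[R]_2 => `|q - p|) (range phi).
- by exists (phi 0), 0.
- exact: cK.
- exact: continuous_subspaceT.
move=> q0; rewrite inE => -[t2 _ <-] hmax'.
have hmax t : `|phi t - p| <= `|phi t2 - p| by apply: hmax'; rewrite inE; exists t.
pose M := `|phi t2 - p| + 1.
have M1 : 1 <= M by rewrite lerDr.
(* [M] bounds the distances to [p], so points move by at most [(1 - k) M], which is at most [e / 2];
   the other bound keeps [k] positive. *)
pose k := 1 - Num.min (1 / 2) (e / (2 * M)).
have m0 : 0 < Num.min (1 / 2) (e / (2 * M)).
  by rewrite lt_min !divr_gt0//; lra.
have m1 : Num.min (1 / 2) (e / (2 * M)) <= 1 / 2 by rewrite ge_min lexx.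
have m2 : Num.min (1 / 2) (e / (2 * M)) <= e / (2 * M) by rewrite ge_min lexx orbT.
have k01 : 0 < k < 1 by rewrite /k; apply/andP; split; lra.
have [k0 k1] := andP k01.
pose psi t := p + k *: (phi t - p).
have close t : `|phi t - psi t| < e.
  have -> : phi t - psi t = (1 - k) *: (phi t - p).
    by apply: vec2P; rewrite !mxE; ring.
  rewrite normrZ ger0_norm; last by lra.
  apply: (@le_lt_trans _ _ (e / (2 * M) * M)).
    have a1 : 0 <= 1 - k by rewrite /k; lra.
    have a2 : 1 - k <= e / (2 * M) by rewrite /k; lra.
    have a3 : `|phi t - p| <= M by rewrite (le_trans (hmax t))// lerDl.
    exact: ler_pM.
  rewrite (_ : e / (2 * M) * M = e / 2); first by lra.
  by field; rewrite gt_eqF//; lra.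
have E : range psi = range phi.
  apply: iso; last by move=> q [t _ <-]; apply: (he (phi t)) => //; exists t.
  exists psi, per; split=> //.
  - exact: hk.
  - by move=> t; rewrite /psi lp.
  - exists t1; rewrite /psi => /addrI /(scalerI (lt0r_neq0 k0)) /addIr; exact: ln.
have [t3 _ E3] : range psi (phi t2) by rewrite E; exists t2.
have E4 : `|phi t2 - p| = k * `|phi t3 - p|.
  by rewrite -E3 /psi addrC addKr normrZ gtr0_norm.
have E5 : `|phi t2 - p| = 0.
  apply/eqP; rewrite eq_le normr_ge0 andbT.
  have : `|phi t2 - p| <= k * `|phi t2 - p| by rewrite {1}E4 ler_pM2l.
  have := normr_ge0 (phi t2 - p); nra.
have cst t : phi t = p.
  have := hmax t; rewrite E5 normr_le0 subr_eq0 => /eqP; exact.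
by apply: ln; rewrite !cst.
Qed.

Lemma sflow_ctr s t : sflow s t (ctr s) = ctr s.
Proof. exact: flow_equil. Qed.

Lemma sflow_homothety s t k p :
  sflow s t (ctr s + k *: (p - ctr s)) = ctr s + k *: (sflow s t p - ctr s).
Proof.
have scE (c q : 'cV[R]_2) : c + k *: (q - c) =
    vec2 (c 0 0 + k * (q 0 0 - c 0 0)) (c 1 0 + k * (q 1 0 - c 1 0)).
  by apply: vec2P; rewrite ?vec2_0 ?vec2_1 !mxE.
rewrite !scE; apply: vec2P.
  by rewrite /sflow /flow [LHS]vec2_0 [RHS]vec2_0 !vec2_0 !vec2_1; ring.
by rewrite /sflow /flow [LHS]vec2_1 [RHS]vec2_1 !vec2_0 !vec2_1; ring.
Qed.

Lemma aft_everywhere_flow phi s : flow_motion phi -> (forall t, after_side s phi t) ->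
  forall t u, phi t = sflow s (t - u) (phi u).
Proof.
move=> L h; have hc := flow_motion_cont F D0 L.
have step b : forall u, 0 <= b -> phi (u + b) = sflow s b (phi u).
  move=> u b0; apply: (@real_induction R (fun r => phi (u + r) = sflow s r (phi u)) 0 b) => //.
  - by rewrite addr0 (sflow0 F).
  - move=> r _ IH; have [e e0 hr] := h (u + r); exists e => // w /andP[w1 w2].
    have [|_] := hr (w - r); first by apply/andP; split; lra.
    rewrite -addrA [r + _]addrC subrK => ->; rewrite IH -(sflowD F D0).
    by rewrite subrK.
  - move=> r /andP[r0 rb] IH.
    have cl : (phi (u + w) @[w --> r^'-]) --> phi (u + r).
      apply: cvg_within_filter.
      apply: (@continuous_comp _ _ _ (fun w => u + w) phi); last exact: hc.
      by apply: (@continuousD _ _ _ (fun=> u) id); [exact: cst_continuous|move=> ?; exact: cvg_id].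
    have cr : (phi (u + w) @[w --> r^'-]) --> sflow s r (phi u).
      apply: (@cvg_trans _ (sflow s w (phi u) @[w --> r^'-])).
        apply: near_eq_cvg; near=> w; rewrite IH//; apply/andP; split.
          near: w; exact: nbhs_left_ge.
        near: w; exact: nbhs_left_lt.
      apply: cvg_within_filter; exact: sflow_cont.
    exact: (cvg_unique _ cl cr).
  - by rewrite b0 lexx.
move=> t u; have [tu|/ltW ut] := leP u t.
  by have := step (t - u) u; rewrite subr_ge0 => /(_ tu); rewrite addrC subrK.
have := step (u - t) t; rewrite subr_ge0 => /(_ ut); rewrite addrC subrK => ->.
by rewrite -(sflowD F D0) -opprB addNr (sflow0 F).
Unshelve. all: by end_near. Qed.

(** Contractions towards the equilibrium commute with the single linear flow. They preserve the
    half-plane by convexity, once the equilibrium is known to lie in it. *)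
Lemma one_sided_not_limit phi per s : periodic_motion phi per -> (forall t, after_side s phi t) ->
  ~ limit_cycle Z (range phi).
Proof.
move=> [L l0 lp ln] h; have hc := flow_motion_cont F D0 L.
have hf := aft_everywhere_flow L h.
have sg t : 0 <= sgn s * phi t 0 0.
  have [e e0 k] := h t; have [|k1 _] := k 0; first by rewrite lexx ltW.
  by rewrite addr0 in k1.
have dphi t : is_derive t (1 : R) phi (sfield s (phi t)).
  apply: (@near_eq_deriv _ phi (fun u => sflow s (u - t) (phi t)) t 1) => //.
  have := sflow_deriv F D0 s (t - t) (phi t); rewrite {2}subrr (sflow0 F).
  move/vec_deriv => [h0 h1]; apply/vec_deriv; split.
    exact: (@deriv1_comp_shift R (fun v => sflow s v (phi t) 0 0)).
  exact: (@deriv1_comp_shift R (fun v => sflow s v (phi t) 1 0)).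
(* Otherwise [x' - T x] would be strictly monotone along the orbit. *)
have ctr_side : 0 <= sgn s * (ctr s) 0 0.
  rewrite leNgt; apply/negP => neg.
  pose A := sideA Z s.
  pose m t := A 0 1 * (phi t 1 0 - (ctr s) 1 0) - A 1 1 * (phi t 0 0 - (ctr s) 0 0).
  have dm t : deriv1 m t (- det2 A * (phi t 0 0 - (ctr s) 0 0)).
    have /vec_deriv[h0 h1] := dphi t.
    apply: (deriv1_eq (deriv1D (deriv1M (deriv1_cst (A 0 1) t) (deriv1D h1 (deriv1_cst (- (ctr s) 1 0) t)))
      (deriv1N (deriv1M (deriv1_cst (A 1 1) t) (deriv1D h0 (deriv1_cst (- (ctr s) 0 0) t)))))).
    have -> : sfield s (phi t) 0 0 = A 0 0 * (phi t 0 0 - (ctr s) 0 0) + A 0 1 * (phi t 1 0 - (ctr s) 1 0).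
      by rewrite /sfield (affE _ (D0 s)) [LHS]vec2_0.
    have -> : sfield s (phi t) 1 0 = A 1 0 * (phi t 0 0 - (ctr s) 0 0) + A 1 1 * (phi t 1 0 - (ctr s) 1 0).
      by rewrite /sfield (affE _ (D0 s)) [LHS]vec2_1.
    by rewrite /det2; ring.
  have mper : m 0 = m per by rewrite /m -[per]add0r lp.
  have [c _ /eqP] := deriv_rolle l0 (fun t _ => dm t) mper.
  rewrite mulf_eq0 oppr_eq0 (negbTE (D0 s)) /= subr_eq0 => /eqP E.
  by have := sg c; rewrite E leNgt neg.
apply: (homothety_not_isolated (p := ctr s) hc l0 lp ln) => k /andP[k0 k1].
apply: (flow_motion_trajectory F D0) => t; exists s, s.
have sg' u : 0 <= sgn s * (ctr s + k *: (phi u - ctr s)) 0 0.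
  have -> : (ctr s + k *: (phi u - ctr s)) 0 0 = (1 - k) * (ctr s) 0 0 + k * phi u 0 0.
    by rewrite !mxE; ring.
  rewrite mulrDr !(mulrCA (sgn s)) addr_ge0// mulr_ge0//; lra.
split; last by rewrite eqxx.
  exists 1 => // r _; split=> //.
  rewrite sflow_homothety; congr (_ + k *: (_ - _)); rewrite (hf (t - r) t); congr (sflow _ _ _); ring.
exists 1 => // r _; split=> //.
rewrite sflow_homothety; congr (_ + k *: (_ - _)); rewrite (hf (t + r) t); congr (sflow _ _ _); ring.
Qed.

(** Two arcs with common endpoints are repeated periodically; the sewing hypotheses make both
    concatenations admissible. *)
Lemma closing (p0 p1 : 'cV[R]_2) (a b : R) : 0 < a -> 0 < b ->
  sflow true a p0 = p1 -> sflow false b p1 = p0 ->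
  (forall r, 0 <= r <= a -> 0 <= sflow true r p0 0 0) ->
  (forall r, 0 <= r <= b -> sflow false r p1 0 0 <= 0) ->
  sewing_region Z p0 -> sewing_region Z p1 ->
  exists phi, [/\ flow_motion phi, forall t, phi (t + (a + b)) = phi t,
    (forall r, 0 <= r <= a -> phi r = sflow true r p0),
    (forall r, 0 <= r <= b -> phi (a + r) = sflow false r p1) &
    [/\ after_side true phi 0, after_side false phi a &
    range phi = [set sflow true r p0 | r in [set r | 0 <= r <= a]] `|`
                [set sflow false r p1 | r in [set r | 0 <= r <= b]]]].
Proof.
move=> a0 b0 E01 E10 hY hX sw0 sw1; pose P := a + b.
have P0 : 0 < P by rewrite addr_gt0.
(* The time modulo the period, taken in [[0, P)]. *)
pose m (t : R) := t - (Num.floor (t / P))%:~R * P.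
have m_itv t : 0 <= m t < P.
  have /andP[h1 h2] := floor_itv (t / P).
  rewrite ler_pdivlMr// in h1; rewrite ltr_pdivrMr// intrD mulrDl mul1r in h2.
  by rewrite /m; apply/andP; split; lra.
have m_id t : 0 <= t < P -> m t = t.
  move=> /andP[t0 t1]; rewrite /m (_ : Num.floor _ = 0) ?mul0r ?subr0//.
  by apply: floor_def; rewrite add0r divr_ge0 ?(ltW P0)//= ltr_pdivrMr// mul1r.
have m_P t : m (t + P) = m t.
  rewrite /m mulrDl divff ?gt_eqF// floorDrz ?intr1// ?rpred1// floor1 intrD.
  by rewrite mulrDl mul1r; ring.
pose phi t := if m t < a then sflow true (m t) p0 else sflow false (m t - a) p1.
have phiP t : phi (t + P) = phi t by rewrite /phi m_P.
have phiY r : 0 <= r <= a -> phi r = sflow true r p0.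
  move=> /andP[r0 ra]; rewrite /phi m_id; last by rewrite /P; apply/andP; split; lra.
  move: ra; rewrite le_eqVlt => /orP[/eqP->|->//].
  by rewrite ltxx subrr (sflow0 F) E01.
have phi_per : phi P = p0.
  by rewrite -[P]add0r phiP phiY ?lexx ?(ltW a0)// (sflow0 F).
have phiX r : 0 <= r <= b -> phi (a + r) = sflow false r p1.
  move=> /andP[r0]; rewrite le_eqVlt => /orP[/eqP->|rb].
    by rewrite -/P phi_per E10.
  rewrite /phi m_id; last by rewrite /P; apply/andP; split; lra.
  by rewrite ltNge lerDl r0 /= addrC addKr.
have phim t : phi t = phi (m t).
  by rewrite /phi (m_id (m t)) ?m_itv.
have phim_add t r : phi (t + r) = phi (m t + r).
  have pz (n : int) v : phi (v + n%:~R * P) = phi v.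
    have pn k w : phi (w + P *+ k) = phi w.
      by elim: k => [|k IH]; rewrite ?addr0// mulrSr addrA phiP.
    case: n => n; first by rewrite -[X in X * _]/(n%:R) mulr_natl pn.
    rewrite NegzE mulrNz mulNr -[X in X * _]/(n.+1%:R) mulr_natl.
    by rewrite -[LHS](pn n.+1) subrK.
  rewrite /m -[RHS](pz (Num.floor (t / P))); congr (phi _); ring.
have fwdY t : 0 <= t < a -> flows_fwd true phi t (a - t).
  move=> /andP[t0 t1] r /andP[r0 r1].
  rewrite !phiY; try by apply/andP; split; lra.
  rewrite mul1r addrC (sflowD F D0); split=> //.
  by rewrite -(sflowD F D0); apply: hY; apply/andP; split; lra.
have fwdX t : 0 <= t < b -> flows_fwd false phi (a + t) (b - t).
  move=> /andP[t0 t1] r /andP[r0 r1].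
  rewrite -addrA !phiX; try by apply/andP; split; lra.
  rewrite mulN1r oppr_ge0 addrC (sflowD F D0); split=> //.
  by rewrite -(sflowD F D0); apply: hX; apply/andP; split; lra.
have aftm t : flows_fwd true phi (m t) (a - m t) \/ flows_fwd false phi (m t) (P - m t).
  have /andP[h1 h2] := m_itv t; have [h|h] := ltP (m t) a.
    by left; apply: fwdY; rewrite h1 h.
  right; have := fwdX (m t - a); rewrite [a + _]addrC subrK.
  rewrite (_ : b - (m t - a) = P - m t); last by rewrite /P; ring.
  by apply; rewrite /P in h2; apply/andP; split; lra.
have aft_m s t : after_side s phi (m t) -> after_side s phi t.
  move=> [e e0 h]; exists e => // r hr.
  by rewrite phim_add [phi t]phim; exact: h.
have bef_m s t : before_side s phi (m t) -> before_side s phi t.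
  move=> [e e0 h]; exists e => // r hr.
  by rewrite phim_add [phi t]phim; exact: h.
have L : flow_motion phi.
  move=> t; have /andP[h1 h2] := m_itv t.
  (* At the start of a period the motion just before is the end of the preceding X-arc, and must be
     found by adding one period. *)
  have [mt0|mt0] := eqVneq (m t) 0.
    exists false, true; split.
    - apply: bef_m; rewrite mt0; exists b => // r hr.
      have := @flows_fwd_bwd _ Z S C F D0 false phi (a + 0) (b - 0) b (ltac:(by rewrite subr0 lexx (ltW b0)))
        (fwdX 0 (ltac:(by rewrite lexx b0))) r hr.
      rewrite addr0 -/P => -[k1 k2].
      rewrite sub0r -[phi (- r)]phiP [- r + P]addrC; split=> //.
      by rewrite k2 -[phi 0]phiP add0r.
    - apply: aft_m; rewrite mt0; exists (a - 0); first by rewrite subr0.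
      by apply: fwdY; rewrite lexx a0.
    - by move=> _; rewrite phim mt0 phiY ?lexx ?(ltW a0)// (sflow0 F).
  have mt1 : 0 < m t by rewrite lt_def mt0 h1.
  have [h|h|h] := ltgtP (m t) a.
  - exists true, true; split; last by [].
      apply: bef_m; exists (m t) => //.
      have := @flows_fwd_bwd _ Z S C F D0 true phi 0 (a - 0) (m t) _ (fwdY 0 _).
      by rewrite add0r; apply; rewrite ?subr0 ?lexx ?h1//= ltW.
    by apply: aft_m; exists (a - m t); rewrite ?subr_gt0//; apply: fwdY; rewrite h1.
  - exists false, false; split; last by [].
      apply: bef_m; exists (m t - a); first by rewrite subr_gt0.
      have := @flows_fwd_bwd _ Z S C F D0 false phi (a + 0) (b - 0) (m t - a) _ (fwdX 0 _).
      rewrite addr0 [a + (_ - _)]addrC subrK; apply; last by rewrite lexx b0.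
      by rewrite /P in h2; apply/andP; split; lra.
    apply: aft_m; exists (P - m t); first by rewrite subr_gt0.
    have := fwdX (m t - a); rewrite [a + _]addrC subrK.
    rewrite (_ : b - (m t - a) = P - m t); last by rewrite /P; ring.
    by apply; rewrite /P in h2; apply/andP; split; lra.
  - exists true, false; split.
    - apply: bef_m; rewrite h; exists a => //.
      have := @flows_fwd_bwd _ Z S C F D0 true phi 0 (a - 0) a _ (fwdY 0 _).
      by rewrite add0r; apply; rewrite ?subr0 ?lexx ?a0 ?(ltW a0).
    - apply: aft_m; rewrite h; exists (b - 0); first by rewrite subr0.
      by have := fwdX 0; rewrite addr0; apply; rewrite lexx b0.
    - by move=> _; rewrite phim h phiY ?lexx ?(ltW a0)// E01.
exists phi; split=> //; split.
- by exists (a - 0); [rewrite subr0|apply: fwdY; rewrite lexx a0].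
- by exists (b - 0); [rewrite subr0|have := fwdX 0; rewrite addr0; apply; rewrite lexx b0].
- apply/seteqP; split=> [q [t _ <-]|q [[r /= hr <-]|[r /= hr <-]]].
  + rewrite phim; have /andP[h1 h2] := m_itv t.
    have [h|h] := leP (m t) a.
      by left; exists (m t); rewrite /= ?h1 ?h// phiY// h1 h.
    right; exists (m t - a); first by rewrite /= ; rewrite /P in h2; apply/andP; split; lra.
    rewrite -phiX; first by rewrite addrC subrK.
    by rewrite /P in h2; apply/andP; split; lra.
  + by exists r; rewrite // phiY.
  + by exists (a + r); rewrite // phiX.
Qed.

End Orbits.

(** * Arcs in a half-plane *)

Section Arcs.
Context {R : realType}.
Notation deriv1 f x d := (is_derive (x : R) (1 : R) f d).

Lemma min_lt_pair (a b : R) : 0 < a -> 0 < b -> exists c, [/\ 0 < c, c < a & c < b].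
Proof.
move=> a0 b0; have [h|h] := leP a b; first by exists (a / 2); split; lra.
by exists (b / 2); split; lra.
Qed.

Variables (T D : R) (S C : R -> R).
Hypothesis F : fundamental T D S C.
Hypothesis D0 : D != 0.
Hypothesis osc : (forall t, 0 < t -> 0 < S t) \/ exists h, oscillates T D S C h.

Local Notation W := (Wf T D S C).

Lemma W_pos z : 0 < z -> (forall r, 0 < r < z -> 0 < S r) -> 0 < W z.
Proof.
move=> z0 h; rewrite -(W0 F).
exact: (deriv_gt0_lt z0 (fun t _ => deriv1_W F t D0)).
Qed.

(* [d] is the constant term of [x'' = T x' - D x + d], and the arc starts on
   the line [x = 0] with velocity [v] and returns to it at time [tau] with
   velocity [w]. *)
Record arc (d v tau w : R) : Prop := Arc {
  arc_tau : 0 < tau;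
  arc_v : v < 0;
  arc_w : 0 < w;
  arc_le : forall r, 0 <= r <= tau -> v * S r + d * W r <= 0;
  arc_x : v * S tau + d * W tau = 0;
  arc_x' : v * C tau + d * S tau = w }.

Lemma osc_Sh h : oscillates T D S C h -> S h = 0.
Proof. by move=> o; rewrite -[h]add0r (osc_S o) (fund_S0 F) mulr0. Qed.

Lemma osc_uniq h h' : oscillates T D S C h -> oscillates T D S C h' -> h = h'.
Proof.
move=> o o'; have [k|k|//] := ltgtP h h'.
  by have := osc_pos o' (t := h); rewrite (osc_h o) k (osc_Sh o) ltxx => /(_ isT).
by have := osc_pos o (t := h'); rewrite (osc_h o') k (osc_Sh o') ltxx => /(_ isT).
Qed.

Lemma osc_Ch h : oscillates T D S C h -> C h = - expR (T * h / 2).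
Proof. by move=> o; rewrite -[h in LHS]add0r (osc_C o) (fund_C0 F) mulr1. Qed.

Lemma osc_neg h t : oscillates T D S C h -> h < t < h + h -> S t < 0.
Proof.
move=> o /andP[t1 t2]; rewrite -[t](subrK h) (osc_S o) mulNr oppr_lt0.
by rewrite mulr_gt0 ?expR_gt0// (osc_pos o)//; apply/andP; split; lra.
Qed.

Lemma osc_W_pos h t : oscillates T D S C h -> 0 < t <= h -> 0 < W t.
Proof.
move=> o /andP[t0 th]; apply: W_pos => // r /andP[r0 rt].
by rewrite (osc_pos o)// r0 (lt_le_trans rt).
Qed.

Lemma osc_S2 h t : oscillates T D S C h -> S (t + (h + h)) = expR (T * h) * S t.
Proof.
move=> o; rewrite addrA !(osc_S o) mulrA mulrNN -expRD; congr (expR _ * _); lra.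
Qed.

Lemma osc_W2 h t : oscillates T D S C h ->
  W (t + (h + h)) = expR (T * h) * W t + (1 - expR (T * h)) / D.
Proof.
move=> o; have E : C (t + (h + h)) = expR (T * h) * C t.
  rewrite addrA !(osc_C o) mulrA mulrNN -expRD; congr (expR _ * _); lra.
by rewrite /Wf E osc_S2//; field.
Qed.

(** For a focus [D > 0], and [d] has the sign of the abscissa of the centre: an arc in [x <= 0]
    takes exactly half a turn about a centre on the line, less about a centre beyond it, and between
    half and a full turn about a centre on its own side. A node or saddle allows only [d > 0]. *)
Lemma arc_cases d v tau w : arc d v tau w ->
  [\/ d = 0 /\ exists2 h, oscillates T D S C h & tau = h,
      0 < d /\ (forall r, 0 < r <= tau -> 0 < S r) |
      d < 0 /\ exists2 h, oscillates T D S C h & h < tau < h + h].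
Proof.
move=> [t0 v0 w0 le x0 x1]; case: osc => [pos|[h o]].
  constructor 2; split; last by move=> r /andP[r0 _]; exact: pos.
  have Wp : 0 < W tau by apply: W_pos => // r /andP[r0 _]; exact: pos.
  have k : 0 < d * W tau.
    have : v * S tau < 0 by rewrite nmulr_rlt0 ?pos.
    lra.
  by rewrite -(pmulr_lgt0 _ Wp).
have h0 := osc_h o; have Wh : 0 < W h by rewrite (osc_W_pos o)// h0 lexx.
have [d0|d0|d0] := ltgtP d 0; last first.
- constructor 1; split=> //; exists h => //; rewrite d0 mul0r addr0 in x0.
  have [th|ht|//] := ltgtP tau h.
    have : S tau > 0 by rewrite (osc_pos o)// t0 th.
    by move/eqP: x0; rewrite mulf_eq0 lt_eqF//= => /eqP->; rewrite ltxx.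
  have [e [e0 e1 e2]] := @min_lt_pair (tau - h) h (ltac:(lra)) h0.
  have := le (h + e); rewrite d0 mul0r addr0 => k.
  have : 0 < v * S (h + e).
    by rewrite nmulr_rgt0// (osc_neg o)//; apply/andP; split; lra.
  have : v * S (h + e) <= 0 by apply: k; apply/andP; split; lra.
  lra.
- constructor 2; split=> // r /andP[r0 rt].
  have [ht|th] := leP h tau; last by rewrite (osc_pos o)// r0 (le_lt_trans rt).
  have := le h; rewrite (osc_Sh o) mulr0 add0r => k.
  have : d * W h <= 0 by apply: k; rewrite (ltW h0).
  by rewrite pmulr_lle0// leNgt d0.
constructor 3; split=> //; exists h => //; apply/andP; split.
  rewrite ltNge; apply/negP => th.
  have Wt : 0 < W tau by rewrite (osc_W_pos o)// t0.
  have k1 : d * W tau < 0 by rewrite nmulr_rlt0.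
  have : S tau <= 0 by rewrite -(nmulr_rge0 _ v0); lra.
  move: th; rewrite le_eqVlt => /orP[/eqP E|th].
    by move: x0; rewrite E (osc_Sh o) mulr0 add0r -E => k2; lra.
  by rewrite leNgt (osc_pos o)// t0.
rewrite ltNge; apply/negP => ht.
have Dp := osc_D o.
pose x t := v * S t + d * W t.
have x2 t : x (t + (h + h)) = expR (T * h) * x t + d * ((1 - expR (T * h)) / D).
  by rewrite /x (osc_S2 _ o) (osc_W2 _ o); ring.
have xle r : 0 <= r <= tau -> x r <= 0 := le r.
have x00 : x 0 = 0 by rewrite /x (fund_S0 F) (W0 F) !mulr0 addr0.
(* If the arc lasted a full turn, [x] would be positive one turn before [tau] for an attracting
   focus, at time [h + h] for a repelling one, and just before [h + h] for a centre. *)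
have [E|E|E] := ltgtP (expR (T * h)) 1.
- have := x2 (tau - (h + h)); rewrite subrK => E2.
  have xt : x tau = 0 by [].
  have k1 : d * ((1 - expR (T * h)) / D) < 0 by rewrite nmulr_rlt0// divr_gt0// subr_gt0.
  have : 0 < expR (T * h) * x (tau - (h + h)) by move: E2; rewrite xt; lra.
  rewrite pmulr_rgt0 ?expR_gt0// ltNge => /negP; apply.
  by apply: xle; apply/andP; split; lra.
- have := x2 0; rewrite add0r x00 mulr0 add0r => E2.
  have : 0 < x (h + h).
    by rewrite E2 nmulr_rgt0// pmulr_llt0 ?invr_gt0// subr_lt0.
  by rewrite ltNge xle//; apply/andP; split; lra.
have dx : deriv1 (fun t => - x t) 0 (- v).
  apply: (deriv1_eq (deriv1N (deriv1D (deriv1M (deriv1_cst v 0) (fund_S F 0)) (deriv1M (deriv1_cst d 0) (deriv1_W F 0 D0))))).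
  by rewrite (fund_S0 F) (fund_C0 F); ring.
have [||e e0 he] := deriv_pos_near dx; [by rewrite x00 oppr0|by rewrite oppr_gt0|].
have [r [r0 r1 r2]] := @min_lt_pair e h e0 h0.
have [|_] := he r; first by rewrite r0.
rewrite oppr_lt0 sub0r => k.
have := x2 (- r); rewrite E subrr mul0r mulr0 addr0 mul1r => E2.
have : x (- r + (h + h)) <= 0 by apply: xle; apply/andP; split; lra.
by rewrite E2 leNgt k.
Qed.

Definition Vf (d t : R) : R := - d * W t / S t.
Definition Uf (d t : R) : R := d * (S t - W t * C t / S t).

Lemma arc_VU d v tau w : arc d v tau w -> S tau != 0 ->
  v = Vf d tau /\ w = Uf d tau.
Proof.
move=> [t0 v0 w0 le x0 x1] Sn.
have Ev : v = Vf d tau by apply: (mulIf Sn); rewrite /Vf divfK//; lra.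
by split=> //; rewrite -x1 Ev /Vf /Uf; field.
Qed.

Lemma deriv_Vf d t : S t != 0 -> deriv1 (Vf d) t (- Uf d t / S t).
Proof.
move=> Sn; have dS := fund_S F t; have dW := deriv1_W F t D0.
apply: (deriv1_eq (deriv1M (deriv1M (deriv1_cst (- d) t) dW) (deriv1V Sn dS))).
by rewrite /Uf; field.
Qed.

(** The Wronskian identity reduces the numerator to a multiple of [Vf]. Thus [Vf] and [Uf] satisfy a
    closed linear system, and the sign of each controls the monotonicity of the other. *)
Lemma deriv_Uf d t : S t != 0 -> deriv1 (Uf d) t (- (expR (T * t) * Vf d t) / S t).
Proof.
move=> Sn; have dS := fund_S F t; have dW := deriv1_W F t D0.
have dC_ := fund_C F t.
apply: (deriv1_eq (deriv1M (deriv1_cst d t) (deriv1D dS (deriv1N (deriv1M (deriv1M dW dC_) (deriv1V Sn dS)))))).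
by rewrite -(fund_wronskian F t) /Vf; field.
Qed.

(* In the quadrant [v < 0 < w] the derivatives of [Vf] and [Uf] have opposite
   constant signs, so the return map of the arcs is decreasing. *)
Lemma arc_mono d v tau w v' tau' w' : d != 0 -> arc d v tau w ->
  arc d v' tau' w' -> tau < tau' -> (v < v' /\ w' < w) \/ (v' < v /\ w < w').
Proof.
move=> dn a a' tt.
have t0 := arc_tau a.
case: (arc_cases a') => [[d0]|[dp Sp]|[dneg [h o /andP[h1 h2]]]].
- by rewrite d0 eqxx in dn.
- right.
  have Sn r : tau <= r <= tau' -> S r != 0.
    by move=> /andP[r1 r2]; rewrite gt_eqF// Sp//; apply/andP; split; lra.
  have [Ev Ew] := arc_VU a (Sn tau (ltac:(by rewrite lexx ltW))).
  have [Ev' Ew'] := arc_VU a' (Sn tau' (ltac:(by rewrite lexx ltW))).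
  have Vneg r : tau <= r <= tau' -> Vf d r < 0.
    move=> /andP[r1 r2]; rewrite /Vf mulNr mulNr oppr_lt0 divr_gt0//.
      rewrite mulr_gt0//; apply: W_pos; first lra.
      by move=> z /andP[z1 z2]; apply: Sp; apply/andP; split; lra.
    by apply: Sp; apply/andP; split; lra.
  have Umono s : tau < s <= tau' -> Uf d tau < Uf d s.
    move=> /andP[s1 s2]; apply: (deriv_gt0_lt s1 (df := fun t => - (expR (T * t) * Vf d t) / S t)).
      by move=> x /andP[x1 x2]; apply/deriv_Uf/Sn; apply/andP; split; lra.
    move=> x /andP[x1 x2]; rewrite divr_gt0//.
      by rewrite oppr_gt0 pmulr_rlt0 ?expR_gt0// Vneg//; apply/andP; split; lra.
    by apply: Sp; apply/andP; split; lra.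
  rewrite Ev Ev' Ew Ew'; split; last by apply: Umono; rewrite tt lexx.
  apply: (deriv_lt0_gt tt (df := fun t => - Uf d t / S t)).
    by move=> x hx; apply/deriv_Vf/Sn.
  move=> x /andP[x1 x2]; rewrite mulNr oppr_lt0 divr_gt0//.
    rewrite (@lt_trans _ _ (Uf d tau))//; first by rewrite -Ew (arc_w a).
    by apply: Umono; rewrite x1 ltW.
  by apply: Sp; apply/andP; split; lra.
left.
have ht : h < tau.
  case: (arc_cases a) => [[d0]|[dp]|[_ [h' o' /andP[h1' h2']]]].
  - by rewrite d0 eqxx in dn.
  - by move: dp; rewrite ltNge ltW.
  - by rewrite (osc_uniq o o').
have Sneg r : tau <= r <= tau' -> S r < 0.
  by move=> /andP[r1 r2]; rewrite (osc_neg o)//; apply/andP; split; lra.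
have Sn r : tau <= r <= tau' -> S r != 0.
  by move=> /Sneg k; rewrite lt_eqF.
have [Ev Ew] := arc_VU a (Sn tau (ltac:(by rewrite lexx ltW))).
have [Ev' Ew'] := arc_VU a' (Sn tau' (ltac:(by rewrite lexx ltW))).
have Wt' : 0 < W tau'.
  have : Vf d tau' < 0 by rewrite -Ev' (arc_v a').
  rewrite /Vf nmulr_llt0 ?invr_lt0 ?Sneg ?lexx ?ltW//.
  by rewrite pmulr_rgt0// oppr_gt0.
(* Here [S < 0], so [W] decreases and its positivity at the later time [tau'] is inherited by the
   earlier ones. *)
have Wp r : tau <= r <= tau' -> 0 < W r.
  move=> /andP[r1]; rewrite le_eqVlt => /orP[/eqP->//|r2].
  apply: (lt_trans Wt'); apply: (deriv_lt0_gt r2 (fun t _ => deriv1_W F t D0)).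
  by move=> x /andP[x1 x2]; apply: Sneg; apply/andP; split; lra.
have Vneg r : tau <= r <= tau' -> Vf d r < 0.
  move=> hr; rewrite /Vf nmulr_llt0 ?invr_lt0 ?Sneg//.
  by rewrite pmulr_rgt0 ?Wp// oppr_gt0.
have Umono s : tau <= s < tau' -> Uf d tau' < Uf d s.
  move=> /andP[s1 s2]; apply: (deriv_lt0_gt s2 (df := fun t => - (expR (T * t) * Vf d t) / S t)).
    by move=> x /andP[x1 x2]; apply/deriv_Uf/Sn; apply/andP; split; lra.
  move=> x /andP[x1 x2]; have hx : tau <= x <= tau' by apply/andP; split; lra.
  by rewrite nmulr_llt0 ?invr_lt0 ?Sneg// oppr_gt0 pmulr_rlt0 ?expR_gt0// Vneg.
rewrite Ev Ev' Ew Ew'; split; last by apply: Umono; rewrite tt lexx.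
apply: (deriv_gt0_lt tt (df := fun t => - Uf d t / S t)).
  by move=> x hx; apply/deriv_Vf/Sn.
move=> x /andP[x1 x2]; have hx : tau <= x <= tau' by apply/andP; split; lra.
rewrite nmulr_lgt0 ?invr_lt0 ?Sneg// oppr_lt0.
rewrite (@lt_trans _ _ (Uf d tau'))//; first by rewrite -Ew' (arc_w a').
by apply: Umono; rewrite x2 ltW.
Qed.

Lemma arc_det d v tau w tau' w' : arc d v tau w -> arc d v tau' w' ->
  tau = tau' /\ w = w'.
Proof.
move=> a a'; suff E : tau = tau' by subst tau'; rewrite -(arc_x' a) -(arc_x' a').
have [d0|dn] := eqVneq d 0.
  have z b z' : arc d v b z' -> exists2 h, oscillates T D S C h & b = h.
    case/arc_cases => [[_ //]|[]|[]]; by rewrite d0 ltxx.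
  have [h o ->] := z _ _ a; have [h' o' ->] := z _ _ a'.
  exact: osc_uniq.
have [hh|hh|//] := ltgtP tau tau'.
  by case: (arc_mono dn a a' hh) => -[]; rewrite ltxx.
by case: (arc_mono dn a' a hh) => -[]; rewrite ltxx.
Qed.

Lemma arc_decr d v tau w v' tau' w' : arc d v tau w -> arc d v' tau' w' ->
  v < v' -> w' < w.
Proof.
move=> a a' vv; have [d0|dn] := eqVneq d 0.
  have z b u u' : arc d u b u' -> exists2 h, oscillates T D S C h & u' = - expR (T * h / 2) * u.
    move=> k; have kx := arc_x' k; case/arc_cases: k => [[_ [h o E]]|[]|[]]; rewrite ?d0 ?ltxx//.
    by exists h => //; rewrite -kx E d0 mul0r addr0 (osc_Ch o) mulrC.
  have [h o E] := z _ _ _ a; have [h' o' E'] := z _ _ _ a'.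
  have hh : h = h' by exact: osc_uniq.
  by rewrite E E' -hh !mulNr ltrN2 ltr_pM2l ?expR_gt0.
have [hh|hh|E] := ltgtP tau tau'.
- by case: (arc_mono dn a a' hh) => -[] //; rewrite ltNge ltW.
- by case: (arc_mono dn a' a hh) => -[] //; rewrite ltNge ltW.
have t0 := arc_tau a; have Sn : S tau != 0.
  case: (arc_cases a) => [[d0]|[dp Sp]|[_ [h o /(osc_neg o) k]]]; last by rewrite lt_eqF.
    by rewrite d0 eqxx in dn.
  by rewrite gt_eqF// Sp// t0 lexx.
have [Ev _] := arc_VU a Sn; rewrite E in Sn; have [Ev' _] := arc_VU a' Sn.
by move: vv; rewrite Ev Ev' E ltxx.
Qed.


(** By the sign of [d] both arcs fall into the same case of [arc_cases], so all intermediate times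
    lie between the same two zeros of [S]. This provides the interval for Rolle's theorem. *)
Lemma arc_S_neq0 d v tau w v' tau' w' : d != 0 -> arc d v tau w ->
  arc d v' tau' w' -> forall r, tau <= r <= tau' -> S r != 0.
Proof.
move=> dn a a' r /andP[r1 r2]; have t0 := arc_tau a.
case: (arc_cases a') => [[d0]|[dp Sp]|[dneg [h' o' /andP[h1' h2']]]].
- by rewrite d0 eqxx in dn.
- by rewrite gt_eqF// Sp//; apply/andP; split; lra.
case: (arc_cases a) => [[d0]|[dp]|[_ [h o /andP[h1 h2]]]].
- by rewrite d0 eqxx in dn.
- by move: dp; rewrite ltNge ltW.
have E := osc_uniq o o'; subst h'.
by rewrite lt_eqF// (osc_neg o)//; apply/andP; split; lra.
Qed.

(* Rolle twice: on an interval where [S] does not vanish, the derivative of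
   the displacement [Vf + c Uf] is a nonzero multiple of a function whose
   derivative is [S t * (expR (- T * t) - c)]. *)
Lemma four_arcs (d c k : R) (v w tau : 'I_4 -> R) : d != 0 -> 0 < c ->
  (forall i, arc d (v i) (tau i) (w i)) ->
  (forall i, v i - k = - c * (w i - k)) ->
  (forall i j : 'I_4, (i < j)%N -> tau i < tau j) ->
  [/\ T = 0, c = 1 & k = 0].
Proof.
move=> dn c0 ha hk ht.
pose o (i : nat) : 'I_4 := inord i.
have lt01 : tau (o 0%N) < tau (o 1%N) by apply: ht; rewrite !inordK.
have lt12 : tau (o 1%N) < tau (o 2%N) by apply: ht; rewrite !inordK.
have lt23 : tau (o 2%N) < tau (o 3%N) by apply: ht; rewrite !inordK.
have Sn r : tau (o 0%N) <= r <= tau (o 3%N) -> S r != 0.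
  exact: arc_S_neq0 dn (ha _) (ha _) _.
pose f t := Vf d t + c * Uf d t.
pose m (t : R) : R := (1 - expR (- T * t) * C t) / D - c * W t.
pose f' (t : R) : R := - (d * expR (T * t) * m t) / S t ^+ 2.
have En (t : R) : expR (T * t) * expR (- T * t) = 1.
  by rewrite -expRD mulNr subrr expR0.
have df t : tau (o 0%N) <= t <= tau (o 3%N) -> deriv1 f t (f' t).
  move=> /Sn Snt.
  apply: (deriv1_eq (deriv1D (deriv_Vf d Snt) (deriv1M (deriv1_cst c t) (deriv_Uf d Snt)))).
  have -> : f' t = - (d * ((expR (T * t) - expR (T * t) * expR (- T * t) * C t) / D - c * expR (T * t) * W t)) / S t ^+ 2.
    by rewrite /f' /m; field; rewrite Snt D0.
  rewrite En mul1r -(fund_wronskian F t) /Uf /Vf /Wf; field.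
  by rewrite Snt D0.
have dm t : deriv1 m t (S t * (expR (- T * t) - c)).
  have dC_ := fund_C F t.
  apply: (deriv1_eq (deriv1D (deriv1M (deriv1D (deriv1_cst 1 t) (deriv1N (deriv1M (deriv1_expRM (- T) t) dC_))) (deriv1_cst D^-1 t))
    (deriv1N (deriv1M (deriv1_cst c t) (deriv1_W F t D0))))).
  by field.
have fv i : tau (o 0%N) <= tau i <= tau (o 3%N) -> f (tau i) = k * (1 + c).
  move=> /Sn Sni; have [Ev Ew] := arc_VU (ha i) Sni.
  by rewrite /f -Ev -Ew; have := hk i; lra.
have roll i j : tau (o 0%N) <= tau i -> tau i < tau j -> tau j <= tau (o 3%N) ->
    exists2 s, tau i < s < tau j & m s = 0.
  move=> h1 h2 h3; have [||s hs E] := deriv_rolle h2 (f := f) (df := f').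
  - by move=> x /andP[x1 x2]; apply: df; apply/andP; split; lra.
  - by rewrite !fv//; apply/andP; split; lra.
  exists s => //; move/eqP: E; have /andP[s1 s2] := hs.
  have Sns : S s != 0 by apply: Sn; apply/andP; split; lra.
  rewrite /f' mulNr oppr_eq0 mulf_eq0 invr_eq0 expf_eq0 /= (negbTE Sns) orbF.
  by rewrite !mulf_eq0 (negbTE dn) gt_eqF ?expR_gt0//= => /eqP.
have [s1 /andP[s1a s1b] m1] := roll (o 0%N) (o 1%N) (ltac:(lra)) lt01 (ltac:(lra)).
have [s2 /andP[s2a s2b] m2] := roll (o 1%N) (o 2%N) (ltac:(lra)) lt12 (ltac:(lra)).
have [s3 /andP[s3a s3b] m3] := roll (o 2%N) (o 3%N) (ltac:(lra)) lt23 (ltac:(lra)).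
have roll2 a b : tau (o 0%N) < a -> a < b -> b < tau (o 3%N) -> m a = 0 -> m b = 0 ->
    exists2 r, a < r < b & expR (- T * r) = c.
  move=> h1 h2 h3 ma mb; have [|r /andP[r1 r2] /eqP E] := deriv_rolle h2 (fun t _ => dm t).
    by rewrite ma mb.
  exists r; first by rewrite r1.
  have Sns : S r != 0 by apply: Sn; apply/andP; split; lra.
  by move: E; rewrite mulf_eq0 (negbTE Sns)/= subr_eq0 => /eqP.
have [r1 /andP[r1a r1b] E1] := roll2 s1 s2 (ltac:(lra)) (ltac:(lra)) (ltac:(lra)) m1 m2.
have [r2 /andP[r2a r2b] E2] := roll2 s2 s3 (ltac:(lra)) (ltac:(lra)) (ltac:(lra)) m2 m3.
(* [expR (- T * t)] takes the value [c] at two distinct times, so it is constant. *)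
have T0 : T = 0.
  have /expR_inj E : expR (- T * r1) = expR (- T * r2) by rewrite E1 E2.
  have : T * (r2 - r1) = 0 by lra.
  by move/eqP; rewrite mulf_eq0 subr_eq0 (gt_eqF (lt_trans r1b r2a)) orbF => /eqP.
have c1 : c = 1 by rewrite -E1 T0 oppr0 mul0r expR0.
split=> //.
have h0 : tau (o 0%N) <= tau (o 0%N) <= tau (o 3%N) by apply/andP; split; lra.
have := fv _ h0; rewrite /f c1 mul1r.
have Sn0 := Sn _ h0; set t := tau _ in Sn0 *.
(* With [T = 0] the Wronskian identity makes the displacement vanish; its value at an arc is also
   [k (1 + c) = 2 k]. *)
have -> : Vf d t + Uf d t = 0.
  have := fund_wronskian F t; rewrite T0 !mul0r expR0 subr0 => wr.
  have -> : Vf d t + Uf d t = d * (C t ^+ 2 - 0 * C t * S t + D * S t ^+ 2 - 1) / (D * S t).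
    by rewrite /Vf /Uf /Wf T0; field; rewrite Sn0 D0.
  by rewrite !mul0r subr0 wr subrr mulr0 mul0r.
lra.
Qed.

(** For [d = 0] the X-arcs multiply the velocity by a constant [- l], and the closing condition is
    the linear equation [(1 - c l) v = (1 + c) k]; two solutions make both sides degenerate. *)
Lemma two_arcs_d0 (c k : R) v w tau v' w' tau' : arc 0 v tau w -> arc 0 v' tau' w' ->
  v - k = - c * (w - k) -> v' - k = - c * (w' - k) -> 0 < c -> v != v' -> k = 0.
Proof.
move=> a a' E E' c0 vv.
have z b u u' : arc 0 u b u' -> exists2 h, oscillates T D S C h & u' = - expR (T * h / 2) * u.
  move=> p; have px := arc_x' p; case/arc_cases: p => [[_ [h o e]]|[]|[]]; rewrite ?ltxx//.
  by exists h => //; rewrite -px e mul0r addr0 (osc_Ch o) mulrC.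
have [h o Ew] := z _ _ _ a; have [h' o' Ew'] := z _ _ _ a'.
have hh : h = h' by exact: osc_uniq.
subst h'; set l := expR _ in Ew Ew'.
have e1 : (1 - c * l) * (v - v') = 0.
  by rewrite Ew Ew' in E E'; lra.
have e2 : 1 - c * l = 0.
  by move/eqP: e1; rewrite mulf_eq0 [v - v' == 0]subr_eq0 (negbTE vv) orbF => /eqP.
have e3 : (1 + c) * k = 0.
  have : (1 - c * l) * v = (1 + c) * k by rewrite Ew in E; lra.
  by rewrite e2 mul0r.
by move/eqP: e3; rewrite mulf_eq0 gt_eqF/=; [move/eqP|lra].
Qed.

(** For [T = 0] the Wronskian identity gives [Uf = - Vf], so the velocity is reversed along each
    arc. The point to check for nearby times is that the arcs stay in [x <= 0]. *)
Lemma arc_family d v tau w : d != 0 -> T = 0 -> arc d v tau w ->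
  exists2 e, 0 < e & forall s, `|s - tau| < e ->
    S s != 0 /\ arc d (Vf d s) s (- Vf d s).
Proof.
move=> dn T0 a; have t0 := arc_tau a.
have Sn : S tau != 0 by apply: (arc_S_neq0 dn a a); rewrite lexx.
have [Ev Ew] := arc_VU a Sn.
have UV t : S t != 0 -> Uf d t = - Vf d t.
  move=> St; apply/eqP; rewrite -subr_eq0 opprK; apply/eqP.
  have := fund_wronskian F t; rewrite T0 !mul0r expR0 subr0 => wr.
  have -> : Uf d t + Vf d t = d * (C t ^+ 2 + D * S t ^+ 2 - 1) / (D * S t).
    by rewrite /Vf /Uf /Wf T0; field; rewrite St D0.
  by rewrite wr subrr mulr0 mul0r.
have [e1 e10 he1] : exists2 e, 0 < e & forall s, `|s - tau| < e -> Vf d s < 0.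
  have := is_derive_cont (deriv_Vf d Sn) => /cvgrPdist_lt /(_ (- Vf d tau)).
  rewrite oppr_gt0 -Ev (arc_v a) => /(_ isT) [e /= e0 he]; exists e => // s hs.
  have := he s; rewrite /ball_ /= distrC => /(_ hs) /ltr_normlP[]; lra.
have build s : 0 < s -> S s != 0 -> Vf d s < 0 ->
    (forall r, 0 <= r <= s -> Vf d s * S r + d * W r <= 0) -> arc d (Vf d s) s (- Vf d s).
  move=> s0 Ss Vs le; split=> //; first by rewrite oppr_gt0.
    by rewrite /Vf divfK//; lra.
  by rewrite -(UV _ Ss) /Uf /Vf; field.
(* This turns the sign of [x] at the time [r] into a comparison of the values of [Vf], which is
   settled by its monotonicity. *)
have xE s r : S r != 0 -> Vf d s * S r + d * W r = S r * (Vf d s - Vf d r).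
  by move=> Sr; rewrite [in RHS](_ : Vf d r = - d * W r / S r)//; field.
have x0 s : Vf d s * S 0 + d * W 0 = 0 by rewrite (fund_S0 F) (W0 F) !mulr0 addr0.
case: (arc_cases a) => [[d0]|[dp Sp]|[dneg [h o /andP[h1 h2]]]].
- by rewrite d0 eqxx in dn.
- have [e2 e20 he2] : exists2 e, 0 < e & forall s, `|s - tau| < e -> 0 < S s.
    have := is_derive_cont (fund_S F tau) => /cvgrPdist_lt /(_ (S tau)).
    rewrite Sp ?lexx ?t0// => /(_ isT) [e /= e0 he]; exists e => // s hs.
    have := he s; rewrite /ball_ /= distrC => /(_ hs) /ltr_normlP[]; lra.
  have [e3 [e30 e31 e32]] := min_lt_pair e10 e20.
  have [e [e0 e1' e2']] := min_lt_pair e30 t0.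
  exists e => // s hs; have [hs1 hs2] := (ltr_normlP _ _ hs).
  have s0 : 0 < s by lra.
  have Sps r : 0 < r <= s -> 0 < S r.
    move=> /andP[r0 rs]; have [rt|tr] := leP r tau; first by rewrite Sp// r0.
    by apply: he2; rewrite gtr0_norm ?subr_gt0//; lra.
  have Ss : S s != 0 by rewrite gt_eqF// Sps// s0 lexx.
  split=> //; apply: build => //; first by apply: he1; lra.
  move=> r /andP[]; rewrite le_eqVlt => /orP[/eqP <- _|r0 rs]; first by rewrite x0.
  rewrite xE; last by rewrite gt_eqF// Sps// r0.
  rewrite pmulr_rle0; last by rewrite Sps// r0.
  rewrite subr_le0; move: rs; rewrite le_eqVlt => /orP[/eqP->//|rs].
  apply/ltW; apply: (deriv_lt0_gt rs (df := fun t => - Uf d t / S t)).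
    move=> t /andP[t1 t2]; apply: deriv_Vf.
    by rewrite gt_eqF// Sps//; apply/andP; split; lra.
  move=> t /andP[t1 t2]; have St : 0 < S t by rewrite Sps//; apply/andP; split; lra.
  rewrite UV ?gt_eqF// opprK pmulr_llt0 ?invr_gt0// /Vf mulNr mulNr oppr_lt0.
  rewrite divr_gt0// mulr_gt0//; apply: W_pos; first lra.
  by move=> z /andP[z1 z2]; apply: Sps; apply/andP; split; lra.
have [e3 [e30 e31 e32]] := @min_lt_pair e1 (tau - h) e10 (ltac:(lra)).
have [e [e0 e1' e2']] := @min_lt_pair e3 (h + h - tau) e30 (ltac:(lra)).
exists e => // s hs; have [hs1 hs2] := (ltr_normlP _ _ hs).
have h0 := osc_h o.
have Sneg r : h < r <= s -> S r < 0.
  by move=> /andP[r1 r2]; rewrite (osc_neg o)//; apply/andP; split; lra.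
have hs' : h < s by lra.
have Ss : S s < 0 by rewrite Sneg// hs' lexx.
have Vs : Vf d s < 0 by apply: he1; lra.
split; first by rewrite lt_eqF.
apply: build => //; [lra|by rewrite lt_eqF|].
move=> r /andP[]; rewrite le_eqVlt => /orP[/eqP <- _|r0 rs]; first by rewrite x0.
have [rh|hr] := leP r h.
  have k1 : d * W r < 0 by rewrite nmulr_rlt0// (osc_W_pos o)// r0.
  have : Vf d s * S r <= 0.
    rewrite nmulr_rle0//; move: rh; rewrite le_eqVlt => /orP[/eqP->|rh].
      by rewrite (osc_Sh o).
    by rewrite ltW// (osc_pos o)// r0.
  lra.
have Sr : S r < 0 by rewrite Sneg// hr.
rewrite xE ?lt_eqF// nmulr_rle0// subr_ge0.
move: rs; rewrite le_eqVlt => /orP[/eqP->//|rs].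
apply/ltW; apply: (deriv_gt0_lt rs (df := fun t => - Uf d t / S t)).
  move=> t /andP[t1 t2]; apply: deriv_Vf.
  by rewrite lt_eqF// Sneg//; apply/andP; split; lra.
move=> t /andP[t1 t2]; have St : S t < 0 by rewrite Sneg//; apply/andP; split; lra.
rewrite UV ?lt_eqF// opprK nmulr_lgt0 ?invr_lt0//.
have Ws : 0 < W s.
  move: Vs; rewrite /Vf nmulr_llt0 ?invr_lt0//.
  by rewrite pmulr_rgt0// oppr_gt0.
rewrite /Vf nmulr_llt0 ?invr_lt0// pmulr_rgt0 ?oppr_gt0//.
apply: (lt_trans Ws); apply: (deriv_lt0_gt t2 (fun u _ => deriv1_W F u D0)).
by move=> x /andP[x1 x2]; apply: Sneg; apply/andP; split; lra.
Qed.

End Arcs.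

(** * Cycles of systems centred on Sigma *)

Section CentredOnSigma.
Context {R : realType}.
Notation deriv1 f x d := (is_derive (x : R) (1 : R) f d).
Implicit Types (p q : 'cV[R]_2) (phi psi : R -> 'cV[R]_2) (t u e : R) (s : bool).

Variable Z : pwl_system R.
Variables (S C : bool -> R -> R).
Local Notation trS s := (tr2 (sideA Z s)).
Local Notation detS s := (det2 (sideA Z s)).
Hypothesis F : forall s, fundamental (trS s) (detS s) (S s) (C s).
Hypothesis D0 : forall s, detS s != 0.
Hypothesis osc : forall s, (forall t, 0 < t -> 0 < S s t) \/
  exists h, oscillates (trS s) (detS s) (S s) (C s) h.
Hypothesis disc : discontinuous Z.

Local Notation sflow := (sflow Z S C).
Local Notation sfield := (sfield Z).
Local Notation after_side := (after_side Z S C).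
Local Notation before_side := (before_side Z S C).
Local Notation flow_motion := (flow_motion Z S C).
Local Notation periodic_motion := (periodic_motion Z S C).
Local Notation ctr s := (equil (sideA Z s) (sideb Z s)).
Local Notation W s := (Wf (trS s) (detS s) (S s) (C s)).

(** The constant term of the second-order equation [x'' = T x' - D x + d] satisfied by the abscissa
    along the flow of the side [s]. *)
Definition force s : R := detS s * (ctr s) 0 0.

Lemma sfieldE0 s p : sfield s p 0 0 = sideA Z s 0 0 * (p 0 0 - (ctr s) 0 0) +
  sideA Z s 0 1 * (p 1 0 - (ctr s) 1 0).
Proof. by rewrite /sfield (affE _ (D0 s)) [LHS]vec2_0. Qed.

Lemma sflow_x s r p : p 0 0 = 0 ->
  sflow s r p 0 0 = sfield s p 0 0 * S s r + force s * W s r.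
Proof.
move=> p0; rewrite sfieldE0 /sflow /flow [LHS]vec2_0 p0 /force /Wf /tr2.
by field; exact: D0.
Qed.

Lemma sflow_x' s r p : p 0 0 = 0 ->
  sfield s (sflow s r p) 0 0 = sfield s p 0 0 * C s r + force s * S s r.
Proof.
move=> p0; rewrite !sfieldE0.
have -> : sflow s r p 0 0 - (ctr s) 0 0 = C s r * (p 0 0 - (ctr s) 0 0) +
   S s r * (sideA Z s 0 1 * (p 1 0 - (ctr s) 1 0) - sideA Z s 1 1 * (p 0 0 - (ctr s) 0 0)).
  by rewrite [X in X - _]vec2_0 addrC addKr.
have -> : sflow s r p 1 0 - (ctr s) 1 0 = C s r * (p 1 0 - (ctr s) 1 0) +
   S s r * (sideA Z s 1 0 * (p 0 0 - (ctr s) 0 0) - sideA Z s 0 0 * (p 1 0 - (ctr s) 1 0)).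
  by rewrite [X in X - _]vec2_1 addrC addKr.
by rewrite p0 /force /det2; ring.
Qed.

Hypothesis ctr_sigma : (ctr true) 0 0 = 0.

Local Notation q := (ctr true).
Local Notation vx p := (sfield false p 0 0).
Local Notation vy p := (sfield true p 0 0).
Local Notation k := (vx q).
Local Notation d := (force false).
Local Notation arcX := (arc (trS false) (detS false) (S false) (C false) d).
Local Notation oscY h := (oscillates (trS true) (detS true) (S true) (C true) h).
Local Notation ratio h := (expR (trS true * h / 2)).

Lemma vyE p : p 0 0 = 0 -> vy p = sideA Z true 0 1 * (p 1 0 - q 1 0).
Proof. by move=> p0; rewrite sfieldE0 p0 ctr_sigma subrr mulr0 add0r. Qed.

Lemma vxE p : p 0 0 = 0 -> vx p = k + sideA Z false 0 1 * (p 1 0 - q 1 0).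
Proof. by move=> p0; rewrite !sfieldE0 p0 ctr_sigma; ring. Qed.

Lemma vx_inj p p' : sideA Z false 0 1 != 0 -> p 0 0 = 0 -> p' 0 0 = 0 ->
  vx p = vx p' -> p = p'.
Proof.
move=> an p0 p0'; rewrite (vxE p0) (vxE p0') => /addrI /(mulfI an) /addIr E.
by apply: vec2P => //; rewrite p0 p0'.
Qed.

Lemma half_turn h p : oscY h -> p 0 0 = 0 ->
  [/\ sflow true h p 0 0 = 0, vx (sflow true h p) = k - ratio h * (vx p - k)
    & vy (sflow true h p) = - ratio h * vy p].
Proof.
move=> o p0; have Sh := osc_Sh (F true) o; have Ch := osc_Ch (F true) o.
have x0 : sflow true h p 0 0 = 0.
  by rewrite sflow_x// Sh mulr0 add0r /force ctr_sigma mulr0 mul0r.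
have y0 : sflow true h p 1 0 - q 1 0 = - ratio h * (p 1 0 - q 1 0).
  by rewrite [X in X - _]vec2_1 Sh Ch mul0r addr0 addrC addKr.
split=> //; first by rewrite (vxE x0) (vxE p0) y0; ring.
by rewrite (vyE x0) (vyE p0) y0; ring.
Qed.

(** These times define the section of the return map, with the first component of X as
    coordinate. *)
Definition enters_Y phi t := sewing_region Z (phi t) /\ after_side true phi t.

Lemma enters_Y_x phi t : enters_Y phi t -> phi t 0 0 = 0.
Proof. by move=> [/(sewingE Z true)[]]. Qed.

(** * The return map along one crossing periodic motion *)

Section OneCycle.
Variables (phi : R -> 'cV[R]_2) (per : R).
Hypothesis cy : periodic_motion phi per.
Hypothesis leaves : exists t, after_side false phi t.

Let L := motion_flow cy.
Let l0 := motion_period_gt0 cy.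
Let lp := motion_periodic cy.
Let ln := motion_nonconstant cy.

Lemma later_after s t : (exists t', after_side s phi t') -> exists2 t', t < t' & after_side s phi t'.
Proof.
move=> [t' h]; have [n hn] := periodic_later l0 t t'.
by exists (t' + per *+ n) => //; exact: (after_side_per_n lp).
Qed.

Lemma enters_vx_gt0 t : enters_Y phi t -> 0 < vx (phi t) /\ 0 < vy (phi t).
Proof.
move=> [sw h]; have := sewing_after F D0 sw h; rewrite mul1r => k1.
by move/(sewingE Z true): sw => [_]; rewrite pmulr_rgt0.
Qed.

(** With the centre of Y on Sigma there is no force term: on the Y-arc [x] is a positive multiple of
    [S true]. Its return to Sigma forces a zero of [S true], hence a focus, and staying in [0 <= x]
    forces the first such zero. *)
Lemma next_entry t : enters_Y phi t -> exists h tau,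
  [/\ oscY h, arcX (k - ratio h * (vx (phi t) - k)) tau (vx (phi (t + h + tau))),
   enters_Y phi (t + h + tau) &
   [/\ forall u, t < u < t + h + tau -> ~ enters_Y phi u,
     forall r, 0 <= r <= h -> phi (t + r) = sflow true r (phi t) &
     forall r, 0 <= r <= tau -> phi (t + h + r) = sflow false r (sflow true h (phi t))]].
Proof.
move=> en; have [sw at_] := en; have x0 := enters_Y_x en.
have [vx0 vy0] := enters_vx_gt0 en.
have [t1 t1t ht1] := later_after t leaves.
have [h [h0 _ dom aft_in [sw1 at1 be1]]] := next_switch F D0 L l0 lp disc ln at_ t1t ht1.
have E1 : phi (t + h) = sflow true h (phi t).
  by case: (dom h) => //; rewrite lexx ltW.
have x1 : phi (t + h) 0 0 = 0 by move/(sewingE Z true): sw1 => [].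
have xY r : 0 <= r <= h -> 0 <= S true r.
  move=> hr; have [] := dom r hr; rewrite mul1r => + E.
  by rewrite E sflow_x// /force ctr_sigma mulr0 mul0r addr0 pmulr_rge0.
have Sh : S true h = 0.
  move: x1; rewrite E1 sflow_x// /force ctr_sigma mulr0 mul0r addr0 => /eqP.
  by rewrite mulf_eq0 gt_eqF//= => /eqP.
have oh : oscY h.
  case: (osc true) => [pos|[h' o]]; first by have := pos h h0; rewrite Sh ltxx.
  suff -> : h = h' by [].
  have [hh|hh|//] := ltgtP h h'.
    by have := osc_pos o (t := h); rewrite h0 hh Sh ltxx => /(_ isT).
  have [e [e0 e1 e2]] := @min_lt_pair R (h - h') h' (ltac:(lra)) (osc_h o).
  have h'0 := osc_h o.
  have := @osc_neg R _ _ _ _ h' (h' + e) o (ltac:(apply/andP; split; lra)).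
  by rewrite ltNge xY//; apply/andP; split; lra.
have [_ v1 vy1] := half_turn oh x0; rewrite -E1 in v1 vy1.
have [t2 t2t ht2] := later_after (t + h) (ex_intro _ t at_).
have [tau [tau0 _ dom2 aft_in2 [sw2 at2 be2]]] := next_switch F D0 L l0 lp disc ln at1 t2t ht2.
have E2 : phi (t + h + tau) = sflow false tau (phi (t + h)).
  by case: (dom2 tau) => //; rewrite lexx ltW.
have x2 : phi (t + h + tau) 0 0 = 0 by move/(sewingE Z true): sw2 => [].
have en2 : enters_Y phi (t + h + tau) by [].
exists h, tau; split=> //.
  rewrite -v1; split=> //.
  - by have := sewing_after F D0 sw1 at1; rewrite mulN1r oppr_gt0.
  - by have [] := enters_vx_gt0 en2.
  - move=> r hr; have [] := dom2 r hr; rewrite mulN1r oppr_ge0 => + E.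
    by rewrite E sflow_x.
  - by rewrite -sflow_x// -E2.
  - by rewrite E2 sflow_x'.
split=> //.
- move=> u /andP[u1 u2] [swu atu].
  have [uh|hu] := ltP u (t + h); last first.
    have := aft_in2 (u - (t + h)); rewrite [t + h + _]addrC subrK => a2.
    have {}a2 : after_side false phi u by apply: a2; apply/andP; split; lra.
    exact: (after_side_excl F D0 L l0 lp disc ln a2 atu).
  have [s bu] := before_side_total L u.
  have E := sewing_switch F D0 swu bu atu.
  have {E} sE : s = false by move: E; case: (s).
  subst s; have [e e0 hb] := bu.
  have [r [r0 r1 r2]] := @min_lt_pair R e (u - t) e0 (ltac:(lra)).
  have a3 : after_side false phi (u - r) by apply: flows_bwd_after hb => //; rewrite r0 ltW.
  have a4 : after_side true phi (u - r).
    have := aft_in (u - r - t); rewrite [t + _]addrC subrK; apply.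
    by apply/andP; split; lra.
  exact: (after_side_excl F D0 L l0 lp disc ln a3 a4).
- by move=> r hr; case: (dom r hr).
- by move=> r hr; rewrite -E1; case: (dom2 r hr).
Qed.

Lemma entry_osc t : enters_Y phi t -> exists h, oscY h.
Proof. by move=> /next_entry[h [tau [ho _ _ _]]]; exists h. Qed.

Lemma next_entry_mono t u h tau h' tau' w w' : enters_Y phi t -> enters_Y phi u ->
  oscY h -> oscY h' -> vx (phi t) <= vx (phi u) ->
  arcX (k - ratio h * (vx (phi t) - k)) tau w ->
  arcX (k - ratio h' * (vx (phi u) - k)) tau' w' -> w <= w'.
Proof.
move=> et eu o o'; rewrite -(osc_uniq (F true) o o').
rewrite le_eqVlt => /orP[/eqP <-|lt_v] a a'.
  by have [_ ->] := arc_det (F false) (D0 false) (osc false) a a'.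
apply/ltW; apply: (arc_decr (F false) (D0 false) (osc false) a' a).
by rewrite ltrD2l ltrN2 ltr_pM2l ?expR_gt0// ltrD2r.
Qed.

(* The return map is increasing, hence along a periodic motion it can only
   have a fixed point. *)
Lemma entry_fixed t h tau w : enters_Y phi t -> oscY h ->
  arcX (k - ratio h * (vx (phi t) - k)) tau w -> w = vx (phi t).
Proof.
move=> et o a; have h0 := osc_h o.
have neq (e : bool) : ~ (0 < sgn e * (w - vx (phi t))).
  move=> lt_e.
  (* Successive entries are at least [h] apart, so induction on [n] reaches every later entry, in
     particular the one at [t + per], where the velocity is the initial one again. *)
  have key n : forall b u, enters_Y phi b -> 0 <= sgn e * (vx (phi b) - vx (phi t)) ->
      b < u -> u <= b + h *+ n -> enters_Y phi u -> 0 < sgn e * (vx (phi u) - vx (phi t)).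
    elim: n => [|n IH] b u eb hb bu; first by rewrite mulr0n addr0 leNgt bu.
    rewrite mulrS addrA => ub eu.
    have [h' [tau' [ho' a' e' [no _ _]]]] := next_entry eb.
    have E := osc_uniq (F true) o ho'; subst h'.
    set b' := b + h + tau' in e' no a'.
    have t0 := arc_tau a'.
    have hb' : 0 < sgn e * (vx (phi b') - vx (phi t)).
      move: lt_e hb; case: (e); rewrite /sgn ?mul1r ?mulN1r ?oppr_gt0 ?oppr_ge0
        ?subr_gt0 ?subr_lt0 ?subr_ge0 ?subr_le0 => k1 k2.
        exact: lt_le_trans k1 (next_entry_mono et eb o o k2 a a').
      exact: le_lt_trans (next_entry_mono eb et o o k2 a' a) k1.
    have [ub'|b'u|->//] := ltgtP u b'; first by case: (no u) => //; rewrite bu.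
    apply: (IH b') => //; first exact: ltW.
    by apply: (le_trans ub); rewrite lerD2r /b'; lra.
  have [n hn] := periodic_later h0 (t + per) t.
  have ep : enters_Y phi (t + per).
    by case: et => sw at_; split; [rewrite lp|exact: after_side_per].
  have := key n t (t + per) et (ltac:(by rewrite subrr mulr0)) (ltac:(by rewrite ltrDl)) (ltW hn) ep.
  by rewrite lp subrr mulr0 ltxx.
have := neq true; have := neq false.
rewrite /sgn mul1r mulN1r oppr_gt0 subr_gt0 subr_lt0 => /negP; rewrite -leNgt => k1.
by move=> /negP; rewrite -leNgt => k2; apply/eqP; rewrite eq_le k1 k2.
Qed.

Lemma entry_arc t : enters_Y phi t -> exists h tau, [/\ oscY h, 
  arcX (k - ratio h * (vx (phi t) - k)) tau (vx (phi t)),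
   (forall r, 0 <= r <= h -> phi (t + r) = sflow true r (phi t)) &
   (forall r, 0 <= r <= tau -> phi (t + h + r) = sflow false r (sflow true h (phi t)))].
Proof.
move=> et; have [h [tau [ho a _ [_ h1 h2]]]] := next_entry et.
by exists h, tau; split=> //; rewrite -{2}(entry_fixed et ho a).
Qed.

(** Otherwise the first component of X would be constant on Sigma, while it has opposite signs at
    the two ends of the X-arc. Hence it is a coordinate on Sigma. *)
Lemma entry_a01 t : enters_Y phi t -> sideA Z false 0 1 != 0.
Proof.
move=> et; have [h [tau [ho a _ _]]] := entry_arc et.
apply/eqP => a0; have x0 := enters_Y_x et.
have [x1 v1 _] := half_turn ho x0.
have := arc_v a; rewrite -v1 (vxE x1) a0 mul0r addr0 => k1.
by have := arc_w a; rewrite (vxE x0) a0 mul0r addr0 ltNge ltW.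
Qed.

Lemma entry_unique t u : enters_Y phi t -> enters_Y phi u -> vx (phi u) = vx (phi t).
Proof.
move=> et eu; have [h o] := entry_osc et; have h0 := osc_h o.
have key n : forall b u, enters_Y phi b -> vx (phi b) = vx (phi t) ->
    b < u -> u <= b + h *+ n -> enters_Y phi u -> vx (phi u) = vx (phi t).
  elim: n => [|n IH] b v eb hb bv; first by rewrite mulr0n addr0 leNgt bv.
  rewrite mulrS addrA => vb ev.
  have [h' [tau' [ho' a' e' [no _ _]]]] := next_entry eb.
  have E := osc_uniq (F true) o ho'; subst h'.
  set b' := b + h + tau' in e' no a'.
  have t0 := arc_tau a'.
  have hb' : vx (phi b') = vx (phi t) by rewrite (entry_fixed eb o a') hb.
  have [vb'|b'v|->//] := ltgtP v b'; first by case: (no v) => //; rewrite bv.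
  by apply: (IH b') => //; apply: (le_trans vb); rewrite lerD2r /b'; lra.
have [m hm] := periodic_later l0 t u.
have [n hn] := periodic_later h0 (u + per *+ m) t.
have eum : enters_Y phi (u + per *+ m).
  by case: eu => sw au; split; [rewrite (phiPn lp)|exact: (after_side_per_n lp)].
by have := key n t _ et (erefl _) hm (ltW hn) eum; rewrite (phiPn lp).
Qed.

End OneCycle.

Lemma motion_cases phi per : periodic_motion phi per ->
  (exists s, forall t, after_side s phi t) \/
  (exists t, after_side false phi t) /\ (exists t, enters_Y phi t).
Proof.
move=> cy; have [L l0 lp ln] := cy.
have [h|/existsNP[t1 h1]] := pselect (forall t, after_side true phi t); first by left; exists true.
have [h|/existsNP[t2 h2]] := pselect (forall t, after_side false phi t); first by left; exists false.
have a1 : after_side false phi t1 by have [[] //] := after_side_total L t1.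
have a2 : after_side true phi t2 by have [[] //] := after_side_total L t2.
right; split; first by exists t1.
have [t3 lt3 a3] := later_after cy t1 (ex_intro _ t2 a2).
have [tau [_ _ _ _ [sw at_ _]]] := next_switch F D0 L l0 lp disc ln a1 lt3 a3.
by exists (t1 + tau).
Qed.

Lemma same_entry phi psi per per' t u : periodic_motion phi per -> periodic_motion psi per' ->
  (exists t, after_side false phi t) -> enters_Y phi t -> enters_Y psi u ->
  vx (phi t) = vx (psi u) -> range phi = range psi.
Proof.
move=> c c' lv e e' E.
have P := vx_inj (entry_a01 c lv e) (enters_Y_x e) (enters_Y_x e') E.
exact: (same_range F D0 disc c c' P e.2 e'.2).
Qed.

Lemma cvg_vec (U : Type) (G : set_system U) {FG : Filter G} (f : U -> 'cV[R]_2) p :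
  (f x 0 0 @[x --> G] --> p 0 0) -> (f x 1 0 @[x --> G] --> p 1 0) ->
  f x @[x --> G] --> p.
Proof.
move=> h0 h1; apply/cvgrPdist_lt => e e0; near=> x.
rewrite [X in X < _]/Num.Def.normr/= mx_normrE (bigmax_lt _ e0)//= => -[i j] _.
rewrite !mxE [j]ord1 /=; have [->|->] := ord2P i; near: x.
  exact: (cvgrPdist_lt _ _).1 h0 _ e0.
exact: (cvgrPdist_lt _ _).1 h1 _ e0.
Unshelve. all: by end_near. Qed.

Lemma sflow_cvg (U : Type) (G : set_system U) {FG : Filter G} s (rho : U -> R)
    (pi_ : U -> 'cV[R]_2) (r : R) p :
  rho x @[x --> G] --> r -> pi_ x @[x --> G] --> p ->
  sflow s (rho x) (pi_ x) @[x --> G] --> sflow s r p.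
Proof.
move=> hr hp.
have hc i : pi_ x i 0 @[x --> G] --> p i 0.
  exact: (cvg_comp _ _ hp (@coord_continuous _ _ _ i 0 p)).
have hS : S s (rho x) @[x --> G] --> S s r.
  exact: (cvg_comp _ _ hr (is_derive_cont (fund_S (F s) r))).
have hC : C s (rho x) @[x --> G] --> C s r.
  exact: (cvg_comp _ _ hr (is_derive_cont (fund_C (F s) r))).
have hk (c : R) : (fun=> c) x @[x --> G] --> c by exact: cvg_cst.
have hw i : pi_ x i 0 - (ctr s) i 0 @[x --> G] --> p i 0 - (ctr s) i 0.
  exact: cvgB.
apply: cvg_vec.
  rewrite [X in _ --> X]vec2_0 (_ : (fun x => _) = (fun x => (ctr s) 0 0 +
      (C s (rho x) * (pi_ x 0 0 - (ctr s) 0 0) + S s (rho x) *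
       (sideA Z s 0 1 * (pi_ x 1 0 - (ctr s) 1 0) - sideA Z s 1 1 * (pi_ x 0 0 - (ctr s) 0 0))))); last first.
    by apply/funext => x; rewrite [LHS]vec2_0.
  by apply: cvgD => //; apply: cvgD; apply: cvgM => //; apply: cvgB; apply: cvgM.
rewrite [X in _ --> X]vec2_1 (_ : (fun x => _) = (fun x => (ctr s) 1 0 +
    (C s (rho x) * (pi_ x 1 0 - (ctr s) 1 0) + S s (rho x) *
     (sideA Z s 1 0 * (pi_ x 0 0 - (ctr s) 0 0) - sideA Z s 0 0 * (pi_ x 1 0 - (ctr s) 1 0))))); last first.
  by apply/funext => x; rewrite [LHS]vec2_1.
by apply: cvgD => //; apply: cvgD; apply: cvgM => //; apply: cvgB; apply: cvgM.
Qed.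

(** The durations vary with the parameter, so times are written [th * len x] with [th] in the fixed
    compact interval [[0, 1]]; a covering argument then gives one neighbourhood of [b]. *)
Lemma near_sflow (U : set 'cV[R]_2) s (len : R -> R) (pi_ : R -> 'cV[R]_2) (b : R) :
  open U -> {for b, continuous len} -> {for b, continuous pi_} -> 0 <= len b ->
  (forall r, 0 <= r <= len b -> U (sflow s r (pi_ b))) ->
  exists2 e, 0 < e & forall x, `|x - b| < e ->
    forall r, 0 <= r <= len x -> U (sflow s r (pi_ x)).
Proof.
move=> oU cl cp lb0 hU.
have /compact_near_coveringP nc := @segment_compact R 0 1.
have : \forall x \near b, `[0, 1]%classic `<=` (fun th => U (sflow s (th * len x) (pi_ x))).
  apply: (nc R (nbhs b) (fun x th => U (sflow s (th * len x) (pi_ x)))) => th /=.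
  rewrite in_itv /= => /andP[th0 th1].
  have : (fun z : R * R => sflow s (z.1 * len z.2) (pi_ z.2)) @ (nbhs (th, b))
      --> sflow s (th * len b) (pi_ b).
    apply: sflow_cvg.
      apply: cvgM; first exact: cvg_fst.
      by apply: (@cvg_comp _ _ _ snd len _ (nbhs b)); [exact: cvg_snd|exact: cl].
    by apply: (@cvg_comp _ _ _ snd pi_ _ (nbhs b)); [exact: cvg_snd|exact: cp].
  apply; apply: open_nbhs_nbhs; split=> //; apply: hU.
  by rewrite mulr_ge0//= ler_piMl.
move=> [e /= e0 he]; exists e => // x hx r /andP[r0 rl].
have := he x; rewrite /ball_ /= distrC => /(_ hx) k1.
have [l0|ln] := eqVneq (len x) 0.
  have -> : r = 0 * len x by move: rl; rewrite l0 mul0r => rl; apply/eqP; rewrite eq_le rl r0.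
  by apply: k1; rewrite /= in_itv /= lexx ler01.
have lp : 0 < len x by rewrite lt_def ln (le_trans r0).
rewrite -(divfK ln r); apply: k1.
by rewrite /= in_itv /= divr_ge0 ?(ltW lp)//= ler_pdivrMr// mul1r.
Qed.

(** Under these conditions each half of the return map only reverses the sign of the velocity, so
    every arc of [arc_family] closes up with a half-turn of Y. A nearby member of the family stays
    in the isolating neighbourhood. *)
Lemma arcX_family_not_isolated phi per t h tau : periodic_motion phi per ->
  (exists t, after_side false phi t) -> enters_Y phi t -> oscY h -> ratio h = 1 ->
  d != 0 -> trS false = 0 -> k = 0 ->
  arcX (k - ratio h * (vx (phi t) - k)) tau (vx (phi t)) ->
  (forall r, 0 <= r <= h -> phi (t + r) = sflow true r (phi t)) ->
  (forall r, 0 <= r <= tau -> phi (t + h + r) = sflow false r (sflow true h (phi t))) ->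
  ~ limit_cycle Z (range phi).
Proof.
move=> cy lv en ho c1 dn T0 k0 a aY aX [_ [U [oU gU iso]]].
rewrite c1 k0 subr0 mul1r sub0r in a.
have h0 := osc_h ho; have t0 := arc_tau a.
have Fx := F false; have Dx := D0 false; have Ox := osc false.
have an := entry_a01 cy lv en; have x0 := enters_Y_x en.
pose V := Vf (trS false) (detS false) (S false) (C false) d.
have Sn : S false tau != 0 by apply: (arc_S_neq0 Fx Dx Ox dn a a); rewrite lexx.
have [EV' _] := arc_VU a Sn.
have EV : - vx (phi t) = V tau := EV'.
have [e1 e10 fam] := arc_family Fx Dx Ox dn T0 a.
(* The point of Sigma at which the first component of X is [- V s], the final velocity of the arc of
   duration [s]. *)
pose p0 (s : R) : 'cV[R]_2 := vec2 0 (q 1 0 - V s / sideA Z false 0 1).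
pose p1 (s : R) := sflow true h (p0 s).
have vp0 (s : R) : vx (p0 s) = - V s.
  by rewrite vxE ?vec2_0// [X in X - _]vec2_1 k0; field.
have p0E : p0 tau = phi t.
  by apply: (vx_inj an) => //; rewrite ?vec2_0// vp0 -EV opprK.
have cV : {for tau, continuous V} by exact: is_derive_cont (deriv_Vf Fx Dx d Sn).
have cp0 : {for tau, continuous p0}.
  apply: cvg_vec.
    rewrite [X in _ --> X]vec2_0 (_ : (fun x => _) = (fun=> 0)); first exact: cvg_cst.
    by apply/funext => x; rewrite [LHS]vec2_0.
  rewrite [X in _ --> X]vec2_1 (_ : (fun x => _) = (fun x => q 1 0 - V x / sideA Z false 0 1)); last first.
    by apply/funext => x; rewrite [LHS]vec2_1.
  by apply: cvgB; [exact: cvg_cst|apply: cvgM; [exact: cV|exact: cvg_cst]].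
have cp1 : {for tau, continuous p1}.
  by apply: sflow_cvg; [exact: cvg_cst|exact: cp0].
have [e2 e20 hY] : exists2 e, 0 < e & forall x, `|x - tau| < e ->
    forall r, 0 <= r <= h -> U (sflow true r (p0 x)).
  apply: (@near_sflow U true (fun=> h) p0 tau) => //.
  - exact: cst_continuous.
  - exact: ltW.
  - by move=> r hr; rewrite p0E -aY//; apply: gU; exists (t + r).
have [e3 e30 hX] : exists2 e, 0 < e & forall x, `|x - tau| < e ->
    forall r, 0 <= r <= x -> U (sflow false r (p1 x)).
  apply: (@near_sflow U false id p1 tau) => //.
  - exact: ltW.
  - by move=> r hr; rewrite /p1 p0E -aX//; apply: gU; exists (t + h + r).
have [e4 [e40 e41 e42]] := min_lt_pair e10 e20.
have [e [e0 e1' e2']] := min_lt_pair e40 e30.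
pose s := tau + e / 2.
have hs : `|s - tau| < e by rewrite /s addrC addKr gtr0_norm; lra.
have s0 : 0 < s by rewrite /s; lra.
have [Ss as_] := fam s (ltac:(lra)).
have [vx0 vy0] := enters_vx_gt0 en.
(* As [k = 0], the first components of X and Y on Sigma are proportional; the positive factor, read
   off at the given entry, makes the new endpoints sewing points. *)
have slope : 0 < sideA Z true 0 1 / sideA Z false 0 1.
  have : vy (phi t) = sideA Z true 0 1 / sideA Z false 0 1 * vx (phi t).
    by rewrite (vyE x0) (vxE x0) k0 add0r; field.
  by move=> E; move: vy0; rewrite E pmulr_lgt0.
have vyp0 : 0 < vy (p0 s).
  have -> : vy (p0 s) = sideA Z true 0 1 / sideA Z false 0 1 * vx (p0 s).
    by rewrite vp0 vyE ?vec2_0// [X in X - _]vec2_1; field.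
  by rewrite mulr_gt0// vp0; exact: arc_w as_.
have Vs : V s < 0 := arc_v as_.
have p00 : p0 s 0 0 = 0 by rewrite vec2_0.
have [p10 vp1 vyp1] := half_turn ho p00.
rewrite c1 mul1r k0 subr0 sub0r vp0 opprK in vp1.
rewrite c1 mulN1r in vyp1.
have Eback : sflow false s (p1 s) = p0 s.
  apply: (vx_inj an) => //.
    by rewrite sflow_x// vp1; exact: arc_x as_.
  by rewrite sflow_x'// vp1 vp0; exact: arc_x' as_.
have [||||||||psi [Lp pp psY psX [pa _ prange]]] :=
    @closing R Z S C F D0 (p0 s) (p1 s) h s => //.
- move=> r /andP[r0 rh]; rewrite sflow_x// /force ctr_sigma mulr0 mul0r addr0 pmulr_rge0//.
  move: r0 rh; rewrite le_eqVlt => /orP[/eqP<- _|r0]; first by rewrite (fund_S0 (F true)).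
  rewrite le_eqVlt => /orP[/eqP->|rh]; first by rewrite (osc_Sh (F true) ho).
  by rewrite ltW// (osc_pos ho)// r0.
- by move=> r hr; rewrite sflow_x// vp1; exact: (arc_le as_).
- by apply/(sewingE Z true); split=> //=; rewrite mulr_gt0// vp0; exact: arc_w as_.
- apply/(sewingE Z true); split=> //=; rewrite vyp1 vp1 mulNr oppr_gt0 pmulr_rlt0//.
have psi0 : psi 0 = p0 s by rewrite psY ?lexx ?ltW// (sflow0 F).
have psih : psi h = p1 s by rewrite psY// lexx ltW.
have cps : periodic_motion psi (h + s).
  split=> //; first lra.
  exists h; rewrite psi0 psih => E; have := vyp1; rewrite -/(p1 s) E.
  by move=> E'; move: vyp0; lra.
have E : range psi = range phi.
  apply: iso; first exact: (motion_periodic_orbit F D0 cps).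
  rewrite prange => p [[r /= hr <-]|[r /= hr <-]].
    by apply: hY => //; lra.
  by apply: hX => //; lra.
have [u _ Eu] : range phi (p0 s) by rewrite -E; exists 0.
have enu : enters_Y phi u.
  have sw : sewing_region Z (phi u).
    by rewrite Eu; apply/(sewingE Z true); split=> //=; rewrite mulr_gt0// vp0; exact: arc_w as_.
  split=> //; have [s' hs'] := after_side_total (motion_flow cy) u.
  case: s' hs' => // hs'; have := sewing_after F D0 sw hs'.
  by rewrite mulN1r oppr_gt0 Eu vp0 oppr_lt0 ltNge ltW.
(* If both cycles coincided, the arcs of durations [tau] and [s] would start with the same velocity,
   against [arc_mono]. *)
have := entry_unique cy lv en enu; rewrite Eu vp0 -[vx _]opprK -[- vx _]/(- vx (phi t)) EV => /oppr_inj Vst.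
have st : tau < s by rewrite /s; lra.
case: (arc_mono Fx Dx Ox dn a as_ st) => -[]; rewrite EV -/V -/(V s) Vst ltxx//.
Qed.

(** Homotheties about a common centre on Sigma preserve Sigma, both half-planes and both flows. *)
Lemma homothety_at_sigma_not_isolated phi per : periodic_motion phi per ->
  ctr false = q -> ~ limit_cycle Z (range phi).
Proof.
move=> [L l0 lp ln] cq; have hc := flow_motion_cont F D0 L.
have eqs s : ctr s = q by case: s.
apply: (homothety_not_isolated (p := q) hc l0 lp ln) => m /andP[m0 m1].
have scE (c p : 'cV[R]_2) i : (c + m *: (p - c)) i 0 = c i 0 + m * (p i 0 - c i 0).
  by rewrite !mxE.
have x0 p : (q + m *: (p - q)) 0 0 = m * p 0 0.
  by rewrite scE ctr_sigma; ring.
have fm s p : sfield s (q + m *: (p - q)) 0 0 = m * sfield s p 0 0.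
  by rewrite !sfieldE0 eqs !scE ctr_sigma; ring.
have hf s r p : sflow s r (q + m *: (p - q)) = q + m *: (sflow s r p - q).
  by have := sflow_homothety Z S C s r m p; rewrite eqs.
apply: (flow_motion_trajectory F D0) => t; have [s1 [s2 [[a a0 h1] [b b0 h2] sw]]] := L t.
exists s1, s2; split.
- exists a => // r /h1 [k1 k2]; split; last by rewrite hf k2.
  by rewrite x0 mulrCA mulr_ge0// ltW.
- exists b => // r /h2 [k1 k2]; split; last by rewrite hf k2.
  by rewrite x0 mulrCA mulr_ge0// ltW.
- move=> /sw /(sewingE Z true)[y0 prod]; apply/(sewingE Z true).
  rewrite x0 y0 mulr0 !fm; split=> //; rewrite mulrACA mulr_gt0// mulr_gt0//.
Qed.

Lemma sort_index n (f : 'I_n -> R) : injective f -> exists2 p : 'I_n -> 'I_n,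
  injective p & forall i j : 'I_n, (i < j)%N -> f (p i) < f (p j).
Proof.
move=> finj; pose rl := [rel i j : 'I_n | f i <= f j].
pose sq := sort rl (enum 'I_n).
have szs : size sq = n by rewrite size_sort size_enum_ord.
have us : uniq sq by rewrite sort_uniq enum_uniq.
have ss : sorted rl sq by apply: sort_sorted => i j; exact: le_total.
have tr : transitive rl by move=> i j l; exact: le_trans.
have nthE (i j l : 'I_n) : nth i sq l = nth j sq l by apply: set_nth_default; rewrite szs.
exists (fun i => nth i sq i).
  move=> i j /eqP; rewrite (nthE j i) nth_uniq ?szs// => /eqP; exact: val_inj.
move=> i j ij; rewrite (nthE j i) lt_neqAle; apply/andP; split.
  apply/eqP => /finj /eqP; rewrite nth_uniq ?szs//; move: ij; rewrite ltn_neqAle => /andP[+ _].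
  by move=> /negP.
by have := sorted_ltn_nth tr i ss; apply; rewrite ?inE ?szs.
Qed.

(** Four cycles force a degenerate configuration: coinciding centres when [d = 0], or [T = 0], ratio
    1 and [k = 0] otherwise. Each produces neighbouring cycles, so that even one of the four cannot
    be isolated. *)
Lemma centred_at_most_three (g : 'I_4 -> set 'cV[R]_2) : injective g ->
  (forall i, limit_cycle Z (g i) /\ non_sliding Z (g i)) -> False.
Proof.
move=> ginj hg.
have data i : exists phi per t, [/\ periodic_motion phi per, g i = range phi,
    (exists t, after_side false phi t) & enters_Y phi t].
  have [lc ns] := hg i; have [po _] := lc.
  have [phi [per [cy E]]] := periodic_orbit_motion F D0 po ns.
  case: (motion_cases cy) => [[s h]|[lv [t en]]]; last by exists phi, per, t.
  by exfalso; rewrite E in lc; exact: (one_sided_not_limit F D0 cy h lc).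
have [phi_ [per_ [t_ [cy_ E_ lv_ en_]]]] := data ord0.
have [h ho] := entry_osc cy_ lv_ en_.
pose dat i (x : R * R) := exists phi per t, [/\ periodic_motion phi per, g i = range phi,
  (exists t, after_side false phi t), enters_Y phi t &
  [/\ x.1 = vx (phi t), arcX (k - ratio h * (x.1 - k)) x.2 x.1,
     (forall r, 0 <= r <= h -> phi (t + r) = sflow true r (phi t)) &
     (forall r, 0 <= r <= x.2 -> phi (t + h + r) = sflow false r (sflow true h (phi t)))]].
have dat_ex i : exists x, dat i x.
  have [phi [per [t [cy E lv en]]]] := data i.
  have [h' [tau [ho' a h1 h2]]] := entry_arc cy lv en.
  have Eh := osc_uniq (F true) ho ho'; subst h'.
  by exists (vx (phi t), tau), phi, per, t.
have [x hx] := choice dat_ex.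
have xinj i j : (x i).1 = (x j).1 -> i = j.
  move=> E; apply: ginj.
  have [phi [per [t [cy -> lv en [e1 _ _ _]]]]] := hx i.
  have [psi [per' [u [cy' -> _ en' [e2 _ _ _]]]]] := hx j.
  by apply: (same_entry cy cy' lv en en'); rewrite -e1 -e2.
have ha i : arcX (k - ratio h * ((x i).1 - k)) (x i).2 (x i).1.
  by have [? [? [? [_ _ _ _ []]]]] := hx i.
have c0 : 0 < ratio h by exact: expR_gt0.
have an := entry_a01 cy_ lv_ en_.
have Fx := F false; have Dx := D0 false; have Ox := osc false.
have [phi [per [t [cy E lv en [e1 a aY aX]]]]] := hx ord0.
have [lc _] := hg ord0; rewrite E in lc.
(* When [d = 0] the centre of X lies on Sigma as well, and [k = 0] then says that it is the centre
   of Y. *)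
have [dz|dn] := eqVneq d 0.
  have k0 : k = 0.
    have a0 := ha ord0; have a1 := ha ord_max; rewrite dz in a0 a1.
    apply: (two_arcs_d0 Fx Dx Ox a0 a1 (c := ratio h)) => //; [lra|lra|].
    rewrite (inj_eq (addrI _)) eqr_opp (inj_eq (mulfI (lt0r_neq0 c0))) (inj_eq (addIr _)).
    by apply/eqP => /xinj.
  have c00 : (ctr false) 0 0 = 0.
    by move/eqP: dz; rewrite /force mulf_eq0 (negbTE Dx) => /eqP.
  apply: (homothety_at_sigma_not_isolated cy _ lc).
  have := k0; rewrite sfieldE0 c00 ctr_sigma subrr mulr0 add0r => /eqP.
  rewrite mulf_eq0 (negbTE an)/= subr_eq0 => /eqP E1.
  by apply: vec2P; [rewrite c00 ctr_sigma|rewrite E1].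
(* The duration of the X-arc determines its final velocity through [Uf], hence the cycle. *)
have tinj : injective (fun i => (x i).2).
  move=> i j; case: (ltngtP i j) => [_|_|/val_inj//] Et; apply: xinj.
    have Sn : S false (x i).2 != 0 by apply: (arc_S_neq0 Fx Dx Ox dn (ha i) (ha i)); rewrite lexx.
    have [_ ->] := arc_VU (ha i) Sn; rewrite Et in Sn *.
    by have [_ <-] := arc_VU (ha j) Sn.
  have Sn : S false (x i).2 != 0 by apply: (arc_S_neq0 Fx Dx Ox dn (ha i) (ha i)); rewrite lexx.
  have [_ ->] := arc_VU (ha i) Sn; rewrite Et in Sn *.
  by have [_ <-] := arc_VU (ha j) Sn.
have [p _ hp] := sort_index tinj.
have [T0 c1 k0] := four_arcs Fx Dx Ox dn c0 (fun i => ha (p i))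
  (fun i => (ltac:(lra) : (k - ratio h * ((x (p i)).1 - k)) - k = - ratio h * ((x (p i)).1 - k))) hp.
rewrite e1 in a.
exact: (arcX_family_not_isolated cy lv en ho c1 dn T0 k0 a aY aX lc).
Qed.
End CentredOnSigma.

(** * Reflection in Sigma and the upper bound *)

Section Reflection.
Context {R : realType}.
Implicit Types (p : 'cV[R]_2) (phi : R -> 'cV[R]_2) (Z : pwl_system R).

Definition refl_mx : 'M[R]_2 :=
  \matrix_(i, j) if i == j then (if i == 0 then -1 else 1) else 0.
Local Notation J := refl_mx.

Definition reflect_sys Z := PwlSystem (J *m Aplus Z *m J) (J *m bplus Z)
  (J *m Aminus Z *m J) (J *m bminus Z).

Definition swap_mode m :=
  match m with ModeX => ModeY | ModeY => ModeX | ModeSliding => ModeSliding end.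

Lemma refl0 p : (J *m p) 0 0 = - p 0 0.
Proof. by rewrite mulA0 !mxE /= mulN1r mul0r addr0. Qed.

Lemma refl1 p : (J *m p) 1 0 = p 1 0.
Proof. by rewrite mulA1 !mxE /= mul1r mul0r add0r. Qed.

Lemma reflK p : J *m (J *m p) = p.
Proof. by apply: vec2P; rewrite ?refl0 ?refl1 ?refl0 ?refl1 ?opprK. Qed.

Lemma refl_sq : J *m J = 1%:M.
Proof.
apply/matrixP => i j; rewrite !mxE !big_ord_recl big_ord0 addr0 lift0_0 !mxE.
by have [->|->] := ord2P i; have [->|->] := ord2P j;
  rewrite /= ?mulr0 ?mul0r ?addr0 ?add0r ?mulrNN ?mulr1.
Qed.

Lemma reflect_sysK Z : reflect_sys (reflect_sys Z) = Z.
Proof.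
case: Z => A b A' b'; rewrite /reflect_sys /=.
by congr PwlSystem; rewrite !mulmxA refl_sq mul1mx// -mulmxA refl_sq mulmx1.
Qed.

Lemma reflect_fieldX Z p : fieldX (reflect_sys Z) (J *m p) = J *m fieldY Z p.
Proof. by rewrite /fieldX /fieldY /= mulmxDr -!mulmxA reflK. Qed.

Lemma reflect_fieldY Z p : fieldY (reflect_sys Z) (J *m p) = J *m fieldX Z p.
Proof. by rewrite /fieldX /fieldY /= mulmxDr -!mulmxA reflK. Qed.

Lemma reflect_sliding Z p : (sliding_region Z `|` escaping_region Z) p ->
  (sliding_region (reflect_sys Z) `|` escaping_region (reflect_sys Z)) (J *m p).
Proof.
case=> -[s h1 h2]; [left|right]; split; rewrite /Sigma /= /xcoord
  ?reflect_fieldX ?reflect_fieldY !refl0 ?oppr_gt0 ?oppr_lt0//;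
  by move: s; rewrite /Sigma /= /xcoord => ->; rewrite oppr0.
Qed.

Lemma reflect_sewing Z p : sewing_region Z p ->
  sewing_region (reflect_sys Z) (J *m p).
Proof.
move=> [s h]; split; rewrite /Sigma /= /xcoord ?reflect_fieldX ?reflect_fieldY !refl0.
  by move: s; rewrite /Sigma /= /xcoord => ->; rewrite oppr0.
by rewrite mulrNN mulrC.
Qed.

Lemma reflect_mode_field Z m p :
  mode_field (reflect_sys Z) (swap_mode m) (J *m p) = J *m mode_field Z m p.
Proof.
case: m => /=; rewrite ?reflect_fieldX ?reflect_fieldY//.
rewrite /sliding_field reflect_fieldX reflect_fieldY -scalemxAr mulmxBr -!scalemxAr.
rewrite /xcoord !refl0 opprK addrC !scaleNr opprK [_ + _ *: (J *m fieldX Z p)]addrC.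
by [].
Qed.

Lemma reflect_follows Z m phi (a b : R) : follows Z m phi a b ->
  follows (reflect_sys Z) (swap_mode m) (fun t => J *m phi t) a b.
Proof.
move=> h u /h [h1 h2]; split.
  move: h1; case: m {h h2} => /=; rewrite /Sminus /Splus /= /xcoord ?refl0.
  - by rewrite oppr_ge0.
  - by rewrite oppr_le0.
  - exact: reflect_sliding.
rewrite reflect_mode_field; move/vec_deriv: h2 => [h2 h3]; apply/vec_deriv.
rewrite refl0 refl1; split.
  have -> : (fun s => (J *m phi s) 0 0) = (fun s => - phi s 0 0).
    by apply/funext => s; rewrite refl0.
  exact: deriv1N.
have -> : (fun s => (J *m phi s) 1 0) = (fun s => phi s 1 0).
  by apply/funext => s; rewrite refl1.
exact: h3.
Qed.

Lemma refl_continuous : continuous (fun p => J *m p).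
Proof.
move=> p; apply: (@cvg_vec R _ (nbhs p) _ (fun p => J *m p) (J *m p)).
  have -> : (fun s : 'cV[R]_2 => (J *m s) 0 0) = (fun s => - s 0 0).
    by apply/funext => s; rewrite refl0.
  by rewrite refl0; apply: cvgN; exact: coord_continuous.
have -> : (fun s : 'cV[R]_2 => (J *m s) 1 0) = (fun s => s 1 0).
  by apply/funext => s; rewrite refl1.
by rewrite refl1; exact: coord_continuous.
Qed.

Lemma reflect_trajectory Z phi : trajectory Z phi ->
  trajectory (reflect_sys Z) (fun t => J *m phi t).
Proof.
move=> [hc ht]; split.
  by move=> t; apply: continuous_comp; [exact: hc|exact: refl_continuous].
move=> t; have [e [m1 [m2 [e0 f1 f2 sw]]]] := ht t.
exists e, (swap_mode m1), (swap_mode m2); split=> //; try exact: reflect_follows.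
by move: sw; case: m1 {f1} => //; case: m2 {f2} => //= /reflect_sewing.
Qed.

Lemma reflect_periodic Z g : periodic_orbit Z g ->
  periodic_orbit (reflect_sys Z) [set J *m p | p in g].
Proof.
move=> [phi [T [tr T0 pp [t nc] ->]]]; exists (fun t => J *m phi t), T; split=> //.
- exact: reflect_trajectory.
- by move=> u; rewrite pp.
- by exists t => /(congr1 (mulmx J)); rewrite !reflK.
by apply/seteqP; split=> [p [_ [u _ <-] <-]|p [u _ <-]]; [exists u|exists (phi u) => //; exists u].
Qed.

Lemma refl_imageK (g : set 'cV[R]_2) : [set J *m p | p in [set J *m p | p in g]] = g.
Proof.
apply/seteqP; split=> [p [_ [u gu <-] <-]|p gp]; first by rewrite reflK.
by exists (J *m p); [exists p|rewrite reflK].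
Qed.

Lemma reflect_limit_cycle Z g : limit_cycle Z g ->
  limit_cycle (reflect_sys Z) [set J *m p | p in g].
Proof.
move=> [po [U [oU gU iso]]]; split; first exact: reflect_periodic.
exists ((fun p => J *m p) @^-1` U); split.
- by apply: open_comp => // p _; exact: refl_continuous.
- by move=> _ [p gp <-]; rewrite /= reflK; exact: gU.
move=> g' /reflect_periodic; rewrite reflect_sysK => po' g'U.
rewrite -(iso _ po') ?refl_imageK//.
by move=> _ [p /g'U + <-].
Qed.

Lemma reflect_non_sliding Z g : non_sliding Z g ->
  non_sliding (reflect_sys Z) [set J *m p | p in g].
Proof.
move=> ns; apply/seteqP; split=> // _ [[p gp <-]] h.
have : (g `&` (escaping_region Z `|` sliding_region Z)) p; last by rewrite ns.
split=> //; rewrite setUC -[p]reflK -[Z]reflect_sysK.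
by apply: reflect_sliding; rewrite setUC.
Qed.

Lemma tr2_reflect (A : 'M[R]_2) : tr2 (J *m A *m J) = tr2 A.
Proof.
by rewrite /tr2 !mxE !big_ord_recl !big_ord0 !lift0_0 !mxE !big_ord_recl !big_ord0 !lift0_0 !mxE /=; ring.
Qed.

Lemma det2_reflect (A : 'M[R]_2) : det2 (J *m A *m J) = det2 A.
Proof.
by rewrite /det2 !mxE !big_ord_recl !big_ord0 !lift0_0 !mxE !big_ord_recl !big_ord0 !lift0_0 !mxE /=; ring.
Qed.

End Reflection.

(** * Cardinality of the set of cycles and existence of the maximum *)

Section UpperBound.
Context {R : realType}.

Lemma centred_bound (Z : pwl_system R) (f : 'I_4 -> set 'cV[R]_2) :
  discontinuous Z ->
  (forall s, det2 (sideA Z s) != 0 /\ exists S C,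
     fundamental (tr2 (sideA Z s)) (det2 (sideA Z s)) S C /\
   ((forall t, 0 < t -> 0 < S t) \/
    exists h, oscillates (tr2 (sideA Z s)) (det2 (sideA Z s)) S C h)) ->
  (exists2 p, Sigma p & fieldY Z p = 0) -> injective f ->
  (forall i, limit_cycle Z (f i) /\ non_sliding Z (f i)) -> False.
Proof.
move=> disc h [p sp hp] finj hf.
have h1 s : exists x : (R -> R) * (R -> R), fundamental (tr2 (sideA Z s)) (det2 (sideA Z s)) x.1 x.2 /\
   ((forall t, 0 < t -> 0 < x.1 t) \/
    exists h, oscillates (tr2 (sideA Z s)) (det2 (sideA Z s)) x.1 x.2 h).
  by have [_ [S [C k]]] := h s; exists (S, C).
have [x hx] := choice h1.
have D0 s : det2 (sideA Z s) != 0 by case: (h s).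
have c0 : (equil (sideA Z true) (sideb Z true)) 0 0 = 0.
  by rewrite -(aff_eq0 (D0 true) hp).
exact: (@centred_at_most_three R Z (fun s => (x s).1) (fun s => (x s).2)
  (fun s => (hx s).1) D0 (fun s => (hx s).2) disc c0 f finj hf).
Qed.

Lemma at_most_three (Z : pwl_system R) (f : 'I_4 -> set 'cV[R]_2) :
  class_C Z -> injective f ->
  (forall i, limit_cycle Z (f i) /\ non_sliding Z (f i)) -> False.
Proof.
move=> [disc fm fp [p sp [hp|hp]]] finj hf; last first.
  apply: (centred_bound disc _ _ finj hf); last by exists p.
  by case; [exact: fundamental_exists fp|exact: fundamental_exists fm].
apply: (@centred_bound (reflect_sys Z) (fun i => [set refl_mx *m p | p in f i])).
- have [u su nu] := disc; exists (refl_mx *m u).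
    by move: su; rewrite /Sigma /= /xcoord refl0 => ->; rewrite oppr0.
  rewrite reflect_fieldX reflect_fieldY => /(congr1 (mulmx refl_mx)).
  by rewrite !reflK => /esym.
- by case=> /=; rewrite tr2_reflect det2_reflect; [exact: fundamental_exists fm|exact: fundamental_exists fp].
- exists (refl_mx *m p); last by rewrite reflect_fieldY hp mulmx0.
  by move: sp; rewrite /Sigma /= /xcoord refl0 => ->; rewrite oppr0.
- by move=> i j /(congr1 (fun g : set 'cV[R]_2 => [set refl_mx *m p | p in g])); rewrite !refl_imageK => /finj.
- by move=> i; have [lc ns] := hf i; split; [exact: reflect_limit_cycle|exact: reflect_non_sliding].
Qed.

(** An infinite set would contain [M.+1] elements, so every set has a finite cardinality at most
    [M]. The attained cardinalities are natural numbers bounded by [M], and the largest of them is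
    [N]. *)
Lemma max_of_bounds (T : Type) (P : pwl_system R -> Prop)
    (A : pwl_system R -> set T) (m M : nat) :
  (forall Z, P Z -> ~ (`I_M.+1 #<= A Z)) ->
  (exists2 Z, P Z & `I_m #<= A Z) ->
  exists N, ((forall Z, P Z -> A Z #<= `I_N) /\ (exists2 Z, P Z & A Z #= `I_N)) /\
    (m <= N <= M)%N.
Proof.
move=> ub [Z0 PZ0 lb].
have fin Z : P Z -> exists2 n, (n <= M)%N & A Z #= `I_n.
  move=> PZ; have fA : finite_set (A Z).
    apply/finite_setPn => inf; apply: (ub Z PZ).
    by apply: card_le_trans inf; apply: subset_card_le.
  have [n hn] := (finite_setP _).1 fA; exists n => //.
  rewrite leqNgt; apply/negP => Mn; apply: (ub Z PZ).
  by rewrite (card_le_eqr hn) card_le_II.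
pose Q n := `[< exists2 Z, P Z & A Z #= `I_n >].
have [n0 n0M hn0] := fin Z0 PZ0.
have exQ : exists n, Q n by exists n0; apply/asboolP; exists Z0.
have bQ n : Q n -> (n <= M)%N.
  move=> /asboolP[Z PZ hn]; have [n' n'M hn'] := fin Z PZ.
  suff -> : n = n' by [].
  by apply/card_eq_II; rewrite -(card_eql hn).
exists (ex_maxn exQ bQ); case: ex_maxnP => N QN maxN.
have mN : (m <= N)%N.
  apply: leq_trans (maxN n0 _); last by apply/asboolP; exists Z0.
  by rewrite -card_le_II -(card_le_eqr hn0).
split; last by rewrite mN bQ.
split; last exact/asboolP.
move=> Z PZ; have [n nM hn] := fin Z PZ.
by rewrite (card_le_eql hn) card_le_II maxN//; apply/asboolP; exists Z.
Qed.

Lemma counted_le_three (Z : pwl_system R) : class_C Z ->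
  ~ (`I_4 #<= counted_limit_cycles Z).
Proof.
move=> cZ /pcard_leP[f].
apply: (@at_most_three Z (fun i => f (val i)) cZ).
- move=> i j E; apply: val_inj.
  by apply: (@inj _ _ _ f) => //; rewrite inE /=; apply: ltn_ord.
- move=> i; have : counted_limit_cycles Z (f (val i)).
    by apply: (@funS _ _ _ _ f); exact: ltn_ord.
  by case.
Qed.

End UpperBound.

(** * A system with two limit cycles *)

Section Spiral.
Context {R : realType}.
Variable beta : R.
Hypothesis beta0 : 0 <= beta.

Definition rad (x u : R) := Num.sqrt (x ^+ 2 + u ^+ 2).

(* The angle from the positive [u]-axis, which lies in [[0, pi]] in the
   half-plane [0 <= x]; it is written with the half-angle formula because
   [u / (rad x u + x)] is continuous there, except at the origin. *)
Definition ang (x u : R) := pi / 2 - 2 * atan (u / (rad x u + x)).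

(** A first integral of the focus [x' = - beta x + u], [u' = - x - beta u] in [0 <= x] away from the
    origin: along its orbits the angle grows at unit speed while the radius decays at rate
    [beta]. *)
Definition spiral (x u : R) := rad x u * expR (beta * ang x u).

Lemma rad_ge0 x u : 0 <= rad x u. Proof. exact: sqrtr_ge0. Qed.

Lemma rad_sq x u : rad x u ^+ 2 = x ^+ 2 + u ^+ 2.
Proof. by rewrite sqr_sqrtr// addr_ge0// sqr_ge0. Qed.

Lemma rad_gex x u : `|x| <= rad x u.
Proof. by rewrite -sqrtr_sqr ler_wsqrtr// lerDl sqr_ge0. Qed.

Lemma rad_geu x u : `|u| <= rad x u.
Proof. by rewrite -sqrtr_sqr ler_wsqrtr// lerDr sqr_ge0. Qed.

Lemma rad0u u : rad 0 u = `|u|.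
Proof. by rewrite /rad expr0n add0r sqrtr_sqr. Qed.

Lemma spiral0 u : spiral 0 u = if 0 <= u then u else - u * expR (beta * pi).
Proof.
rewrite /spiral /ang rad0u addr0; have [u0|u0] := leP 0 u.
  have [->|un] := eqVneq u 0; first by rewrite normr0 mul0r.
  rewrite ger0_norm// divff// atan1 (_ : _ - _ = 0) ?mulr0 ?expR0 ?mulr1//.
  by field.
rewrite ltr0_norm// invrN mulrN divff ?lt_eqF// atanN atan1.
by congr (_ * expR (_ * _)); field.
Qed.

Section Polar.
Variables x u : R.
Hypotheses (x0 : 0 <= x) (r0 : 0 < rad x u).

(** The tangent of half the angle measured from the positive [x]-axis. *)
Let w := u / (rad x u + x).

Lemma atan_sq : cos (atan w) ^+ 2 = (1 + w ^+ 2)^-1.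
Proof. by rewrite cos_atan exprVn sqr_sqrtr// addr_ge0// sqr_ge0. Qed.

Lemma sin_atan_cos : sin (atan w) = w * cos (atan w).
Proof.
have cn : cos (atan w) != 0.
  by rewrite cos_atan invr_eq0 gt_eqF// sqrtr_gt0 ltr_wpDr ?sqr_ge0.
by rewrite -[X in X * _](atanK w) /tan divfK.
Qed.

Lemma rx0 : rad x u + x != 0. Proof. by rewrite gt_eqF// ltr_wpDr. Qed.

Lemma one_w2 : 1 + w ^+ 2 = 2 * rad x u / (rad x u + x).
Proof.
have E := rad_sq x u; have n := rx0.
have -> : 1 + w ^+ 2 = (rad x u ^+ 2 + 2 * rad x u * x + (x ^+ 2 + u ^+ 2)) / (rad x u + x) ^+ 2.
  by rewrite /w; field.
by rewrite -E; field.
Qed.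

Lemma polar_x : x = rad x u * sin (ang x u).
Proof.
have rn : rad x u != 0 by rewrite gt_eqF.
rewrite /ang sinB sin_pihalf cos_pihalf mul1r mul0r subr0 -/w.
rewrite mulr_natl cos_mulr2n atan_sq one_w2.
by rewrite mulr2n; field; rewrite rn rx0.
Qed.

Lemma polar_u : u = rad x u * cos (ang x u).
Proof.
have rn : rad x u != 0 by rewrite gt_eqF.
rewrite /ang cosB sin_pihalf cos_pihalf mul1r mul0r add0r -/w.
rewrite mulr_natl sin_mulr2n sin_atan_cos mulrCA -expr2 atan_sq one_w2.
rewrite mulr2n /w; field; by rewrite rn rx0.
Qed.

Lemma ang_itv : 0 <= ang x u <= pi.
Proof.
have w1 : `|w| <= 1.
  rewrite normrM normfV ler_pdivrMr ?normr_gt0 ?rx0// mul1r.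
  rewrite (ger0_norm (addr_ge0 (ltW r0) x0)) (le_trans (rad_geu x u))//.
  by rewrite lerDl.
move: w1; rewrite ler_norml => /andP[/(@le_atan R) k1 /(@le_atan R) k2].
by move: k1 k2; rewrite atanN atan1 /ang -/w => k1 k2; apply/andP; split; lra.
Qed.

Lemma spiral_ge_rad : rad x u <= spiral x u.
Proof.
have /andP[a0 _] := ang_itv.
rewrite /spiral -[X in X <= _]mulr1 ler_wpM2l ?rad_ge0//.
by rewrite -expR0 ler_expR mulr_ge0.
Qed.

End Polar.

(** Away from the origin all ingredients are continuous. At the origin [ang] need not converge, but
    it is bounded, since [atan] exceeds [- pi / 2], and the radius tends to 0. *)
Lemma spiral_cvg (T : Type) (G : set_system T) {FG : Filter G} (f g : T -> R) (x u : R) :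
  (\forall t \near G, 0 <= f t) -> 0 <= x ->
  f t @[t --> G] --> x -> g t @[t --> G] --> u ->
  spiral (f t) (g t) @[t --> G] --> spiral x u.
Proof.
move=> f0 x0 hf hg.
have hrad : rad (f t) (g t) @[t --> G] --> rad x u.
  apply: (@cvg_comp _ _ _ (fun t => f t ^+ 2 + g t ^+ 2) Num.sqrt _ (nbhs (x ^+ 2 + u ^+ 2))).
    by apply: cvgD; rewrite [X in _ --> X]expr2; apply: cvgM.
  exact: sqrt_continuous.
have [r0|rn] := eqVneq (rad x u) 0.
  rewrite {2}/spiral r0 mul0r.
  apply: (@squeeze_cvgr _ _ _ _ (fun=> 0) (fun t => rad (f t) (g t) * expR (beta * (pi / 2 + pi)))).
  - near=> t; apply/andP; split; first by rewrite mulr_ge0 ?rad_ge0 ?expR_ge0.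
    rewrite /spiral ler_wpM2l ?rad_ge0// ler_expR ler_wpM2l//.
    rewrite /ang; have := atan_gtNpi2 (g t / (rad (f t) (g t) + f t)); lra.
  - exact: cvg_cst.
  - rewrite -[X in _ --> X](mul0r (expR (beta * (pi / 2 + pi)))) -r0.
    by apply: cvgM => //; exact: cvg_cst.
have rp : 0 < rad x u by rewrite lt_def rn rad_ge0.
apply: cvgM => //.
apply: (@cvg_comp _ _ _ (fun t => beta * ang (f t) (g t)) expR _ (nbhs (beta * ang x u))); last exact: continuous_expR.
apply: cvgM; first exact: cvg_cst.
apply: cvgB; first exact: cvg_cst.
apply: cvgM; first exact: cvg_cst.
apply: (@cvg_comp _ _ _ (fun t => g t / (rad (f t) (g t) + f t)) atan _ (nbhs (u / (rad x u + x)))); last exact: continuous_atan.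
apply: cvgM => //; apply: cvgV; last exact: cvgD.
by rewrite gt_eqF// ltr_wpDr.
Unshelve. all: by end_near. Qed.

End Spiral.

(** * The node-focus system, its cycles and their isolation *)

Section Example.
Context {R : realType}.
Notation deriv1 f x d := (is_derive (x : R) (1 : R) f d).
Implicit Types (p : 'cV[R]_2) (phi psi : R -> 'cV[R]_2).

Definition mx22 (a b c d : R) : 'M[R]_2 := \matrix_(i, j)
  if i == 0 then (if j == 0 then a else b) else (if j == 0 then c else d).

Lemma mx22E a b c d : (mx22 a b c d 0 0 = a) * (mx22 a b c d 0 1 = b) *
  (mx22 a b c d 1 0 = c) * (mx22 a b c d 1 1 = d).
Proof. by rewrite !mxE. Qed.

(** Chosen so that [expR (- beta * pi) = 1 / 8]. *)
Definition beta : R := ln 8 / pi.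

(* [X] is a node with eigenvalues 1 and 2 centred at [(1, 0)], whose orbits are
   parabolas; [Y] is a focus centred at [(0, -1/3)], whose half-turn about its
   centre has ratio [1/8].  With [z = expR t] the equation for a closed orbit
   spending time [t] in [x <= 0] is [z ^ 2 - 6 z + 8 = 0]. *)
Definition two_cycles : pwl_system R :=
  PwlSystem (mx22 0 1 (-2) 3) (vec2 0 2)
    (mx22 (- beta) 1 (-1) (- beta)) (vec2 (1 / 3) (- beta / 3)).

Local Notation Z0 := two_cycles.

Definition two_cycles_S (s : bool) := if s then focus_S (- beta) 1 else node_S 2 1.
Definition two_cycles_C (s : bool) := if s then focus_C (- beta) 1 else node_C 2 1.

Local Notation sflow := (sflow Z0 two_cycles_S two_cycles_C).
Local Notation sfield := (sfield Z0).
Local Notation after_side := (after_side Z0 two_cycles_S two_cycles_C).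
Local Notation periodic_motion := (periodic_motion Z0 two_cycles_S two_cycles_C).
Local Notation enters_Y := (enters_Y Z0 two_cycles_S two_cycles_C).
Local Notation trS s := (tr2 (sideA Z0 s)).
Local Notation detS s := (det2 (sideA Z0 s)).

Lemma trS_true : trS true = (- beta) *+ 2.
Proof. by rewrite /tr2 /= !mx22E mulr2n. Qed.

Lemma detS_true : detS true = (- beta) ^+ 2 + 1 ^+ 2.
Proof. by rewrite /det2 /= !mx22E; ring. Qed.

Lemma trS_false : trS false = 2 + 1.
Proof. by rewrite /tr2 /= !mx22E; ring. Qed.

Lemma detS_false : detS false = 2 * 1.
Proof. by rewrite /det2 /= !mx22E; ring. Qed.

Lemma detS_true_gt0 : 0 < detS true.
Proof. by rewrite detS_true ltr_wpDl ?sqr_ge0// expr1n. Qed.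

Lemma two_cycles_fundamental s : fundamental (trS s) (detS s) (two_cycles_S s) (two_cycles_C s).
Proof.
case: s.
  by rewrite trS_true detS_true; apply: fundamental_focus; rewrite oner_eq0.
rewrite trS_false detS_false; apply: fundamental_node.
by apply/eqP; lra.
Qed.

Lemma two_cycles_det s : detS s != 0.
Proof.
case: s; first by rewrite gt_eqF ?detS_true_gt0.
by rewrite detS_false gt_eqF//; lra.
Qed.

Lemma two_cycles_focus : oscillates (trS true) (detS true) (two_cycles_S true) (two_cycles_C true) pi.
Proof.
rewrite trS_true detS_true -[pi]divr1; exact: oscillates_focus.
Qed.

Lemma two_cycles_osc s : (forall t, 0 < t -> 0 < two_cycles_S s t) \/
  exists h, oscillates (trS s) (detS s) (two_cycles_S s) (two_cycles_C s) h.
Proof.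
case: s; first by right; exists pi; exact: two_cycles_focus.
have d1 : (0 : R) < 2 - 1 by lra.
left=> t t0; rewrite /two_cycles_S /node_S pmulr_lgt0 ?invr_gt0//.
by rewrite subr_gt0 ltr_expR; lra.
Qed.

Lemma ctr_true : equil (sideA Z0 true) (sideb Z0 true) = vec2 0 (- (1 / 3)).
Proof.
have d0 := two_cycles_det true; rewrite /equil; congr vec2.
  by rewrite /= !mx22E vec2_0 vec2_1; rewrite (_ : _ - _ = 0) ?mul0r//; field.
apply: (mulIf d0); rewrite divfK// detS_true /= !mx22E vec2_0 vec2_1; lra.
Qed.

Lemma ctr_false : equil (sideA Z0 false) (sideb Z0 false) = vec2 1 0.
Proof.
have d0 := two_cycles_det false; rewrite /equil; congr vec2;
apply: (mulIf d0); rewrite divfK// detS_false /= !mx22E vec2_0 vec2_1; ring.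
Qed.

Lemma two_cycles_ctr : (equil (sideA Z0 true) (sideb Z0 true)) 0 0 = 0.
Proof. by rewrite ctr_true vec2_0. Qed.

Lemma two_cycles_vx p : sfield false p 0 0 = p 1 0.
Proof. by rewrite /sfield aff0 /= !mx22E vec2_0; ring. Qed.

Lemma two_cycles_vy p : sfield true p 0 0 = - beta * p 0 0 + (p 1 0 + 1 / 3).
Proof. by rewrite /sfield aff0 /= !mx22E vec2_0; ring. Qed.

Lemma two_cycles_discontinuous : discontinuous Z0.
Proof.
exists (vec2 0 0); first by rewrite /Sigma /= /xcoord vec2_0.
move=> /(congr1 (fun v : 'cV[R]_2 => v 0 0)).
rewrite -[fieldX _ _]/(sfield false (vec2 0 0)) -[fieldY _ _]/(sfield true (vec2 0 0)).
by rewrite two_cycles_vx two_cycles_vy !vec2_0 !vec2_1 => E; move: E; lra.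
Qed.

Lemma two_cycles_class : class_C Z0.
Proof.
split; first exact: two_cycles_discontinuous.
- right; left; exists 2, 1; split; first by lra.
  rewrite char_poly2 !mx22E (_ : 3 = 2 + 1 :> R); last by lra.
  by rewrite mul1r !polyCN polyC0 polyCD polyC1; ring.
- left; exists (- beta), 1; split; first by rewrite oner_eq0.
  rewrite eigenvalue_root_char rootE char_poly22 !mxE /=; apply/eqP.
  by apply/eqP; rewrite eq_complex /=; apply/andP; split; apply/eqP; ring.
exists (vec2 0 (- (1 / 3))); first by rewrite /Sigma /= /xcoord vec2_0.
right; rewrite -ctr_true; exact: aff_equil (two_cycles_det true).
Qed.

(** On Sigma the first component of X is [y]; these are therefore the end and the beginning of the
    X-arc of duration [ln z], with [w = z - 1] and [v = 1/z - 1]. *)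
Definition start (z : R) : 'cV[R]_2 := vec2 0 (z - 1).
Definition middle (z : R) : 'cV[R]_2 := vec2 0 (z^-1 - 1).

Lemma expR_beta : expR (- beta * pi) = 1 / 8.
Proof.
by rewrite mulNr /beta divfK ?gt_eqF ?pi_gt0// expRN lnK ?posrE ?div1r//; lra.
Qed.

Lemma beta_gt0 : 0 < beta.
Proof. by rewrite divr_gt0 ?pi_gt0// ln_gt0//; lra. Qed.

Lemma sflow_right r z : sflow true r (start z) =
  vec2 (expR (- beta * r) * sin r * (z - 2 / 3))
     (- (1 / 3) + expR (- beta * r) * cos r * (z - 2 / 3)).
Proof.
rewrite /sflow /flow ctr_true !vec2_0 !vec2_1 /= !mx22E /focus_S /focus_C !mul1r invr1.
by congr vec2; field.
Qed.

Lemma sflow_left r z : z != 0 -> sflow false r (middle z) =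
  vec2 ((expR r - 1) * (expR r / z - 1))
     (expR r * (2 * expR r / z - z^-1 - 1)).
Proof.
move=> z0; rewrite /sflow /flow ctr_false !vec2_0 !vec2_1 /= !mx22E /node_S /node_C !mul1r.
have -> : expR (2 * r) = expR r * expR r by rewrite -expRD; congr expR; ring.
have -> : (2 - 1 : R) = 1 by lra.
by rewrite invr1; congr vec2; field.
Qed.

(** * The closed curve through [start z] and its interior *)

Section OneParameter.
Variable z : R.
Hypothesis z1 : 1 < z.
(* The closing condition for the cycle through [start z]. *)
Hypothesis hz : z^-1 - 1 + 1 / 3 = - (1 / 8) * (z - 2 / 3).

Let z0 : 0 < z. Proof. by move: z1; lra. Qed.
Let zn : z != 0. Proof. by rewrite gt_eqF. Qed.
Let zi : z^-1 < 1. Proof. by rewrite invf_lt1. Qed.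
Let lnz : expR (ln z) = z. Proof. by rewrite lnK. Qed.

Definition cycle_set : set 'cV[R]_2 :=
  [set sflow true r (start z) | r in [set r | 0 <= r <= pi]] `|`
  [set sflow false r (middle z) | r in [set r | 0 <= r <= ln z]].

Lemma expR_itv r : 0 <= r <= ln z -> 1 <= expR r <= z.
Proof. by move=> /andP[r0 r1]; apply/andP; split;
  [rewrite -(@expR0 R) ler_expR|rewrite -[X in _ <= X]lnz ler_expR]. Qed.

Lemma sflow_right_half : sflow true pi (start z) = middle z.
Proof.
rewrite sflow_right expR_beta sinpi cospi /middle; congr vec2; first by ring.
by move: hz; lra.
Qed.

Lemma sflow_left_back : sflow false (ln z) (middle z) = start z.
Proof. by rewrite sflow_left// lnz /start; congr vec2; field. Qed.

Lemma sewing_start : sewing_region Z0 (start z).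
Proof.
apply/(sewingE Z0 true); rewrite vec2_0 two_cycles_vx two_cycles_vy vec2_0 vec2_1; split=> //.
by rewrite mulr_gt0//; move: z1; lra.
Qed.

Lemma sewing_middle : sewing_region Z0 (middle z).
Proof.
apply/(sewingE Z0 true); rewrite vec2_0 two_cycles_vx two_cycles_vy vec2_0 vec2_1; split=> //.
by rewrite nmulr_rgt0; move: z1 zi hz; lra.
Qed.

Lemma cycle_set_motion : exists phi per, [/\ periodic_motion phi per, range phi = cycle_set,
  enters_Y phi 0, exists t, after_side false phi t & phi 0 = start z].
Proof.
have lz : 0 < ln z by rewrite ln_gt0.
have [||||||||phi [L lp hY hX [a0 ah rg]]] :=
    @closing R Z0 two_cycles_S two_cycles_C two_cycles_fundamental two_cycles_det (start z) (middle z) pi (ln z) => //.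
- exact: pi_gt0.
- exact: sflow_right_half.
- exact: sflow_left_back.
- move=> r /andP[r0 rpi]; rewrite sflow_right vec2_0 mulr_ge0//; last by move: z1; lra.
  by rewrite mulr_ge0 ?expR_ge0// sin_ge0_pi// r0 rpi.
- move=> r /expR_itv/andP[e1 e2]; rewrite sflow_left// vec2_0 mulr_ge0_le0// ?subr_ge0//.
  by rewrite subr_le0 ler_pdivrMr// mul1r.
- exact: sewing_start.
- exact: sewing_middle.
have p0 : phi 0 = start z by rewrite hY ?(sflow0 two_cycles_fundamental)// lexx pi_ge0.
exists phi, (pi + ln z); split=> //; last 2 first.
- by split; rewrite ?p0//; exact: sewing_start.
- by exists pi.
split=> //; first by rewrite addr_gt0 ?pi_gt0.
exists pi; rewrite p0 hY ?pi_ge0 ?lexx// sflow_right_half => /(congr1 (fun v : 'cV[R]_2 => v 1 0)).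
by rewrite /= !vec2_1; move: z1 zi; lra.
Qed.

Lemma cycle_set_sigma p : cycle_set p -> p 0 0 = 0 -> p = start z \/ p = middle z.
Proof.
case=> -[r /= hr <-].
  have /andP[r0 rp] := hr.
  rewrite {1}sflow_right vec2_0 => /eqP; rewrite mulf_eq0 mulf_eq0 (gt_eqF (expR_gt0 _))/=.
  move=> /orP[/eqP s0|/eqP]; last by move=> k; exfalso; move: z1 k; lra.
  have [->|rn] := eqVneq r 0; first by left; rewrite (sflow0 two_cycles_fundamental).
  have [->|rn'] := eqVneq r pi; first by right; rewrite sflow_right_half.
  have : 0 < sin r by rewrite sin_gt0_pi// !lt_neqAle r0 rp eq_sym rn rn'.
  by rewrite s0 ltxx.
rewrite {1}sflow_left// vec2_0 => /eqP; rewrite mulf_eq0 !subr_eq0 => /orP[/eqP e|/eqP e].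
  by right; rewrite sflow_left// e /middle; congr vec2; field.
left; have {}e : expR r = z by rewrite -[LHS](divfK zn) e mul1r.
by rewrite sflow_left// e /start; congr vec2; field.
Qed.

(* The piecewise defining function of [cycle_set]: a quadratic form vanishing on the
   parabola on the left, the spiral equation on the right, multiplied by the
   positive factor that makes both agree on [Sigma]. *)
Definition parab (x y : R) :=
  (y - 2 * x + 2) ^+ 2 - (z + 1) ^+ 2 / z * (y - x + 1).
Definition gauge (y : R) := Num.max (y - (z^-1 - 1)) (1 / 8 * (z - 1 - y)).
(** Clamping [x] on each side and subtracting the common value on Sigma yields a single continuous
    formula, with no gluing of two functions. *)
Definition level p : R := parab (Num.min (p 0 0) 0) (p 1 0)
  + gauge (p 1 0) * (spiral beta (Num.max (p 0 0) 0) (p 1 0 + 1 / 3) - (z - 2 / 3))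
  - (p 1 0 - (z - 1)) * (p 1 0 - (z^-1 - 1)).

Lemma parab0 y : parab 0 y = (y - (z - 1)) * (y - (z^-1 - 1)).
Proof. by rewrite /parab; field. Qed.

Lemma gauge_gt0 y : 0 < gauge y.
Proof.
rewrite /gauge lt_max; have [h|h] := ltP (z^-1 - 1) y; first by rewrite subr_gt0 h.
by apply/orP; right; move: h z1 zi; lra.
Qed.

(** The spiral bracket on Sigma is [y - (z - 1)] above the centre and, by the closing condition,
    [- 8 (y - (1/z - 1))] below it; [gauge] supplies the missing factor. Its two branches meet at
    the centre [y = - 1/3], again by the closing condition, so their maximum selects the right
    one. *)
Lemma gauge_spiral y :
  gauge y * (spiral beta 0 (y + 1 / 3) - (z - 2 / 3)) = parab 0 y.
Proof.
have e8 : expR (beta * pi) = 8.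
  by rewrite /beta divfK ?gt_eqF ?pi_gt0// lnK// posrE; lra.
rewrite parab0 spiral0; have [h|h] := leP 0 (y + 1 / 3).
  have -> : gauge y = y - (z^-1 - 1).
    by rewrite /gauge; apply: max_l; move: h hz; lra.
  by field.
have -> : gauge y = 1 / 8 * (z - 1 - y).
  by rewrite /gauge; apply: max_r; move: h hz; lra.
rewrite e8; have -> : z^-1 - 1 = - (1 / 3) - (1 / 8) * (z - 2 / 3) by move: hz; lra.
by field.
Qed.

Lemma level_left p : p 0 0 <= 0 -> level p = parab (p 0 0) (p 1 0).
Proof.
move=> h; rewrite /level (min_l h) (max_r h) gauge_spiral parab0.
by rewrite addrK.
Qed.

Lemma level_right p : 0 <= p 0 0 -> level p =
  gauge (p 1 0) * (spiral beta (p 0 0) (p 1 0 + 1 / 3) - (z - 2 / 3)).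
Proof.
move=> h; rewrite /level (min_r h) (max_l h) parab0.
by rewrite addrAC subrr add0r.
Qed.

Lemma level_eq0 p : level p = 0 -> cycle_set p.
Proof.
have [h|/ltW h] := leP (p 0 0) 0.
  rewrite level_left// /parab; set x := p 0 0 in h *; set y := p 1 0 => E.
  (* [y - 2 * x + 2] and [y - x + 1] are eigencoordinates of the node, growing like [expR t] and
     [expR (2 * t)]. On the arc from [middle z] they equal [(z + 1) / z * w] and [w ^+ 2 / z] with
     [w = expR t], so [w] recovers the time. *)
  pose w := (y - 2 * x + 2) * z / (z + 1).
  have z1n : z + 1 != 0 by rewrite gt_eqF//; move: z0; lra.
  have EQ : y - 2 * x + 2 = (z + 1) / z * w by rewrite /w; field; rewrite zn z1n.
  have EP : y - x + 1 = w ^+ 2 / z.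
    have k0 : (z + 1) ^+ 2 / z != 0 by rewrite mulf_neq0 ?invr_eq0 ?expf_neq0.
    apply: (mulfI k0); have -> : (z + 1) ^+ 2 / z * (y - x + 1) = (y - 2 * x + 2) ^+ 2.
      by move: E; lra.
    by rewrite EQ; field.
  have Ex : x = (w - 1) * (w / z - 1).
    have -> : x = (y - x + 1) - (y - 2 * x + 2) + 1 by ring.
    by rewrite EQ EP; field.
  have Ey : y = w * (2 * w / z - z^-1 - 1).
    have -> : y = 2 * (y - x + 1) - (y - 2 * x + 2) by ring.
    by rewrite EQ EP; field.
  (* The condition [x <= 0] says exactly that the time [ln w] lies between 0 and [ln z]. *)
  have prod : (w - 1) * (w - z) <= 0.
    have -> : (w - 1) * (w - z) = x * z by rewrite Ex; field.
    by rewrite pmulr_lle0.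
  have w1 : 1 <= w by move: prod z1; nra.
  have wz : w <= z by move: prod z1; nra.
  have w0 : 0 < w by lra.
  right; exists (ln w); first by rewrite /= ln_ge0//= ler_ln// posrE.
  rewrite sflow_left// lnK//; apply: vec2P; first by rewrite vec2_0 -Ex.
  by rewrite vec2_1 -Ey.
rewrite level_right// => /eqP; rewrite mulf_eq0 gt_eqF ?gauge_gt0//= subr_eq0.
set x := p 0 0 in h *; set u := p 1 0 + 1 / 3 => /eqP E.
have r0 : 0 < rad x u.
  rewrite lt_def rad_ge0 andbT; apply/eqP => r0.
  by move: E; rewrite /spiral r0 mul0r; move: z1; lra.
have aitv := ang_itv h r0.
have Er : rad x u = expR (- beta * ang x u) * (z - 2 / 3).
  by rewrite -E /spiral mulrCA -expRD mulNr addNr expR0 mulr1.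
left; exists (ang x u) => //; rewrite sflow_right; apply: vec2P.
  by rewrite vec2_0 -[p 0 0]/x [in RHS](polar_x h r0) Er; ring.
rewrite vec2_1; have -> : p 1 0 = u - 1 / 3 by rewrite /u; ring.
by rewrite [in RHS](polar_u h r0) Er; ring.
Qed.

Lemma level_center : level (vec2 0 (- (1 / 3))) < 0.
Proof.
rewrite level_left ?vec2_0// parab0 vec2_1 pmulr_llt0; first by move: z1; lra.
by move: hz z1; lra.
Qed.

(** The inside of the parabola is unbounded, but its part in [x <= 0] is not: the eigencoordinates
    are confined there. On the right the radius is at most the value of [spiral]. *)
Lemma level_neg_bounded : exists M, forall p, level p < 0 -> `|p| <= M.
Proof.
pose K := (z + 1) ^+ 2 / z.
have K0 : 0 < K by rewrite divr_gt0// exprn_gt0//; move: z0; lra.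
exists (3 * K + 3 + (z + 1)) => p.
have norm2 M : `|p 0 0| <= M -> `|p 1 0| <= M -> `|p| <= M.
  move=> h0 h1; have M0 : 0 <= M by apply: le_trans h0.
  rewrite /Num.Def.normr/= mx_normrE (bigmax_le _ M0)//= => -[i j] _.
  by rewrite [j]ord1; have [->|->] := ord2P i.
have [h|/ltW h] := leP (p 0 0) 0.
  rewrite level_left// /parab -/K; set x := p 0 0 in h norm2 *; set y := p 1 0 in norm2 *.
  set Q := y - 2 * x + 2; set P := y - x + 1 => lt0.
  have PQ : P = Q + (x - 1) by rewrite /P /Q; ring.
  (* Negativity of the level means [Q ^+ 2 < K * P], and [x <= 0] gives [P <= Q - 1]. *)
  have Qlt : Q * (Q - K) < 0.
    have : K * P <= K * (Q - 1) by rewrite ler_pM2l//; move: PQ h; lra.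
    by move: lt0 K0; lra.
  have Q0 : 0 < Q by move: Qlt K0; nra.
  have QK : Q < K by move: Qlt K0; nra.
  have P0 : 0 < P.
    have k : 0 < K * P by have := sqr_ge0 Q; move: lt0 Q0; nra.
    by move: k; rewrite pmulr_rgt0.
  have Ey : y = 2 * P - Q by rewrite /P /Q; ring.
  by apply: norm2; apply/ler_normlP; split; move: PQ Ey z1 h Q0 QK P0 K0; lra.
rewrite level_right// pmulr_rlt0 ?gauge_gt0// subr_lt0.
set x := p 0 0 in h norm2 *; set u := p 1 0 + 1 / 3 => lt.
have r1 : rad x u <= z - 2 / 3.
  have [r0|rn] := leP (rad x u) 0; first by move: z1; lra.
  apply: le_trans (ltW lt); apply: spiral_ge_rad => //.
  exact/ltW/beta_gt0.
have hx := rad_gex x u; have hu := rad_geu x u.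
apply: norm2; first by move: hx r1 K0 z1; lra.
have -> : p 1 0 = u - 1 / 3 by rewrite /u; ring.
by move/ler_normlP : hu => [u1 u2]; apply/ler_normlP; split; move: r1 K0 z1 u1 u2; lra.
Qed.

Lemma level_continuous : continuous level.
Proof.
move=> p; pose x (q : 'cV[R]_2) := q 0 0; pose y (q : 'cV[R]_2) := q 1 0.
have cx : x q @[q --> p] --> x p by exact: (@coord_continuous _ _ _ 0 0 p).
have cy : y q @[q --> p] --> y p by exact: (@coord_continuous _ _ _ 1 0 p).
have cst (c : R) : (fun _ : 'cV[R]_2 => c) q @[q --> p] --> c.
  exact: (@cst_continuous 'cV[R]_2 R c p).
have cmin : Num.min (x q) 0 @[q --> p] --> Num.min (x p) 0.
  exact: (@continuous_min R 'cV[R]_2 x (fun=> 0) p cx (cst 0)).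
have cmax : Num.max (x q) 0 @[q --> p] --> Num.max (x p) 0.
  exact: (@continuous_max R 'cV[R]_2 x (fun=> 0) p cx (cst 0)).
have cg : gauge (y q) @[q --> p] --> gauge (y p).
  apply: (@continuous_max R 'cV[R]_2 (fun q => y q - (z^-1 - 1))
    (fun q => 1 / 8 * (z - 1 - y q)) p).
    exact: (cvgB cy (cst _)).
  exact: (cvgM (cst _) (cvgB (cst _) cy)).
have cS : spiral beta (Num.max (x q) 0) (y q + 1 / 3) @[q --> p] -->
    spiral beta (Num.max (x p) 0) (y p + 1 / 3).
  apply: (@spiral_cvg R beta (ltW beta_gt0) 'cV[R]_2 (nbhs p) _
    (fun q => Num.max (x q) 0) (fun q => y q + 1 / 3)).
  - by near=> q; rewrite le_max lexx orbT.
  - by rewrite le_max lexx orbT.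
  - exact: cmax.
  - exact: (cvgD cy (cst _)).
pose Q q := y q - 2 * Num.min (x q) 0 + 2.
have cQ : Q q @[q --> p] --> Q p.
  exact: (cvgD (cvgB cy (cvgM (cst 2) cmin)) (cst 2)).
have cP : (z + 1) ^+ 2 / z * (y q - Num.min (x q) 0 + 1) @[q --> p] -->
    (z + 1) ^+ 2 / z * (y p - Num.min (x p) 0 + 1).
  exact: (cvgM (cst _) (cvgD (cvgB cy cmin) (cst 1))).
have cR : gauge (y q) * (spiral beta (Num.max (x q) 0) (y q + 1 / 3) - (z - 2 / 3))
    @[q --> p] -->
    gauge (y p) * (spiral beta (Num.max (x p) 0) (y p + 1 / 3) - (z - 2 / 3)).
  exact: (cvgM cg (cvgB cS (cst _))).
have cT : (y q - (z - 1)) * (y q - (z^-1 - 1)) @[q --> p] -->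
    (y p - (z - 1)) * (y p - (z^-1 - 1)).
  exact: (cvgM (cvgB cy (cst _)) (cvgB cy (cst _))).
exact: (cvgB (cvgD (cvgB (cvgM cQ cQ) cP) cR) cT).
Unshelve. all: by end_near. Qed.

(** No Jordan curve argument: [level] is continuous, vanishes only on [cycle_set] and is negative at
    the centre, so by the intermediate value property it is negative on the whole component of the
    centre, and [level_neg_bounded] applies. *)
Lemma center_enclosed : enclosed cycle_set (vec2 0 (- (1 / 3))).
Proof.
set c := vec2 _ _.
have ngc : ~ cycle_set c.
  move=> /cycle_set_sigma; rewrite vec2_0 => /(_ erefl) [] /(congr1 (fun v : 'cV[R]_2 => v 1 0)).
    by rewrite /= !vec2_1; move: z1; lra.
  by rewrite /= !vec2_1; move: hz z1; lra.
split=> //; have [M hM] := level_neg_bounded.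
exists M; split=> [|N MN p Cp]; first exact: num_real.
rewrite /= (le_trans _ (ltW MN))//; apply: hM; rewrite ltNge; apply/negP => lp.
have lc := level_center; rewrite -/c in lc.
have Cc : connected_component (~` cycle_set) c c by apply: connected_component_refl.
have : connected (level @` connected_component (~` cycle_set) c).
  apply: connected_continuous_connected; first exact: component_connected.
  exact/continuous_subspaceT/level_continuous.
move=> /connected_intervalP /(_ (level c) (level p)) /(_ _ _ 0) [].
- by exists c.
- by exists p.
- by rewrite (ltW lc).
move=> q Cq /level_eq0; exact: (connected_component_sub Cq).
Qed.

End OneParameter.

(* This says that [exp (per A) - 1] is singular. *)
Lemma one_sided_trace phi per s : periodic_motion phi per -> (forall t, after_side s phi t) ->
  expR (trS s * per) + 1 = 2 * two_cycles_C s per - trS s * two_cycles_S s per.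
Proof.
move=> [L l0 lp [t nc]] h; have hf := aft_everywhere_flow two_cycles_fundamental two_cycles_det L h.
pose c := equil (sideA Z0 s) (sideb Z0 s).
pose w0 := phi 0 0 0 - c 0 0; pose w1 := phi 0 1 0 - c 1 0.
have E : sflow s per (phi 0) = phi 0 by rewrite -[RHS](lp 0) add0r [RHS](hf per 0) subr0.
have := fund_wronskian (two_cycles_fundamental s) per; set Cp := two_cycles_C s per; set Sp := two_cycles_S s per => wr.
pose A := sideA Z0 s.
have E0 : (Cp - 1 - Sp * A 1 1) * w0 + Sp * A 0 1 * w1 = 0.
  have := congr1 (fun v : 'cV[R]_2 => v 0 0) E; rewrite /= [X in X = _ -> _]vec2_0.
  by rewrite -/c -/w0 -/w1 -/Cp -/Sp -/A /w0; lra.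
have E1 : Sp * A 1 0 * w0 + (Cp - 1 - Sp * A 0 0) * w1 = 0.
  have := congr1 (fun v : 'cV[R]_2 => v 1 0) E; rewrite /= [X in X = _ -> _]vec2_1.
  by rewrite -/c -/w0 -/w1 -/Cp -/Sp -/A /w1; lra.
pose det := (Cp - 1 - Sp * A 1 1) * (Cp - 1 - Sp * A 0 0) - Sp * A 0 1 * (Sp * A 1 0).
have d0 : det * w0 = 0.
  transitivity ((Cp - 1 - Sp * A 0 0) * ((Cp - 1 - Sp * A 1 1) * w0 + Sp * A 0 1 * w1)
    - Sp * A 0 1 * (Sp * A 1 0 * w0 + (Cp - 1 - Sp * A 0 0) * w1)); first by rewrite /det; ring.
  by rewrite E0 E1 !mulr0 subrr.
have d1 : det * w1 = 0.
  transitivity ((Cp - 1 - Sp * A 1 1) * (Sp * A 1 0 * w0 + (Cp - 1 - Sp * A 0 0) * w1)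
    - Sp * A 1 0 * ((Cp - 1 - Sp * A 1 1) * w0 + Sp * A 0 1 * w1)); first by rewrite /det; ring.
  by rewrite E0 E1 !mulr0 subrr.
suff dz : det = 0.
  have : expR (trS s * per) + 1 - (2 * Cp - trS s * Sp) = det.
    by rewrite -wr /det /tr2 /det2 -/A; ring.
  by rewrite dz; lra.
apply/eqP/negPn/negP => dn; apply: nc.
have z0 : w0 = 0 by move/eqP: d0; rewrite mulf_eq0 (negbTE dn) => /eqP.
have z1 : w1 = 0 by move/eqP: d1; rewrite mulf_eq0 (negbTE dn) => /eqP.
have pc : phi 0 = c by apply: vec2P; apply/eqP; rewrite -subr_eq0; apply/eqP.
by rewrite (hf t 0) pc /c sflow_ctr.
Qed.

(** For the focus, with [e = expR (- beta * per) < 1], the trace relation reads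
    [e^2 + 1 = 2 e cos per <= 2 e], which is impossible. For the node, with [w = expR per > 1], it
    reads [(w - 1)^2 (w + 1) = 0]. *)
Lemma no_one_sided phi per s : periodic_motion phi per -> ~ (forall t, after_side s phi t).
Proof.
move=> cy h; have := one_sided_trace cy h; have l0 := motion_period_gt0 cy.
case: s {h}.
  rewrite trS_true /= /focus_S /focus_C !mul1r invr1 !mulr1.
  have -> : - beta *+ 2 * per = - beta * per + - beta * per by rewrite mulr2n; ring.
  rewrite expRD; set e := expR _; have e0 : 0 < e by exact: expR_gt0.
  have e1 : e < 1 by rewrite expR_lt1 mulNr oppr_lt0 mulr_gt0// beta_gt0.
  have := cos_le1 per; rewrite mulr2n; move: (cos per) (sin per) => a b a1 E.
  have k : e * e + 1 = 2 * (e * a) by move: E; lra.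
  have : e * a <= e by rewrite -[X in _ <= X]mulr1 ler_pM2l.
  by move: k e1; nra.
rewrite trS_false /= /node_S /node_C !mul1r.
have -> : (2 + 1) * per = per + per + per by ring.
have -> : 2 * per = per + per by ring.
rewrite !expRD; set w := expR per.
have w1 : 1 < w by rewrite expR_gt1.
have -> : (2 - 1 : R) = 1 by lra.
rewrite invr1 !mulr1 => E.
have : (w - 1) * (w - 1) * (w + 1) = 0 by move: E; lra.
have w2 : (w + 1 == 0) = false by apply: gt_eqF; move: w1; lra.
by move/eqP; rewrite !mulf_eq0 subr_eq0 (gt_eqF w1) w2.
Qed.

(** With [z = expR tau] the X-arc returns to Sigma when [(z - 1) ((v + 1) z - 1) = 0]; as [z > 1],
    this gives [v = 1/z - 1] and [w = z - 1], and the half-turn of Y then leaves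
    [(z - 2) (z - 4) = 0]. *)
Lemma entry_value phi per t : periodic_motion phi per -> (exists t, after_side false phi t) ->
  enters_Y phi t -> phi t 1 0 = 2 - 1 \/ phi t 1 0 = 4 - 1.
Proof.
move=> cy lv en.
have [h [tau [ho a _ _]]] := entry_arc two_cycles_fundamental two_cycles_det two_cycles_osc two_cycles_discontinuous two_cycles_ctr cy lv en.
have hp := osc_uniq (two_cycles_fundamental true) ho two_cycles_focus; subst h.
have rt : expR (trS true * pi / 2) = 1 / 8.
  by rewrite -expR_beta trS_true mulr2n; congr expR; field.
rewrite rt /force ctr_true ctr_false !two_cycles_vx !vec2_1 detS_false vec2_0 !mulr1 in a.
set w := phi t 1 0 in a *; set v := _ - _ * _ in a.
have t0 := arc_tau a; have x0 := arc_x a; have x1 := arc_x' a; have w0 := arc_w a.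
move: x0 x1; rewrite /Wf trS_false /= /node_S /node_C !mul1r.
have -> : 2 * tau = tau + tau by ring.
have -> : (2 - 1 : R) = 1 by lra.
rewrite invr1 expRD; set z := expR tau => x0 x1.
have z1 : 1 < z by rewrite expR_gt1.
have zv : (v + 1) * z = 1.
  have : (z - 1) * ((v + 1) * z - 1) = 0 by rewrite -x0; field.
  by move/eqP; rewrite mulf_eq0 subr_eq0 (gt_eqF z1) subr_eq0 => /eqP.
have wz : w = z - 1.
  have -> : w = 2 * z * ((v + 1) * z) - v * z - 2 * z by rewrite -x1; ring.
  by have : v * z = 1 - z by [move: zv; lra]; rewrite zv => ->; ring.
have : (z - 2) * (z - 4) = 0.
  have : (v + 1) * z * 8 = 8 by rewrite zv mul1r.
  by rewrite /v wz; lra.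
move/eqP; rewrite mulf_eq0 !subr_eq0 => /orP[/eqP e|/eqP e].
  by left; move: wz e; lra.
by right; move: wz e; lra.
Qed.

Definition is_root (z : R) := z = 2 \/ z = 4.

Lemma root_gt1 z : is_root z -> 1 < z. Proof. by case=> ->; lra. Qed.

Lemma root_closing z : is_root z -> z^-1 - 1 + 1 / 3 = - (1 / 8) * (z - 2 / 3).
Proof. by case=> ->; field. Qed.

(** The complete list of non-sliding periodic orbits, from which isolation follows: a crossing one
    has one of two entry velocities and by [same_entry] is the cycle built from it. *)
Lemma nonsliding_periodic g : periodic_orbit Z0 g -> non_sliding Z0 g ->
  exists2 z, is_root z & g = cycle_set z.
Proof.
move=> po ns; have [phi [per [cy ->]]] := periodic_orbit_motion two_cycles_fundamental two_cycles_det po ns.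
case: (motion_cases two_cycles_fundamental two_cycles_det two_cycles_discontinuous cy) => [[s h]|[lv [t en]]].
  by case: (no_one_sided cy h).
have [z rz Ez] : exists2 z, is_root z & phi t 1 0 = z - 1.
  by case: (entry_value cy lv en) => E; [exists 2|exists 4] => //; [left|right].
exists z => //.
have [psi [per' [cy' <- en' lv' p0]]] := cycle_set_motion (root_gt1 rz) (root_closing rz).
apply: (same_entry two_cycles_fundamental two_cycles_det two_cycles_osc two_cycles_discontinuous two_cycles_ctr cy cy' lv en en').
by rewrite p0 !two_cycles_vx Ez vec2_1.
Qed.

Lemma cycle_set_start z : is_root z -> cycle_set z (start z).
Proof.
move=> rz; have [psi [per' [_ <- _ _ <-]]] := cycle_set_motion (root_gt1 rz) (root_closing rz).
by exists 0.
Qed.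

Lemma start_cycle_set z z' : is_root z -> is_root z' -> cycle_set z (start z') -> z = z'.
Proof.
move=> rz rz' /(cycle_set_sigma (root_gt1 rz) (root_closing rz)).
have k1 := root_gt1 rz; have k2 := root_gt1 rz'.
rewrite vec2_0 => /(_ erefl) [] /(congr1 (fun v : 'cV[R]_2 => v 1 0)); rewrite /= !vec2_1; first by lra.
have : z^-1 < 1 by rewrite invf_lt1//; lra.
by move=> k3 k4; exfalso; lra.
Qed.

(** On Sigma the product of the two first components is [y (y + 1/3)], negative only between its
    roots. The segment is taken closed so that its complement is open. *)
Definition slide : set 'cV[R]_2 := [set p | p 0 0 = 0 /\ - (1 / 3) <= p 1 0 <= 0].

Lemma sliding_sub : escaping_region Z0 `|` sliding_region Z0 `<=` slide.
Proof.
move=> p h; have [x0 prod] : p 0 0 = 0 /\ sfield false p 0 0 * sfield true p 0 0 < 0.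
  case: h => -[s h1 h2]; split=> //; first by rewrite nmulr_rlt0.
  by rewrite pmulr_rlt0.
split=> //; move: prod; rewrite two_cycles_vx two_cycles_vy x0 mulr0 add0r => prod.
by apply/andP; split; move: prod; nra.
Qed.

Lemma slide_closed : closed slide.
Proof.
have -> : slide = (fun p : 'cV[R]_2 => p 0 0) @^-1` [set 0] `&`
    (fun p : 'cV[R]_2 => p 1 0) @^-1` `[- (1 / 3), 0]%classic.
  apply/seteqP; split=> p; rewrite /slide /= in_itv /=; exact.
apply: closedI; apply: preimage_closed.
- by move=> p _; exact: (@coord_continuous _ _ _ 0 0 p).
- exact: closed_eq.
- by move=> p _; exact: (@coord_continuous _ _ _ 1 0 p).
- exact: interval_closed.
Qed.

Lemma cycle_set_slide z p : is_root z -> cycle_set z p -> ~ slide p.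
Proof.
move=> rz gp [x0 /andP[y1 y2]]; have k1 := root_gt1 rz; have k2 := root_closing rz.
case: (cycle_set_sigma k1 k2 gp x0) => E; move: y1 y2; rewrite E vec2_1; first by lra.
by move: k2 k1; lra.
Qed.

(** The isolating neighbourhood omits the segment [slide] and one point of the other cycle: a
    periodic orbit inside it is non-sliding, hence one of the two cycles, and not the other one. *)
Lemma cycle_set_limit_cycle z : is_root z -> limit_cycle Z0 (cycle_set z) /\ non_sliding Z0 (cycle_set z).
Proof.
move=> rz; have [psi [per' [cy' E _ _ _]]] := cycle_set_motion (root_gt1 rz) (root_closing rz).
have ns g : g `<=` ~` slide -> non_sliding Z0 g.
  by move=> gs; apply/seteqP; split=> // p [/gs np /sliding_sub].
split; last by apply: ns => p gp; exact: cycle_set_slide gp.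
split; first by rewrite -E; exact: (motion_periodic_orbit two_cycles_fundamental two_cycles_det cy').
(* The other root, since the roots 2 and 4 have sum 6. *)
have rz' : is_root (6 - z) by case: rz => ->; [right|left]; lra.
have zz' : z <> 6 - z by case: rz => ->; lra.
exists (~` slide `&` ~` [set start (6 - z)]); split.
- apply: openI; apply: closed_openC; first exact: slide_closed.
  exact: accessible_closed_set1 (hausdorff_accessible (@norm_hausdorff _ _)) _.
- move=> p gp; split; first exact: cycle_set_slide gp.
  by move=> Ep; rewrite Ep in gp; exact: (zz' (start_cycle_set rz rz' gp)).
- move=> g' po sub.
  have [z2 rz2 E2] := nonsliding_periodic po (ns g' (fun p gp => (sub p gp).1)).
  have [zE|nz] := eqVneq z2 z; first by rewrite E2 zE.
  have z26 : z2 = 6 - z by move: rz rz2 nz => [->|->] [->|->]; rewrite ?eqxx//; lra.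
  have := cycle_set_start rz2; rewrite -E2 => /sub[_]; rewrite z26.
  by case.
Qed.

Lemma cycle_set_counted z : is_root z -> counted_limit_cycles Z0 (cycle_set z).
Proof.
move=> rz; have [lc ns] := cycle_set_limit_cycle rz; split=> //; left.
have eY : equil (sideA Z0 true) (sideb Z0 true) = vec2 0 (- (1 / 3)) := ctr_true.
exists (vec2 0 (- (1 / 3))); split.
  split; last exact: center_enclosed (root_gt1 rz) (root_closing rz).
  right; split; last by rewrite /Splus /= /xcoord vec2_0.
  by rewrite -eY; exact: aff_equil (two_cycles_det true).
(* The equilibrium [(1, 0)] of the node is virtual, so the centre of the focus is the only
   candidate. *)
move=> p [[[h s]|[h s]] _].
  have Ep := aff_eq0 (two_cycles_det false) h; move: s; rewrite /Sminus /= /xcoord Ep.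
  by rewrite ctr_false vec2_0 => k; exfalso; move: k; lra.
by rewrite (aff_eq0 (two_cycles_det true) h) -eY.
Qed.

Lemma example_two_cycles : `I_2 #<= counted_limit_cycles Z0.
Proof.
pose f n : set 'cV[R]_2 := if n == 0%N then cycle_set 2 else cycle_set 4.
have r2 : is_root 2 by left.
have r4 : is_root 4 by right.
have finj : {in `I_2 &, injective f}.
  have ne : cycle_set 2 <> cycle_set 4.
    move=> E; have := cycle_set_start r2; rewrite E => /(start_cycle_set r4 r2).
    lra.
  move=> i j; rewrite !inE /= => i2 j2; case: i i2 => [|[|//]] _; case: j j2 => [|[|//]] _ //=.
  by move=> /esym.
rewrite -(card_le_eql (inj_card_eq finj)); apply: subset_card_le.
by move=> _ [n _ <-]; rewrite /f; case: ifP => _; exact: cycle_set_counted.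
Qed.

End Example.

Theorem theorem1 (R : realType) :
  exists N : nat, max_limit_cycles R N /\ (2 <= N <= 3)%N.
Proof.
apply: max_of_bounds; first exact: counted_le_three.
by exists two_cycles; [exact: two_cycles_class|exact: example_two_cycles].
Qed.
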